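(* Let $\mathbf{k}$ be an algebraically closed field of characteristic $\neq2$, let $G$ be a finite group whose order is coprime to $\operatorname{char}(\mathbf{k})$ if $\operatorname{char}(\mathbf{k})>0$, let $\mathcal{C}=\operatorname{Rep}(G)\boxtimes\mathrm{sVec}$ (representations over $\mathbf{k}$), and let $\Gamma=G\times\mathbb{Z}/2$ with $\mathbb{Z}/2$ generated by $t$. Identify $\operatorname{Br}(\mathcal{C})\cong\operatorname{Pic}(\mathcal{C})=H^2_*(\Gamma,\mathbf{k}^\times)\times\mu_2$, and let $\iota:\mathcal{SW}(\mathcal{C})\hookrightarrow\operatorname{Br}(\mathcal{C})$ be the injective homomorphism sending the class $[V]$ of a symplectic object $V$ with $SV$ of finite length to the class of its Weyl algebra $A(V)$. Then $\iota$ is given by $$\iota([X\otimes\psi])=(\beta_X,(-1)^{\dim X})$$ for every orthogonal representation $X$ of $G$, and it is a group homomorphism. Thus $$\iota(\mathcal{SW}(\mathcal{C}))=\mathcal{SW}_+(\mathcal{C})\times\mu_2,$$ where $\mathcal{SW}_+(\mathcal{C})$ is the subgroup of $H^2_*(G\times\mathbb{Z}/2,\mathbf{k}^\times)$ generated by the classes $\beta_X$, $X$ ranging over orthogonal representations of $G$.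
   Context: $\mathcal{C}=\operatorname{Rep}(G)\boxtimes\mathrm{sVec}=\operatorname{Rep}(\Gamma,t)$ is the symmetric tensor category of representations of $G$ on finite-dimensional supervector spaces, with $t$ acting by the parity operator; $\psi$ is the odd line with trivial $G$-action, with a fixed identification $\psi\otimes\psi\cong\mathbf{1}$. An orthogonal representation of $G$ is a finite-dimensional representation $\rho:G\to O(X)$ over $\mathbf{k}$ with an invariant non-degenerate symmetric form; then $X\otimes\psi$ is a symplectic object. A symplectic object $V$ is an object with a non-degenerate form $B:V\otimes V\to\mathbf{1}$ with $B\circ c_{V,V}=-B$ ($c$ the braiding). Its Weyl algebra $A(V)$ is the quotient of the tensor algebra $T(V)$ by the ideal generated by the image of $(\mathrm{id}-c_{V,V})-B$. $SV$ is the symmetric algebra of $V$ in $\mathcal{C}$. When $SV$ has finite length, $A(V)$ is an Azumaya algebra in $\mathcal{C}$ (i.e. $A\otimes A^{\rm op}\to\underline{\operatorname{End}}(A)=A\otimes A^*$ is an isomorphism). The Brauer group $\operatorname{Br}(\mathcal{C})$ is the group of Morita classes of Azumaya algebras under tensor product, isomorphic to the Picard group $\operatorname{Pic}(\mathcal{C})$ of invertible $\mathcal{C}$-module categories via $A\mapsto A$-mod. The symplectic Witt group $\mathcal{SW}(\mathcal{C})$ is the abelian group generated by classes $[V]$ of symplectic objects $V$ with $SV$ of finite length, with $[V\oplus W]=[V]+[W]$ and $[V]=0$ whenever $A(V)\cong\underline{\operatorname{End}}(S)$ for some $S\in\mathcal{C}$. In the present case it is generated by the classes $[X\otimes\psi]$,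 $X$ an orthogonal representation of $G$. $H^2_*(\Gamma,\mathbf{k}^\times)$ is the set $H^2(\Gamma,\mathbf{k}^\times)$ (trivial action) with multiplication defined on 2-cocycles by $$(\beta*\gamma)(x,y)=(-1)^{\varepsilon_\beta(x)\varepsilon_\gamma(y)}\beta(x,y)\gamma(x,y),$$ where $\varepsilon_\beta:\Gamma\to\mathbb{Z}/2$ is the homomorphism with $(-1)^{\varepsilon_\beta(x)}=\beta(x,t)/\beta(t,x)$. The isomorphism $\operatorname{Pic}(\mathcal{C})=H^2_*(\Gamma,\mathbf{k}^\times)\times\mu_2$ (Carnovale's theorem; Davydov–Nikshych) is as follows. The second coordinate is the image under the functor forgetting the $G$-action in $\operatorname{Br}(\mathrm{sVec})=\mu_2$ (the non-trivial class being that of the Clifford superalgebra on one odd generator). An element of its kernel is represented by $\operatorname{End}(S)$, where $S$ is a supervector space with a projective action of $\Gamma$ with $t$ acting by the parity operator (up to scalar), inducing the $\Gamma$-action on $\operatorname{End}(S)$; its first coordinate is the class of the multiplier of this projective action. The element $(1,-1)$ is the class of the Clifford superalgebra on one odd generator on which $G$ acts trivially. For a representation $X$ of $G$, $X_-$ denotes its extension to $\Gamma$ with $t$ acting by $-1$. For an orthogonal representation $(X,\rho)$ let $\widetilde X:=X_-\oplus\mathbf{k}_-^{\dim X}$ (orthogonal sum, $\mathbf{k}$ the trivial representation of $G$ with its standard form), with $\Gamma$ acting by $\widetilde\rho(g,t^a)=(-1)^a(\rho(g)\oplus\mathrm{id}_{\mathbf{k}^{\dim X}})\in O(\widetilde X)$.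 Then $\beta_X\in H^2_*(\Gamma,\mathbf{k}^\times)$ is the class of the pullback by $\widetilde\rho$ of the central extension $1\to\mathbf{k}^\times\to\mathrm{Cliff}(\widetilde X)\to O(\widetilde X)\to1$. Here $\mathrm{Cliff}(\widetilde X)$ is the Clifford group: homogeneous invertible elements $u$ of the Clifford algebra $\mathrm{Cl}(\widetilde X)$ with $u\widetilde Xu^{-1}=\widetilde X$, mapping to $O(\widetilde X)$ by the twisted adjoint action $v\mapsto(-1)^{|u|}uvu^{-1}$. *)

(* Defs.v *)
From HB Require Import structures.
From mathcomp Require Import all_boot all_order all_algebra all_fingroup all_field.
From mathcomp Require Import mxrepresentation.
From mathcomp Require Import boolp classical_sets.
From mathcomp.multinomials Require Import monalg.
From mathcomp Require Import finmap ring.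

Set Implicit Arguments.
Unset Strict Implicit.
Unset Printing Implicit Defensive.

Import GRing.Theory.
Local Open Scope ring_scope.
Local Open Scope quotient_scope.

(* C = Rep(Gm, t): finite-dimensional k-linear representations of the finite
   group Gm, with braiding the super-flip for the grading by the eigenvalues
   +1 / -1 of the central involution t.  Rep(G) [x] sVec is
   Rep(G x Z/2, parity G) and sVec is Rep(Z/2, 1).  Objects are matrix
   representations rV, with x acting on column vectors by v |-> rV x *m v;
   algebras and bimodules live on abstract vector spaces. *)

Definition parity (gT : finGroupType) : gT * 'Z_2 := (1%g, 1%R).

Section TensorAlgebra.
Variables (k : fieldType) (n : nat).

Definition tensalg := {malg k[{fmonom 'I_n}]}.

Definition tens1 (v : 'cV[k]_n) : tensalg := \sum_i v i 0 *: << fmu i >>.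

(* k^n (x) k^n is 'M_n, with v (x) w = v *m w^T *)
Definition tens2 (M : 'M[k]_n) : tensalg :=
  \sum_i \sum_j M i j *: (<< fmu i >> * << fmu j >>).

Definition tensmap (a : 'M[k]_n) (p : tensalg) : tensalg :=
  \sum_(w <- msupp p) p@_w *: \prod_(i <- (w : seq 'I_n)) tens1 (col i a).

End TensorAlgebra.

Definition ideal_gen (R : nzRingType) (S : set R) : set R :=
  [set p | forall I : set R,
     [/\ I 0, forall a b, I a -> I b -> I (a - b),
         forall a p b, I p -> I (a * p * b) & forall s, S s -> I s] -> I p].

Definition is_quotient (k : fieldType) (n : nat) (S : set (tensalg k n))
    (A : falgType k) (pi : {lrmorphism tensalg k n -> A}) : Prop :=
  (forall a, exists p, pi p = a) /\ (forall p, pi p = 0 <-> ideal_gen S p).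

Section Symplectic.
Variables (k : fieldType) (Gm : finGroupType) (t : Gm).

(* M |-> c(M), where c (v (x) w) = (-1)^(|v||w|) w (x) v; for the parity      *)
(* operator P this is 1/2 (1(x)1 + P(x)1 + 1(x)P - P(x)P) followed by the flip *)
Definition braiding n (P M : 'M[k]_n) : 'M[k]_n :=
  (2^-1 *: (M + P *m M + M *m P^T - P *m M *m P^T))^T.

(* the value at M in V (x) V of the form v (x) w |-> v^T B w *)
Definition form_eval n (B M : 'M[k]_n) : k := \tr (B^T *m M).

Record symp := Symp {
  sdim : nat;
  srep : mx_representation k [set: Gm] sdim;
  sform : 'M[k]_sdim;
  sform_inv : forall x, (srep x)^T *m sform *m srep x = sform;
  sform_nondeg : sform \in unitmx;
  sform_skew : forall M,
    form_eval sform (braiding (srep t) M) = - form_eval sform M }.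

HB.instance Definition _ := gen_eqMixin symp.
HB.instance Definition _ := gen_choiceMixin symp.

Definition sym_rel (V : symp) : set (tensalg k (sdim V)) :=
  [set tens2 (M - braiding (srep V t) M) | M in [set: 'M_(sdim V)]].

Definition weyl_rel (V : symp) : set (tensalg k (sdim V)) :=
  [set tens2 (M - braiding (srep V t) M) - (form_eval (sform V) M)%:A
     | M in [set: 'M_(sdim V)]].

Arguments sym_rel : clear implicits.
Arguments weyl_rel : clear implicits.

(* subobjects of SV = T(V) / (sym_rel V), as Gm-stable subspaces of T(V) *)
Definition sym_subobject (V : symp) (W : set (tensalg k (sdim V))) : Prop :=
  [/\ forall p, ideal_gen (sym_rel V) p -> W p,
      forall (c : k) p q, W p -> W q -> W (c *: p + q)
    & forall x p, W p -> W (tensmap (srep V x) p)].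

Definition sym_finite_length (V : symp) : Prop :=
  exists N : nat, forall (m : nat) (W : nat -> set (tensalg k (sdim V))),
    (forall i, (i <= m)%N -> sym_subobject (W i)) ->
    (forall i, (i < m)%N -> (W i `<` W i.+1)%classic) -> (m <= N)%N.

(* h is an isomorphism of symplectic objects from V (+) W to U *)
Definition symp_sum_iso (U V W : symp) (h : 'M[k]_(sdim U, sdim V + sdim W))
    : Prop :=
  [/\ exists h', h *m h' = 1%:M /\ h' *m h = 1%:M,
      forall x, srep U x *m h = h *m block_mx (srep V x) 0 0 (srep W x)
    & h^T *m sform U *m h = block_mx (sform V) 0 0 (sform W)].

End Symplectic.

Arguments sym_rel {k Gm t} V.
Arguments weyl_rel {k Gm t} V.

Section Algebras.
Variables (k : fieldType) (Gm : finGroupType).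

Record calg := CAlg {
  calg_alg :> falgType k;
  cact : Gm -> 'AEnd(calg_alg);
  cact1 : forall a, cact 1%g a = a;
  cactM : forall x y a, cact (x * y)%g a = cact x (cact y a) }.

Lemma unit_calg1 (a : k^o) : (\1%AF : 'AEnd(k^o)) a = a.
Proof. by rewrite /= id_lfunE. Qed.

Definition unit_calg : calg :=
  @CAlg k^o (fun=> \1%AF) unit_calg1 (fun _ _ a => esym (unit_calg1 _)).

Record bimod (A B : calg) := Bimod {
  bmod :> vectType k;
  lmul : 'Hom(A, 'End(bmod));
  rmul : 'Hom(B, 'End(bmod));
  bact : Gm -> 'End(bmod);
  lmul1 : forall m, lmul 1 m = m;
  lmulM : forall a a' m, lmul (a * a') m = lmul a (lmul a' m);
  rmul1 : forall m, rmul 1 m = m;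
  rmulM : forall b b' m, rmul (b * b') m = rmul b' (rmul b m);
  lrmul : forall a b m, lmul a (rmul b m) = rmul b (lmul a m);
  bact1 : forall m, bact 1%g m = m;
  bactM : forall x y m, bact (x * y)%g m = bact x (bact y m);
  bact_l : forall x a m, bact x (lmul a m) = lmul (cact A x a) (bact x m);
  bact_r : forall x b m, bact x (rmul b m) = rmul (cact B x b) (bact x m) }.

(* f induces a surjective morphism of A-bimodules M (x)_B N -> A in C *)
Definition bimod_pairing (A B : calg) (M : bimod A B) (N : bimod B A)
    (f : 'Hom(M, 'Hom(N, A))) : Prop :=
  [/\ forall m b n, f (rmul M b m) n = f m (lmul N b n),
      forall a m n, f (lmul M a m) n = a * f m n,
      forall a m n, f m (rmul N a n) = f m n * a,
      forall x m n, f (bact M x m) (bact N x n) = cact A x (f m n)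
    & (<<[seq f m n | m <- vbasis {:M}, n <- vbasis {:N}]>> = fullv)%VS].

(* a strict Morita context in C, that is, mutually inverse bimodules in C *)
Definition morita (A B : calg) : Prop :=
  exists (M : bimod A B) (N : bimod B A)
         (f : 'Hom(M, 'Hom(N, A))) (g : 'Hom(N, 'Hom(M, B))),
    [/\ bimod_pairing f, bimod_pairing g,
        forall m n m', lmul M (f m n) m' = rmul M (g n m') m
      & forall n m n', lmul N (g n m) n' = rmul N (f m n') n].

Variable t : Gm.

Definition evenp (A : calg) (a : A) : A := 2^-1 *: (a + cact A t a).
Definition oddp (A : calg) (a : A) : A := 2^-1 *: (a - cact A t a).

(* x |-> (-1)^(|b||x|) a x b, the action of a (x) b in A (x) A^op on A *)
Definition sandwich (A : calg) (a b : A) : 'End(A) :=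
  linfun (fun x : A => a * (x * evenp b + cact A t x * oddp b)).

(* the linear map A (x) A^op -> End(A) sends a basis to a basis *)
Definition azumaya (A : calg) : Prop :=
  basis_of fullv [seq sandwich a b | a <- vbasis {:A}, b <- vbasis {:A}].

(* C is the tensor product A (x) B, with a (x) b = tau a b and                *)
(* (a (x) b) (a' (x) b') = (-1)^(|b||a'|) (a a') (x) (b b')                   *)
Definition is_tensor (A B C : calg) : Prop :=
  exists tau : 'Hom(A, 'Hom(B, C)),
    [/\ basis_of fullv [seq tau a b | a <- vbasis {:A}, b <- vbasis {:B}],
        tau 1 1 = 1,
        forall a b a' b', tau a b * tau a' b' =
          tau (a * a') (evenp b * b') + tau (a * cact A t a') (oddp b * b')
      & forall x a b, cact C x (tau a b) = tau (cact A x a) (cact B x b)].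

Record azu := Azu { azu_alg :> calg; azuP : azumaya azu_alg }.

(* characterizes Br(C), with cls A the Morita class of A, up to a unique
   isomorphism *)
Definition is_brauer_group (Br : groupType) (cls : azu -> Br) : Prop :=
  [/\ forall c, exists A, cls A = c,
      forall A B : azu, cls A = cls B <-> morita A B
    & forall A B C : azu, is_tensor A B C -> cls C = (cls A * cls B)%g].

Definition is_weyl (V : symp k t) (A : calg) : Prop :=
  exists pi : {lrmorphism tensalg k (sdim V) -> A},
    is_quotient (weyl_rel V) pi /\
    (forall x v, cact A x (pi (tens1 v)) = pi (tens1 (srep V x *m v))).

(* A = End(S), with x acting by conjugation by the invertible operator r x *)
Definition is_End (A : calg) n (r : Gm -> 'M[k]_n) : Prop :=
  exists f : 'Hom(A, 'M[k]_n),
    [/\ bijective f, f 1 = 1%:M, forall a b, f (a * b) = f a *m f b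
      & forall x a, f (cact A x a) = r x *m f a *m invmx (r x)].

End Algebras.

Section WittGroup.
Variables (k : fieldType) (Gm : finGroupType) (t : Gm).

Record fsymp := FSymp {
  fsymp_symp :> symp k t; fsympP : sym_finite_length fsymp_symp }.

HB.instance Definition _ := gen_eqMixin fsymp.
HB.instance Definition _ := gen_choiceMixin fsymp.

Notation free := {malg int[fsymp]}.

Inductive SW_rel : free -> Prop :=
| SW_sum (U V W : fsymp) (h : 'M[k]_(sdim U, sdim V + sdim W)) :
    symp_sum_iso h -> SW_rel (<< U >> - (<< V >> + << W >>))
| SW_split (V : fsymp) (A : calg k Gm) n (S : mx_representation k [set: Gm] n) :
    is_weyl V A -> is_End A S -> SW_rel << V >>.

Definition SW_null_prop (p : free) : Prop :=
  forall I : set free, [/\ I 0, forall a b, I a -> I b -> I (a - b)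
    & forall s, SW_rel s -> I s] -> I p.

Definition SW_null : pred free := fun p => `[< SW_null_prop p >].

Lemma SW_null_closed : zmod_closed SW_null.
Proof.
split=> [|a b /asboolP Ha /asboolP Hb]; apply/asboolP=> I hI.
  by case: (hI).
by have [_ h _] := hI; apply: h; [apply: Ha|apply: Hb].
Qed.

HB.instance Definition _ :=
  GRing.isZmodClosed.Build free SW_null SW_null_closed.

Definition SW_nullmod : zmodClosed free := GRing.ZmodClosed.clone _ SW_null _.

Definition SW : zmodType := @Quotient.quot free SW_nullmod.

Definition SW_class (V : fsymp) : SW := \pi_(@Quotient.quot free SW_nullmod) << V >>.

End WittGroup.

Lemma parityC (gT : finGroupType) (x : gT * 'Z_2) :
  (x * parity gT = parity gT * x)%g.
Proof. by case: x => x a; congr pair; rewrite ?mulg1 ?mul1g // Zp_mulgC. Qed.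

Lemma parity2 (gT : finGroupType) : (parity gT * parity gT = 1)%g.
Proof. by congr pair; rewrite ?mulg1 //; apply: val_inj. Qed.

Section Cohomology.
Variables (k : fieldType) (gT : finGroupType).

Notation Gm := (gT * 'Z_2)%type.
Notation t := (parity gT).
Implicit Types x y z : Gm.

Definition is_cocycle (b : {ffun Gm * Gm -> k}) : bool :=
  [forall p, b p != 0] &&
  [forall x, forall y, forall z,
     b (x, y) * b ((x * y)%g, z) == b (x, (y * z)%g) * b (y, z)].

Record cocycle := Cocycle { cofun :> {ffun Gm * Gm -> k}; _ : is_cocycle cofun }.
HB.instance Definition _ := [isSub for cofun].
HB.instance Definition _ := [Choice of cocycle by <:].
Implicit Types b c d : cocycle.

Lemma coneq0 b p : b p != 0.
Proof. by case: b => b /= /andP[/forallP]. Qed.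

Lemma cocycleE b x y z :
  b (x, y) * b ((x * y)%g, z) = b (x, (y * z)%g) * b (y, z).
Proof.
by case: b => b /= /andP[_ /forallP/(_ x)/forallP/(_ y)/forallP/(_ z)/eqP].
Qed.

Lemma cocycle_subproof (b : Gm -> Gm -> k) :
  (forall x y, b x y != 0) ->
  (forall x y z, b x y * b (x * y)%g z = b x (y * z)%g * b y z) ->
  is_cocycle [ffun p => b p.1 p.2].
Proof.
move=> b0 bE; apply/andP; split; first by apply/forallP=> p; rewrite ffunE.
by do 3!(apply/forallP=> ?); rewrite !ffunE /= bE.
Qed.

Definition mkcocycle (f : Gm -> Gm -> k) (f0 : forall x y, f x y != 0)
    (fE : forall x y z, f x y * f (x * y)%g z = f x (y * z)%g * f y z) : cocycle :=
  Cocycle (cocycle_subproof f0 fE).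

Definition chi b x : k := b (x, t) / b (t, x).

(* epsilon_b, as chi b takes its values in {1, -1} (see chiE) *)
Definition eps b x : bool := chi b x != 1.

Lemma chiM b x y : chi b (x * y)%g = chi b x * chi b y.
Proof.
have e1 : b ((x * y)%g, t) = b (x, (t * y)%g) * b (y, t) / b (x, y).
  by rewrite -parityC -cocycleE mulrC mulKf ?coneq0.
have e2 : b (x, (t * y)%g) = b (x, t) * b ((t * x)%g, y) / b (t, y).
  by rewrite -[in RHS]parityC cocycleE mulfK ?coneq0.
have e3 : b (t, (x * y)%g) = b (t, x) * b ((t * x)%g, y) / b (x, y).
  by rewrite cocycleE mulfK ?coneq0.
by rewrite /chi e1 e2 e3; field; rewrite !coneq0.
Qed.

Lemma chi_sqr b x : chi b x ^+ 2 = 1.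
Proof.
have e0 : b (x, 1%g) = b (1%g, x).
  have := cocycleE b x 1%g x; rewrite mulg1 mul1g mulrC => h.
  exact: (mulfI (coneq0 b (x, x)) h).
have e1 := cocycleE b x t t; have e2 := cocycleE b t t x.
have e3 := cocycleE b t x t.
rewrite parity2 !parityC e0 in e1 e2 e3.
have n1 := coneq0 b ((t * x)%g, t); have n2 := coneq0 b (t, (t * x)%g).
have n3 := coneq0 b (t, x).
apply/eqP; rewrite /chi expr_div_n -subr_eq0 -[1](divff (expf_neq0 2 n3)).
rewrite -mulrBl mulf_eq0 invr_eq0 expf_eq0 (negPf n3) /= orbF.
apply/eqP/(mulIf n1)/(mulIf n2); rewrite mul0r; apply/eqP.
have -> : (b (x, t) ^+ 2 - b (t, x) ^+ 2) * b ((t * x)%g, t) * b (t, (t * x)%g)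
  = b (x, t) * b ((t * x)%g, t) * (b (t, (t * x)%g) * b (x, t))
    - b (t, x) * b ((t * x)%g, t) * (b (t, (t * x)%g) * b (t, x)) by ring.
by rewrite e1 -e2 -e3; apply/eqP; ring.
Qed.

Lemma chi1P b x : (chi b x = 1) \/ (chi b x = -1).
Proof.
have /eqP := chi_sqr b x; rewrite sqrf_eq1 => /orP[] /eqP ->; by [left|right].
Qed.

Lemma chiE b x : (-1) ^+ eps b x = chi b x.
Proof.
rewrite /eps; case: eqP => //= /eqP h; case: (chi1P b x) => // e.
by rewrite e eqxx in h.
Qed.

Lemma epsM b x y : eps b (x * y)%g = eps b x (+) eps b y.
Proof.
rewrite /eps chiM; case: (chi1P b x) => ->; case: (chi1P b y) => ->;
  by rewrite ?mulrNN ?mul1r ?mulr1 ?eqxx ?addbb ?addbF ?addFb.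
Qed.

Lemma epst b : eps b t = false.
Proof. by rewrite /eps /chi divff ?coneq0 ?eqxx. Qed.

Fact mul_ac6 (a1 a2 a3 b1 b2 b3 : k) :
  a1 * a2 * a3 * (b1 * b2 * b3) = (a1 * b1) * (a2 * b2) * (a3 * b3).
Proof. by ring. Qed.

Fact comul_neq0 b c x y :
  (-1) ^+ (eps b x && eps c y) * b (x, y) * c (x, y) != 0.
Proof. by rewrite !mulf_neq0 ?signr_eq0 ?coneq0. Qed.

Fact comul_assoc b c x y z :
  (-1) ^+ (eps b x && eps c y) * b (x, y) * c (x, y) *
    ((-1) ^+ (eps b (x * y)%g && eps c z) * b ((x * y)%g, z) * c ((x * y)%g, z)) =
  (-1) ^+ (eps b x && eps c (y * z)%g) * b (x, (y * z)%g) * c (x, (y * z)%g) *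
    ((-1) ^+ (eps b y && eps c z) * b (y, z) * c (y, z)).
Proof.
rewrite !mul_ac6 !cocycleE !epsM; congr (_ * _ * _).
case: (eps b x); case: (eps b y); case: (eps c y); case: (eps c z);
  by rewrite /= ?expr0 ?expr1 ?mulrNN ?mulr1 ?mul1r.
Qed.

Definition comul b c : cocycle := mkcocycle (comul_neq0 b c) (comul_assoc b c).

Fact coone_neq0 x y : (1 : k) != 0.
Proof. exact: oner_neq0. Qed.

Fact coone_assoc (x y z : Gm) : (1 : k) * 1 = 1 * 1.
Proof. by []. Qed.

Definition coone : cocycle := mkcocycle coone_neq0 coone_assoc.

Fact coinv_neq0 b x y : (-1) ^+ (eps b x && eps b y) / b (x, y) != 0.
Proof. by rewrite mulf_neq0 ?signr_eq0 ?invr_eq0 ?coneq0. Qed.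

Fact coinv_assoc b x y z :
  (-1) ^+ (eps b x && eps b y) / b (x, y) *
    ((-1) ^+ (eps b (x * y)%g && eps b z) / b ((x * y)%g, z)) =
  (-1) ^+ (eps b x && eps b (y * z)%g) / b (x, (y * z)%g) *
    ((-1) ^+ (eps b y && eps b z) / b (y, z)).
Proof.
rewrite mulrACA [RHS]mulrACA -!invfM cocycleE !epsM; congr (_ / _).
case: (eps b x); case: (eps b y); case: (eps b z);
  by rewrite /= ?expr0 ?expr1 ?mulrNN ?mulr1 ?mul1r.
Qed.

Definition coinv b : cocycle := mkcocycle (coinv_neq0 b) (coinv_assoc b).

Lemma cocycle_eq b c : (forall x y, b (x, y) = c (x, y)) -> b = c.
Proof. by move=> h; apply: val_inj; apply/ffunP=> -[x y]; exact: h. Qed.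

Lemma comulE b c x y :
  comul b c (x, y) = (-1) ^+ (eps b x && eps c y) * b (x, y) * c (x, y).
Proof. by rewrite ffunE. Qed.

Lemma cooneE x y : coone (x, y) = 1.
Proof. by rewrite ffunE. Qed.

Lemma coinvE b x y : coinv b (x, y) = (-1) ^+ (eps b x && eps b y) / b (x, y).
Proof. by rewrite ffunE. Qed.

Lemma eps_comul b c x : eps (comul b c) x = eps b x (+) eps c x.
Proof.
have -> : eps (comul b c) x = (chi b x * chi c x != 1).
  rewrite /eps /chi !comulE !epst andbF andFb expr0 !mul1r.
  by congr (_ != _); rewrite mulf_div.
rewrite /eps; case: (chi1P b x) => ->; case: (chi1P c x) => ->;
  by rewrite ?mulrNN ?mul1r ?mulr1 ?eqxx ?addbb ?addbF ?addFb.
Qed.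

Lemma eps_coone x : eps coone x = false.
Proof. by rewrite /eps /chi !cooneE divr1 eqxx. Qed.

Lemma eps_coinv b x : eps (coinv b) x = eps b x.
Proof.
rewrite /eps; congr (_ != _).
rewrite {1}/chi !coinvE epst andbF andFb expr0 !div1r.
have -> : chi b x = (chi b x)^-1.
  by case: (chi1P b x) => ->; rewrite ?invrN invr1.
by rewrite /chi invf_div invrK mulrC.
Qed.

Lemma comulA : associative comul.
Proof.
move=> b c d; apply: cocycle_eq => x y; rewrite !comulE !eps_comul.
move: (b _) (c _) (d _) => u v w.
by case: (eps b x); case: (eps c x); case: (eps c y); case: (eps d y);
  rewrite /= ?expr0 ?expr1; ring.
Qed.

Lemma comul1 b : comul b coone = b.
Proof.
by apply: cocycle_eq => x y; rewrite comulE cooneE eps_coone andbF expr0 mul1r mulr1.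
Qed.

Lemma comulV b : comul b (coinv b) = coone.
Proof.
apply: cocycle_eq => x y; rewrite comulE coinvE cooneE eps_coinv.
by rewrite mulrACA -expr2 sqrr_sign mul1r divff ?coneq0.
Qed.

Definition cohom b c : bool :=
  `[< exists f : Gm -> k, (forall x, f x != 0) /\
      forall x y, c (x, y) = b (x, y) * (f x * f y / f (x * y)%g) >].

Lemma cohom_equiv : equiv_class_of cohom.
Proof.
have sym b c : cohom b c -> cohom c b.
  move=> /asboolP[f [f0 fE]]; apply/asboolP; exists (fun x => (f x)^-1).
  split=> [x|x y]; first by rewrite invr_eq0.
  by rewrite fE; field; rewrite !f0 ?oner_neq0.
split=> [b|b c|c b d /asboolP[f [f0 fE]] /asboolP[g [g0 gE]]].
- by apply/asboolP; exists (fun=> 1); split=> *; rewrite ?oner_neq0 // !divr1 !mulr1.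
- by apply/idP/idP; exact: sym.
- apply/asboolP; exists (fun x => f x * g x).
  split=> [x|x y]; first by rewrite mulf_neq0.
  by rewrite gE fE; field; rewrite !f0 !g0 ?oner_neq0.
Qed.

Canonical cohom_equiv_rel := EquivRelPack cohom_equiv.
Definition H2star := {eq_quot cohom}.
HB.instance Definition _ := Choice.on H2star.
HB.instance Definition _ := EqQuotient.on H2star.

Definition H2class b : H2star := \pi_H2star b.

Lemma H2classP b c : cohom b c <-> H2class b = H2class c.
Proof. by split=> [h|/eqmodP //]; apply/eqmodP. Qed.

Lemma eps_cohom b c x : cohom b c -> eps b x = eps c x.
Proof.
move=> /asboolP[f [f0 fE]]; rewrite /eps; congr (_ != _).
rewrite /chi !fE parityC; move: (coneq0 b (x, t)) (coneq0 b (t, x)).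
move: (f0 x) (f0 t) (f0 (t * x)%g).
move: (b (x, t)) (b (t, x)) (f x) (f t) (f (t * x)%g).
by move=> u v a1 a2 a3 h1 h2 h3 h4 h5; field; rewrite ?h1 ?h2 ?h3 ?h4 ?h5 ?oner_neq0.
Qed.

Lemma cohom_comul b b' c c' :
  cohom b b' -> cohom c c' -> cohom (comul b c) (comul b' c').
Proof.
move=> hb hc; have [f [f0 fE]] := asboolP _ hb; have [g [g0 gE]] := asboolP _ hc.
apply/asboolP; exists (fun x => f x * g x).
split=> [x|x y]; first by rewrite mulf_neq0.
rewrite !comulE -(eps_cohom _ hb) -(eps_cohom _ hc) fE gE invfM.
by move: ((-1) ^+ _) (b _) (c _) (_^-1) (_^-1) => s u v a1 a2; ring.
Qed.

Definition H2mul (u v : H2star) : H2star := H2class (comul (generic_quotient.repr u) (generic_quotient.repr v)).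
Definition H2inv (u : H2star) : H2star := H2class (coinv (generic_quotient.repr u)).

Lemma reprH2 b : cohom (generic_quotient.repr (H2class b)) b.
Proof. by apply/H2classP; rewrite /H2class reprK. Qed.

Lemma H2mulE b c : H2mul (H2class b) (H2class c) = H2class (comul b c).
Proof. by apply/H2classP/cohom_comul; exact: reprH2. Qed.

Lemma H2ind (P : H2star -> Prop) : (forall b, P (H2class b)) -> forall u, P u.
Proof. by move=> h u; rewrite -[u]reprK; exact: h. Qed.

Lemma H2mulA : associative H2mul.
Proof.
by elim/H2ind=> b; elim/H2ind=> c; elim/H2ind=> d; rewrite !H2mulE comulA.
Qed.

Lemma H2mul1 : right_id (H2class coone) H2mul.
Proof. by elim/H2ind=> b; rewrite H2mulE comul1. Qed.

Lemma H2mulC : commutative H2mul.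
Proof.
elim/H2ind=> b; elim/H2ind=> c; rewrite !H2mulE; apply/H2classP/asboolP.
exists (fun x => (-1) ^+ (eps b x && eps c x)).
split=> [x|x y]; first by rewrite signr_eq0.
rewrite !comulE !epsM; move: (b _) (c _) => u v.
by case: (eps b x); case: (eps b y); case: (eps c x); case: (eps c y);
  rewrite /= ?expr0 ?expr1 ?invrN ?invr1; ring.
Qed.

Lemma H2mulV : right_inverse (H2class coone) H2inv H2mul.
Proof. by move=> u; rewrite -{1}[u]reprK H2mulE comulV. Qed.

HB.instance Definition _ := isGroup.Build H2star H2mulA
  (fun u => etrans (H2mulC _ u) (H2mul1 u)) H2mul1
  (fun u => etrans (H2mulC _ u) (H2mulV u)) H2mulV.

End Cohomology.

Section Mu2.
Variable k : fieldType.

Record mu2 := Mu2 { mu2_val :> k; _ : mu2_val ^+ 2 == 1 }.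
HB.instance Definition _ := [isSub for mu2_val].
HB.instance Definition _ := [Choice of mu2 by <:].
Implicit Types u v : mu2.

Lemma mu2P u : mu2_val u ^+ 2 = 1.
Proof. by case: u => u /= /eqP. Qed.

Fact mu2_one_subproof : (1 : k) ^+ 2 == 1. Proof. by rewrite expr1n. Qed.
Definition mu2_one := Mu2 mu2_one_subproof.

Fact mu2_mul_subproof u v : (mu2_val u * mu2_val v) ^+ 2 == 1.
Proof. by rewrite exprMn !mu2P mulr1. Qed.
Definition mu2_mul u v := Mu2 (mu2_mul_subproof u v).

Fact mu2_mulA : associative mu2_mul.
Proof. by move=> u v w; apply: val_inj; rewrite /= mulrA. Qed.
Fact mu2_mul1 : left_id mu2_one mu2_mul.
Proof. by move=> u; apply: val_inj; rewrite /= mul1r. Qed.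
Fact mu2_mul1r : right_id mu2_one mu2_mul.
Proof. by move=> u; apply: val_inj; rewrite /= mulr1. Qed.
Fact mu2_mulV : left_inverse mu2_one id mu2_mul.
Proof. by move=> u; apply: val_inj; rewrite /= -expr2 mu2P. Qed.

HB.instance Definition _ :=
  isGroup.Build mu2 mu2_mulA mu2_mul1 mu2_mul1r mu2_mulV mu2_mulV.

Fact mu2_sign_subproof n : ((-1 : k) ^+ n) ^+ 2 == 1.
Proof. by rewrite -exprM mulnC exprM sqrrN expr1n expr1n. Qed.
Definition mu2_sign (n : nat) : mu2 := Mu2 (mu2_sign_subproof n).

End Mu2.

Section Orthogonal.
Variables (k : fieldType) (gT : finGroupType).

Notation Gm := (gT * 'Z_2)%type.
Notation t := (parity gT).

Record orthrep := OrthRep {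
  odim : nat;
  orep : mx_representation k [set: gT] odim;
  oform : 'M[k]_odim;
  oform_sym : oform^T = oform;
  oform_nondeg : oform \in unitmx;
  oform_inv : forall x, (orep x)^T *m oform *m orep x = oform }.

Definition sgn (x : Gm) : k := (-1) ^+ (x.2 : nat).

Lemma sgnM x y : sgn (x * y)%g = sgn x * sgn y.
Proof.
rewrite /sgn -exprD -[RHS]signr_odd -[LHS]signr_odd; congr (_ ^+ nat_of_bool _).
by case: x y => [x [[|[|//]] ?]] [y [[|[|//]] ?]].
Qed.

Lemma sgn_sqr x : sgn x * sgn x = 1.
Proof. by rewrite /sgn -expr2 sqrr_sign. Qed.

(* X_- : the extension of X to G x Z/2 with t acting by -1 *)
Definition minus_mx n (r : gT -> 'M[k]_n) (x : Gm) : 'M[k]_n := sgn x *: r x.1.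

Lemma minus_mx_repr n (r : mx_representation k [set: gT] n) :
  mx_repr [set: Gm] (minus_mx r).
Proof.
split=> [|x y _ _]; first by rewrite /minus_mx repr_mx1 /sgn expr0 scale1r.
rewrite /minus_mx sgnM repr_mxM ?inE //.
by rewrite -scalemxAl -scalemxAr scalerA.
Qed.

Definition minus_rep n (r : mx_representation k [set: gT] n) :=
  MxRepresentation (minus_mx_repr r).

Hypothesis char2 : 2%N \notin [pchar k].
Variable X : orthrep.

Lemma two_neq0 : (2 : k) != 0.
Proof. by move: char2; rewrite inE /=. Qed.

Lemma tpsi_inv x :
  (minus_rep (orep X) x)^T *m oform X *m minus_rep (orep X) x = oform X.
Proof.
rewrite /= /minus_mx [(_ *: _)^T]linearZ /= -!scalemxAl -scalemxAr scalerA.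
rewrite sgn_sqr scale1r.
exact: oform_inv.
Qed.

Lemma tpsi_braiding (M : 'M_(odim X)) :
  braiding (minus_rep (orep X) t) M = - M^T.
Proof.
have -> : minus_rep (orep X) t = - 1%:M.
  by rewrite /= /minus_mx repr_mx1 /sgn /= expr1 scaleN1r.
have Pt : (- 1%:M)^T = - 1%:M :> 'M[k]_(odim X) by rewrite linearN /= trmx1.
rewrite /braiding Pt !mulNmx !mul1mx !mulmxN !mulmx1 opprK.
rewrite addrN add0r -opprD -mulr2n -scaler_nat scalerN scalerA.
by rewrite mulVf ?two_neq0 // scale1r linearN.
Qed.

Lemma tpsi_skew M :
  form_eval (oform X) (braiding (minus_rep (orep X) t) M)
    = - form_eval (oform X) M.
Proof.
rewrite tpsi_braiding /form_eval mulmxN linearN /= -trmx_mul mxtrace_tr.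
by rewrite mxtrace_mulC oform_sym.
Qed.

(* X (x) psi; under psi (x) psi = 1 its form is the form of X *)
Definition tpsi : symp k t := Symp tpsi_inv (oform_nondeg X) tpsi_skew.

Local Notation n := (odim X).
Local Notation I := (ideal_gen (sym_rel tpsi)).
Local Notation T := (tensalg k n).
Local Notation word s := (<< FMonom s >> : T).

Lemma ideal0 : I 0. Proof. by move=> J []. Qed.
Lemma idealB a b : I a -> I b -> I (a - b).
Proof. by move=> ha hb J hJ; case: (hJ) => _ h _ _; apply: h; [exact: ha|exact: hb]. Qed.
Lemma idealM a p b : I p -> I (a * p * b).
Proof. by move=> hp J hJ; case: (hJ) => _ _ h _; apply: h; exact: hp. Qed.
Lemma idealS s : sym_rel tpsi s -> I s.
Proof. by move=> hs J [_ _ _]; exact. Qed.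
Lemma idealD a b : I a -> I b -> I (a + b).
Proof.
move=> ha hb; rewrite -[b]opprK; apply: idealB => //.
by rewrite -sub0r; apply: idealB => //; exact: ideal0.
Qed.
Lemma idealMl a p : I p -> I (a * p).
Proof. by move/(@idealM a p 1); rewrite mulr1. Qed.
Lemma idealMr p b : I p -> I (p * b).
Proof. by move/(@idealM 1 p b); rewrite mul1r. Qed.
Lemma idealZ (c : k) p : I p -> I (c *: p).
Proof. by move/(idealMl (c%:A)); rewrite -scalerAl mul1r. Qed.

Lemma wordM s1 s2 : word (s1 ++ s2) = word s1 * word s2.
Proof.
rewrite malgM_def fgmulUU mulr1; congr (mkmalgU _ _).
by apply: val_inj => /=; rewrite fmM.
Qed.

Lemma fmuE' (i : 'I_n) : (<< fmu i >> : T) = word [:: i].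
Proof. by congr (mkmalgU _ _); apply: val_inj; rewrite fmuE. Qed.

Lemma tens2_delta i j :
  tens2 (delta_mx i j : 'M[k]_n) = word [:: i] * word [:: j].
Proof.
rewrite -(fmuE' i) -(fmuE' j).
rewrite /tens2 (bigD1 i) //= [X in _ + X]big1 ?addr0 => [|i' ni].
  rewrite (bigD1 j) //= [X in _ + X]big1 ?addr0 => [|j' nj].
    by rewrite mxE !eqxx scale1r.
  by rewrite mxE (negPf nj) andbF scale0r.
by rewrite big1 // => j' _; rewrite mxE (negPf ni) scale0r.
Qed.

Lemma tens2D (M N : 'M[k]_n) : tens2 (M + N) = tens2 M + tens2 N.
Proof.
rewrite /tens2 -big_split; apply: eq_bigr => i _.
by rewrite -big_split; apply: eq_bigr => j _; rewrite mxE scalerDl.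
Qed.

Lemma anticomm i j : I (word [:: i] * word [:: j] + word [:: j] * word [:: i]).
Proof.
have <- : tens2 (delta_mx i j - braiding (minus_rep (orep X) t) (delta_mx i j))
    = word [:: i] * word [:: j] + word [:: j] * word [:: i].
  by rewrite tpsi_braiding opprK trmx_delta tens2D !tens2_delta.
apply: idealS; exact: imageT.
Qed.

Lemma sandwich_eq (R : nzRingType) (a b c : R) :
  a * (b * c) * a = (a * b + b * a) * (c * a) - b * (a * c * a).
Proof. by rewrite mulrDl !mulrA addrK. Qed.

Lemma ideal_sandwich i s : I (word [:: i] * word s * word [:: i]).
Proof.
elim: s => [|j s IHs].
  rewrite -wordM cats0.
  have := idealZ 2^-1 (anticomm i i).
  by rewrite -mulr2n -scaler_nat scalerA mulVf ?two_neq0 // scale1r.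
rewrite -[j :: s]cat1s [word (_ ++ _)]wordM sandwich_eq.
apply: idealB; first by apply: idealMr; exact: anticomm.
by apply: idealMl; exact: IHs.
Qed.

Lemma ideal_word s : ~~ uniq s -> I (word s).
Proof.
elim: s => //= i s IHs; rewrite negb_and negbK => /orP[/splitPr[p1 p2]|/IHs h].
  have -> : word (i :: p1 ++ i :: p2) = word [:: i] * word p1 * word [:: i] * word p2.
    by rewrite -!wordM /= -!catA.
  by apply: idealMr; exact: ideal_sandwich.
by rewrite -[i :: s]cat1s [word (_ ++ _)]wordM; apply: idealMl.
Qed.

Local Notation Wd := {bseq n of 'I_n}.
Definition coeffs (p : T) : 'rV[k]_#|{: Wd}| :=
  \row_j p@_(FMonom (enum_val j : Wd)).

Lemma coeffs_sum N (c : 'I_N -> k) (p : 'I_N -> T) :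
  coeffs (\sum_j c j *: p j) = \sum_j c j *: coeffs (p j).
Proof.
apply/rowP=> i; rewrite !mxE raddf_sum summxE; apply: eq_bigr => j _.
by rewrite !mxE [LHS]mcoeffZ.
Qed.

Lemma coeffs0_ideal p : coeffs p = 0 -> I p.
Proof.
move=> h; rewrite [p]monalgE; apply: (big_ind I) => [||w _].
- exact: ideal0.
- exact: idealD.
have -> : << p@_w *g w >> = p@_w *: word w.
  apply/malgP=> w'; rewrite mcoeffZ !mcoeffU fmK.
  by case: (w == w'); rewrite ?mulr1n ?mulr0n ?mulr1 ?mulr0.
have [sw|sw] := leqP (size (w : seq _)) n.
  move/rowP/(_ (enum_rank (Bseq sw))): h; rewrite !mxE enum_rankK /= fmK => ->.
  by rewrite scale0r; exact: ideal0.
apply: idealZ; apply: ideal_word; apply: contraL sw => /card_uniqP <-.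
by rewrite -leqNgt -[X in (_ <= X)%N](card_ord n); exact: max_card.
Qed.

Lemma tpsi_finite : sym_finite_length tpsi.
Proof.
set N := #|{: Wd}|; exists N => m W Wsub Wlt; rewrite leqNgt; apply/negP=> ltNm.
have Wmono i j : (i <= j <= m)%N -> (W i `<=` W j)%classic.
  move=> /andP[]; elim: j => [|j IHj]; first by rewrite leqn0 => /eqP-> _ p.
  rewrite leq_eqVlt => /orP[/eqP-> _ p //|]; rewrite ltnS => lij ltjm.
  by apply: subset_trans (IHj lij (ltnW ltjm)) _; have [] := Wlt j ltjm.
have /choice[p pP] (i : 'I_N.+1) : exists p, W i.+1 p /\ ~ W i p.
  have [_ /existsNP[q /not_implyP[? ?]]] := Wlt i (leq_trans (ltn_ord i) ltNm).
  by exists q.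
pose P : 'M[k]_(N.+1, N) := \matrix_i coeffs (p i).
have : kermx P != 0.
  rewrite kermx_eq0 /row_free neq_ltn; apply/orP; left.
  by rewrite ltnS rank_leq_col.
case/rowV0Pn=> u /sub_kermxP uP u0.
have lin i (s : seq 'I_N.+1) (c : 'I_N.+1 -> k) : (i <= m)%N ->
    (forall j, j \in s -> c j != 0 -> W i (p j)) ->
    W i (\sum_(j <- s) c j *: p j).
  move=> lim h; have [hI hl _] := Wsub i lim.
  have W0 : W i 0 by apply: hI; exact: ideal0.
  elim: s h => [|j s IHs] h; first by rewrite big_nil.
  rewrite big_cons; have hs := IHs (fun j' sj' => h j' (mem_behead (s := j :: s) sj')).
  have [->|cj] := eqVneq (c j) 0; first by rewrite scale0r add0r.
  by apply: hl => //; apply: h; rewrite ?mem_head.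
have [j0 uj0] : exists j, u 0 j != 0.
  apply/existsP; rewrite -negb_forall; apply: contraNN u0 => /forallP h.
  by apply/eqP/rowP=> j; rewrite mxE; apply/eqP.
case: (@arg_maxnP _ j0 (fun j => u 0 j != 0) (fun j => nat_of_ord j) uj0) => i ui imax.
have lim : (i <= m)%N by apply: leq_trans (ltnW ltNm); rewrite -ltnS.
have [hI hl _] := Wsub i lim.
have qI : W i (\sum_j u 0 j *: p j).
  apply: hI; apply: coeffs0_ideal.
  rewrite coeffs_sum; apply: etrans uP.
  rewrite mulmx_sum_row; apply: eq_bigr => j _.
  by rewrite rowK.
have qi : W i (\sum_(j <- rem i (index_enum 'I_N.+1)) u 0 j *: p j).
  apply: lin => // j; rewrite mem_rem_uniq ?index_enum_uniq // inE => /andP[ji _] uj.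
  have lji : (j < i)%N by rewrite ltn_neqAle ji /=; exact: imax.
  have [h _] := pP j; apply: Wmono h; exact/andP.
have [_] := pP i; apply.
have -> : p i = (u 0 i)^-1 *: (\sum_j u 0 j *: p j) +
     - (u 0 i)^-1 *: \sum_(j <- rem i (index_enum 'I_N.+1)) u 0 j *: p j.
  rewrite (big_rem i) ?mem_index_enum //= scalerDr scalerA mulVf // scale1r.
  by rewrite scaleNr addrK.
have W0 : W i 0 by apply: hI; exact: ideal0.
by apply: (hl _ _ _ qI); rewrite -[_ *: _]addr0; apply: hl.
Qed.

Definition tpsi_f : fsymp k t := FSymp tpsi_finite.

End Orthogonal.

Section Clifford.
Variable k : fieldType.

Definition cliff_rel n (Q : 'M[k]_n) : set (tensalg k n) :=
  [set tens1 v * tens1 v - ((v^T *m Q *m v) 0 0)%:A | v in [set: 'cV_n]].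

Section CliffordGroup.
Variables (n : nat) (A : falgType k) (pi : {lrmorphism tensalg k n -> A}).

Definition homog (d : bool) (u : A) : Prop :=
  exists p, u = pi p /\ forall w : {fmonom 'I_n}, w \in msupp p -> odd (fdeg w) = d.

(* u is an element of degree d of the Clifford group, lying over a under the
   twisted adjoint action v |-> (-1)^d u v u^-1 *)
Definition clifford_over (a : 'M[k]_n) (d : bool) (u : A) : Prop :=
  [/\ homog d u, u \is a GRing.unit,
      [set u * pi (tens1 v) * u^-1 | v in [set: 'cV[k]_n]]%classic =
        [set pi (tens1 v) | v in [set: 'cV[k]_n]]%classic
    & forall v, (-1) ^+ d *: (u * pi (tens1 v) * u^-1) = pi (tens1 (a *m v))].

End CliffordGroup.
End Clifford.

Section Beta.
Variables (k : fieldType) (gT : finGroupType).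

Section BetaX.
Variable X : orthrep k gT.

(* X~ = X_- (+) k_-^(dim X) *)
Definition tilde_rep (x : gT * 'Z_2) : 'M[k]_(odim X + odim X) :=
  minus_mx (fun g => block_mx (orep X g) 0 0 1%:M) x.

Definition tilde_form : 'M[k]_(odim X + odim X) :=
  block_mx (oform X) 0 0 1%:M.

(* b is the factor set of the pulled back extension for the section x |-> u x *)
Definition is_beta (b : cocycle k gT) : Prop :=
  exists (A : falgType k)
         (pi : {lrmorphism tensalg k (odim X + odim X) -> A})
         (d : gT * 'Z_2 -> bool) (u : gT * 'Z_2 -> A),
    [/\ is_quotient (cliff_rel tilde_form) pi,
        forall x, clifford_over pi (tilde_rep x) (d x) (u x)
      & forall x y, u x * u y = b (x, y) *: u (x * y)%g].

(* is_beta determines the class of b; the default 1 is never used *)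
Definition betaX : H2star k gT :=
  xget 1%g [set c | exists2 b, is_beta b & c = H2class b].

End BetaX.

Definition SWplus : set (H2star k gT) :=
  [set c | forall K : set (H2star k gT),
     [/\ K 1%g, forall a b, K a -> K b -> K (a * b)%g, forall a, K a -> K a^-1%g
       & forall X, K (betaX X)] -> K c].

Notation Gm := (gT * 'Z_2)%type.

(* the Clifford superalgebra on one odd generator, with G acting trivially *)
Definition is_Cliff1 (A : calg k Gm) : Prop :=
  exists xi : A, [/\ basis_of fullv [:: 1; xi], xi * xi = 1
    & forall x, cact A x xi = sgn k x *: xi].

(* A = End(S), for S a super vector space with parity operator P and r a
   projective action of G x Z/2 on S with multiplier b *)
Definition is_projEnd (A : calg k Gm) (b : cocycle k gT) : Prop :=
  exists (n : nat) (P : 'M[k]_n) (r : Gm -> 'M[k]_n),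
    [/\ P *m P = 1%:M, exists c, r (parity gT) = c *: P,
        forall x, r x \in unitmx,
        forall x y, r x *m r y = b (x, y) *: r (x * y)%g
      & is_End A r].

Definition inZ2 (a : 'Z_2) : Gm := (1%g, a).

Lemma inZ2M a b : inZ2 (a * b)%g = (inZ2 a * inZ2 b)%g.
Proof. by congr pair; rewrite mulg1. Qed.

Definition forgetG (A : calg k Gm) : calg k 'Z_2 :=
  @CAlg _ _ A (cact A \o inZ2) (cact1 (c := A))
    (fun x y a => etrans (congr1 (fun z => cact A z a) (inZ2M x y))
                         (cactM _ _ a)).

(* The third clause reads the mu_2-coordinate off Br(sVec) = mu_2.  The last
   three clauses determine Phi. *)
Definition is_identification (Br : groupType) (cls : azu k (parity gT) -> Br)
    (Phi : Br -> H2star k gT * mu2 k) : Prop :=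
  [/\ bijective Phi,
      forall a b, Phi (a * b)%g = (Phi a * Phi b)%g,
      forall A : azu k (parity gT),
        (Phi (cls A)).2 = 1%g <-> morita (forgetG A) (unit_calg k 'Z_2),
      forall (A : azu k (parity gT)) b, is_projEnd A b ->
        Phi (cls A) = (H2class b, 1%g)
    & forall A : azu k (parity gT), is_Cliff1 A ->
        Phi (cls A) = (1%g, mu2_sign k 1)].

Definition sends_to_Weyl (Br : groupType) (cls : azu k (parity gT) -> Br)
    (iota : SW k (parity gT) -> Br) : Prop :=
  forall (V : fsymp k (parity gT)) (A : azu k (parity gT)),
    is_weyl V A -> iota (SW_class V) = cls A.

End Beta.

(* Main.v *)
(** For X orthogonal, the Weyl algebra of X (x) psi is the Clifford algebra of X
    with the form halved, and these algebras turn orthogonal sums into tensor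
    products in C.  Over an algebraically closed field a form has an orthonormal
    basis, so all of them reduce to algebras generated by anticommuting elements
    of square 1; an even number of such elements has linearly independent
    monomials in any algebra, which gives both the Azumaya property and, in even
    dimension, A = End(S).

    Adding dim X trivial summands makes the dimension even.  If u x is a factor
    system in the Clifford group for the twisted adjoint action, and w
    anticommutes with all vectors, with w ^ 2 = -1, then u x * w ^ |u x| is a
    projective action on S inducing the action on End(S), with the same
    multiplier.  Hence Phi [X (+) k^(dim X)] = (beta_X, 1), whichever factor
    system is chosen, and dividing by the class (1, -1) of each trivial summand
    gives the formula for X.

    An object V with SV of finite length is purely odd, so the generators of the
    Witt group are the [X (x) psi].  They are torsion, because H2star x mu2 has
    finite exponent and iota is injective; thus every element of the Witt group is
    some [X (x) psi], and additivity of iota follows from that on sums. *)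

Require Import Defs.
From HB Require Import structures.
From mathcomp Require Import all_boot all_order all_algebra all_fingroup all_field.
From mathcomp Require Import mxrepresentation.
From mathcomp.multinomials Require Import monalg.
From mathcomp Require Import finmap ring.
From mathcomp Require Import boolp classical_sets.

Set Implicit Arguments.
Unset Strict Implicit.
Unset Printing Implicit Defensive.

Import GRing.Theory.
Local Open Scope ring_scope.

(** An algebra given by [is_quotient] is a presentation, and nothing in it bounds the dimension from
    below. Both bounds come from counting: ordered monomials give at most [2 ^ n], and an explicit
    model built by successive doubling gives at least [2 ^ n]. After that, kernels, bases and
    isomorphisms are all obtained by comparing dimensions.

    Evenness matters because the product of an odd number of anticommuting generators commutes with
    all of them and may be a scalar, as for the single generator 1 of [k]. For an even number,
    conjugation by the generators tells all monomials apart.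

    The Weyl relation has v ^ 2 = B(v, v) / 2, while beta_X is defined with v ^ 2 = B(v, v); a
    square root of 1/2 lets one algebra carry both structures.

    The hypotheses give [iota] only on classes of objects, and a formal difference of classes is not
    visibly one. Torsion of [X (x) psi] is a statement about multiples of one class, for which
    additivity on direct sums suffices; so it can come before additivity of [iota] without
    circularity. *)

Section TensorAlgebra.
Variables (k : fieldType) (n : nat).
Local Notation T := (tensalg k n).
Local Notation word s := (<< FMonom s >> : T).

Lemma tens_scalerAl (c : k) (p q : T) : c *: (p * q) = (c *: p) * q.
Proof. exact: scalerAl. Qed.

(** A scalar sits on the empty word, which commutes with every word although words do not commute
    with each other. *)
Lemma tens_scalerAr (c : k) (p q : T) : p * (c *: q) = c *: (p * q).
Proof.
have mulC : p * c%:MP = c *: p.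
  rewrite malgM_def fgmulgU [in RHS](monalgE p) scaler_sumr; apply: eq_bigr => w _.
  by rewrite mulm1 mulrC; apply/malgP=> w'; rewrite mcoeffZ !mcoeffU mulrnAr.
by rewrite -[c *: q]mul_malgC mulrA mulC -scalerAl.
Qed.

Lemma tens_mulPl (c : k) (p p' q : T) : (c *: p + p') * q = c *: (p * q) + p' * q.
Proof. by rewrite [LHS]mulrDl [in RHS]tens_scalerAl. Qed.

Lemma tens_mulPr (c : k) (p q q' : T) : p * (c *: q + q') = c *: (p * q) + p * q'.
Proof. by rewrite [LHS]mulrDr [X in X + _]tens_scalerAr. Qed.

Lemma word_cat s1 s2 : word (s1 ++ s2) = word s1 * word s2.
Proof.
rewrite malgM_def fgmulUU mulr1; congr (mkmalgU _ _).
by apply: val_inj => /=; rewrite fmM.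
Qed.

Lemma word_cons i s : word (i :: s) = << fmu i >> * word s.
Proof. by rewrite fmuE -word_cat. Qed.

Lemma word_nil : word [::] = 1.
Proof. by congr (mkmalgU _ _); rewrite -fmoneE. Qed.

Lemma tens_sum_words (p : T) :
  p = \sum_(w <- msupp p) p@_w *: word w.
Proof.
rewrite {1}[p]monalgE; apply: eq_bigr => w _.
apply/malgP=> w'; rewrite mcoeffZ !mcoeffU fmK.
by case: (w == w'); rewrite ?mulr1n ?mulr0n ?mulr1 ?mulr0.
Qed.

Lemma tens_span (P : T -> Prop) :
    P 0 -> (forall c p q, P p -> P q -> P (c *: p + q)) ->
    (forall s, P (word s)) ->
  forall p, P p.
Proof.
move=> P0 Plin Pw p; rewrite [p]tens_sum_words.
elim: (enum_fset (msupp p)) => [|w s IHs]; first by rewrite big_nil.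
by rewrite big_cons; apply: Plin => //; case: w => w; exact: Pw.
Qed.

Lemma tens_ind (P : T -> Prop) :
    P 0 -> (forall c p q, P p -> P q -> P (c *: p + q)) -> P 1 ->
    (forall i p, P p -> P (<< fmu i >> * p)) ->
  forall p, P p.
Proof.
move=> P0 Plin P1 Pmul; apply: tens_span => // s.
elim: s => [|i s IHs]; first by rewrite word_nil.
by rewrite word_cons; exact: Pmul.
Qed.

Lemma tens1_delta i : tens1 (delta_mx i 0 : 'cV[k]_n) = << fmu i >>.
Proof.
rewrite /tens1 (bigD1 i) //= mxE !eqxx scale1r big1 ?addr0 // => j ji.
by rewrite mxE (negPf ji) scale0r.
Qed.

Lemma tens1_is_linear : linear (@tens1 k n).
Proof.
move=> c u v; rewrite /tens1 scaler_sumr -big_split; apply: eq_bigr => i _.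
by rewrite !mxE scalerDl scalerA.
Qed.
HB.instance Definition _ := GRing.isLinear.Build k 'cV[k]_n T _ (@tens1 k n) tens1_is_linear.

Section Lift.
Variables (B : algType k) (g : 'I_n -> B).

Definition lift_tens (p : T) : B :=
  \sum_(w <- msupp p) p@_w *: \prod_(i <- (w : seq 'I_n)) g i.

(** Summing beyond the support lets [p], [q] and [c *: p + q] be compared over one common set of
    words. *)
Lemma lift_tensE (d : {fset {fmonom 'I_n}}) p : (msupp p `<=` d)%fset ->
  lift_tens p = \sum_(w <- d) p@_w *: \prod_(i <- (w : seq 'I_n)) g i.
Proof.
move=> le; apply: big_fset_incl => // w _ /mcoeff_outdom ->; exact: scale0r.
Qed.

Lemma lift_tens_is_linear : linear lift_tens.
Proof.
move=> c p q; pose d := (msupp (c *: p + q) `|` msupp p `|` msupp q)%fset.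
rewrite !(@lift_tensE d) ?fsubsetUl ?fsubsetUr //; last first.
- by rewrite /d -fsetUA fsubsetUl.
- by rewrite /d fsetUAC fsubsetUr.
rewrite scaler_sumr -big_split; apply: eq_bigr => w _.
by rewrite mcoeffD mcoeffZ scalerDl scalerA.
Qed.
HB.instance Definition _ := GRing.isLinear.Build k T B _ lift_tens lift_tens_is_linear.

Lemma lift_word s : lift_tens (word s) = \prod_(i <- s) g i.
Proof.
rewrite (lift_tensE msuppU_le) big_seq_fset1 mcoeffUU scale1r; congr bigop.
Qed.

Lemma lift_fmu i : lift_tens << fmu i >> = g i.
Proof. by rewrite fmuE lift_word big_seq1. Qed.

Lemma lift_tensP c p q : lift_tens (c *: p + q) = c *: lift_tens p + lift_tens q.
Proof. exact: lift_tens_is_linear. Qed.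

Lemma lift_tens_is_monoid_morphism : monoid_morphism lift_tens.
Proof.
have l1 : lift_tens 1 = 1 by rewrite -word_nil lift_word big_nil.
have l0 : lift_tens 0 = 0 by rewrite linear0.
split=> // p q; move: p; apply: tens_span => [|c p p' hp hp'|s].
- by rewrite mul0r l0 mul0r.
- by rewrite (lift_tensP c p) [RHS]mulrDl -scalerAl -hp -hp' -lift_tensP tens_mulPl.
move: q; apply: tens_span => [|c q q' hq hq'|s'].
- by rewrite mulr0 l0 mulr0.
- by rewrite (lift_tensP c q) [RHS]mulrDr -scalerAr -hq -hq' -lift_tensP tens_mulPr.
by rewrite -word_cat !lift_word big_cat.
Qed.
HB.instance Definition _ :=
  GRing.isMonoidMorphism.Build T B lift_tens lift_tens_is_monoid_morphism.

Lemma lift_tens1 v : lift_tens (tens1 v) = \sum_i v i 0 *: g i.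
Proof.
by rewrite linear_sum; apply: eq_bigr => i _; rewrite linearZ /= lift_fmu.
Qed.

End Lift.

End TensorAlgebra.

(** * Linear algebra *)

Section Diagonalisation.
Variable k : closedFieldType.
Hypothesis char2 : (2 : k) != 0.

Lemma closed_sqrt (a : k) : exists b, b * b = a.
Proof.
have [b] := @solve_monicpoly k 2 (fun i => if i == 0%N then a else 0) isT.
rewrite !big_ord_recl big_ord0 /= mul0r !addr0 expr0 mulr1 expr2 => e.
by exists b.
Qed.

(** Polarisation: Q(v + w) - Q(v) - Q(w) is twice the bilinear form, and 2 is invertible. *)
Lemma symmetric_form_eq0 n (Q : 'M[k]_n) :
  Q^T = Q -> (forall v : 'cV_n, (v^T *m Q *m v) 0 0 = 0) -> Q = 0.
Proof.
move=> Qs Q0.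
have Qd (v w : 'cV_n) : (v^T *m Q *m w) 0 0 = 0.
  have addE (A B : 'M[k]_1) : (A + B) 0 0 = A 0 0 + B 0 0 by rewrite mxE.
  have e : (w^T *m Q *m v) 0 0 = (v^T *m Q *m w) 0 0.
    have <- : (v^T *m Q *m w)^T = w^T *m Q *m v by rewrite !trmx_mul trmxK Qs mulmxA.
    by rewrite mxE.
  have := Q0 (v + w); rewrite [(v + w)^T]linearD /= !mulmxDl !mulmxDr !addE.
  rewrite !Q0 e add0r addr0 -mulr2n -mulr_natl => /eqP.
  by rewrite mulf_eq0 (negPf char2) => /eqP.
apply/matrixP=> i j; rewrite [RHS]mxE -(Qd (delta_mx i 0) (delta_mx j 0)).
by rewrite trmx_delta -rowE -colE !mxE.
Qed.

(** Gram-Schmidt, one vector at a time: a vector of norm 1 becomes the first basis vector, the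
    unipotent [L] makes the others orthogonal to it, and the induction hypothesis applies to the
    Schur complement [C]. *)
Lemma orthonormal_basis n (Q : 'M[k]_n) :
  Q^T = Q -> Q \in unitmx -> exists2 P, P \in unitmx & P^T *m Q *m P = 1%:M.
Proof.
elim: n Q => [|n IHn] Q Qs Qu.
  by exists 1%:M; rewrite ?unitmx1 //; apply/matrixP=> -[].
have [v v0] : exists v : 'cV_n.+1, (v^T *m Q *m v) 0 0 != 0.
  apply: contrapT => /forallNP h.
  have Q0 : Q = 0.
    by apply: symmetric_form_eq0 => // v; have /negP/negPn/eqP := h v.
  by move: Qu; rewrite Q0 unitmxE det0 unitr0.
(* Normalising [v] takes a square root of the inverse of its norm; this is where algebraic closure
   enters. *)
have [c cc] := closed_sqrt ((v^T *m Q *m v) 0 0)^-1.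
pose w : 'cV_(1 + n) := c *: v.
have w1 : (w^T *m Q *m w) 0 0 = 1.
  rewrite /w [(c *: v)^T]linearZ /= -!scalemxAl -scalemxAr scalerA mxE cc mulVf //.
have w0 : w != 0.
  apply/eqP=> w0; move: w1; rewrite w0 mulmx0 mxE => /eqP.
  by rewrite eq_sym oner_eq0.
have [R Ru Rw] : exists2 R : 'M_(1 + n), R \in unitmx & col 0 R = w.
  have rw : \rank w = 1%N.
    by apply/eqP; rewrite eqn_leq rank_leq_col lt0n mxrank_eq0.
  (* [w] is [col_ebase w] times the first unit vector times the 1 by 1 matrix [row_ebase w]; placing
     that scalar in the corner makes [w] the first column. *)
  exists (col_ebase w *m block_mx (row_ebase w) 0 0 1%:M).
    rewrite unitmx_mul col_ebase_unit unitmxE det_ublock det1 mulr1.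
    exact: (row_ebase_unit w).
  rewrite -[RHS]mulmx_ebase rw -mulmxA colE -mulmxA; congr (_ *m _).
  have -> : delta_mx 0 0 = col_mx 1%:M 0 :> 'cV[k]_(1 + n).
    apply/colP=> i; rewrite !mxE; case: splitP => j ij; rewrite !mxE.
      have -> : i = 0 by apply: val_inj; rewrite /= ij ord1.
      by rewrite !ord1 !eqxx.
    by rewrite andbT; case: eqP => // i0; move: ij; rewrite i0.
  refine (etrans (mul_block_col (row_ebase w) 0 0 1%:M 1%:M 0) _).
  rewrite mulmx1 mulmx0 mul0mx ?mulmx0 !addr0.
  have -> : pid_mx 1 = col_mx 1%:M 0 :> 'M[k]_(1 + n, 1).
    exact: pid_mx_col.
  by apply/esym; refine (etrans (mul_col_mx 1%:M 0 (row_ebase w)) _); rewrite mul1mx mul0mx.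
pose N : 'M_(1 + n) := R^T *m Q *m R.
have Ns : N^T = N by rewrite /N !trmx_mul trmxK Qs mulmxA.
have Nu : N \in unitmx by rewrite !unitmx_mul unitmx_tr Ru Qu.
pose b := ursubmx N.
have NE : N = block_mx 1%:M b b^T (drsubmx N).
  rewrite -[LHS]submxK; congr block_mx.
    apply/matrixP=> i j; rewrite !ord1 [RHS]mxE eqxx mulr1n -w1 -Rw !mxE.
    rewrite !lshift0; apply: eq_bigr => l _.
    by rewrite !mxE; congr (_ * _); apply: eq_bigr => l' _; rewrite !mxE.
  by rewrite /b trmx_ursub Ns.
pose L : 'M_(1 + n) := block_mx 1%:M (- b) 0 1%:M.
have Lu : L \in unitmx by rewrite unitmxE det_ublock !det1 mulr1 unitr1.
pose C := drsubmx N - b^T *m b.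
have LN : L^T *m N *m L = block_mx 1%:M 0 0 C.
  rewrite NE /L tr_block_mx !trmx1 trmx0 linearN /= !mulmx_block.
  rewrite !mul1mx !mul0mx !mulmx1 !mulmx0 ?addr0 ?mulNmx ?mul1mx ?mulmx1.
  by rewrite !addNr mul0mx add0r [- _ + _]addrC.
have Cs : C^T = C.
  by rewrite /C linearB /= trmx_mul trmxK trmx_drsub Ns.
have Cu : C \in unitmx.
  have : L^T *m N *m L \in unitmx by rewrite 2!unitmx_mul unitmx_tr Lu Nu.
  by rewrite LN !unitmxE det_ublock det1 mul1r.
have [P Pu PC] := IHn C Cs Cu.
have Bu : (block_mx 1%:M 0 0 P : 'M_(1 + n)) \in unitmx.
  by rewrite unitmxE det_ublock det1 mul1r -unitmxE.
exists (R *m L *m block_mx 1%:M 0 0 P).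
  by rewrite 2!unitmx_mul Ru Lu; exact: Bu.
transitivity ((block_mx 1%:M 0 0 P)^T *m (L^T *m N *m L) *m block_mx 1%:M 0 0 P).
  by rewrite /N !trmx_mul !mulmxA.
rewrite LN tr_block_mx trmx1 !trmx0 !mulmx_block.
rewrite !mul1mx !mul0mx !mulmx1 !mulmx0 ?addr0 ?add0r PC.
rewrite mul0mx; exact: esym (scalar_mx_block 1 n 1).
Qed.

End Diagonalisation.

(** * A model of the Clifford algebra by iterated doubling *)

Section Double.
Variables (k : fieldType) (A : falgType k) (theta : {lrmorphism A -> A}).
Hypothesis thetaK : involutive theta.

(* A + A x, with x ^ 2 = 1 and x a = theta a x *)
Definition clifford_double of involutive theta : Type := (A * A)%type.
Local Notation D := (clifford_double thetaK).
HB.instance Definition _ := Vector.on D.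

Definition double_one : D := (1, 0).
Definition double_mul (p q : D) : D :=
  (p.1 * q.1 + p.2 * theta q.2, p.1 * q.2 + p.2 * theta q.1).

Fact double_mulA : associative double_mul.
Proof.
move=> [a b] [c d] [e f]; congr pair => /=.
  by rewrite !rmorphD !rmorphM /= thetaK !mulrDr !mulrDl !mulrA -!addrA; congr (_ + _);
    rewrite [RHS]addrC -addrA.
by rewrite !rmorphD !rmorphM /= thetaK !mulrDr !mulrDl !mulrA -!addrA; congr (_ + _);
    rewrite [RHS]addrC -addrA.
Qed.

Fact double_mul1l : left_id double_one double_mul.
Proof. by case=> a b; rewrite /double_mul /= !mul1r !mul0r !addr0. Qed.

Fact double_mul1r : right_id double_one double_mul.
Proof.
by case=> a b; rewrite /double_mul /= rmorph0 rmorph1 !mulr1 !mulr0 addr0 add0r.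
Qed.

Fact double_mulDl : left_distributive double_mul +%R.
Proof.
by move=> [a b] [c d] [e f]; congr pair; rewrite /= !mulrDl addrACA.
Qed.

Fact double_mulDr : right_distributive double_mul +%R.
Proof.
by move=> [a b] [c d] [e f]; congr pair; rewrite /= rmorphD !mulrDr addrACA.
Qed.

Fact double_one_neq0 : double_one != 0.
Proof. by apply/eqP=> -[/eqP]; rewrite oner_eq0. Qed.

HB.instance Definition _ := GRing.Zmodule_isNzRing.Build D
  double_mulA double_mul1l double_mul1r double_mulDl double_mulDr double_one_neq0.

Fact double_scaleAl (c : k) (p q : D) : c *: (p * q) = (c *: p : D) * q.
Proof.
case: p q => [a b] [e f]; by congr pair; rewrite /= scalerDr -!scalerAl.
Qed.
HB.instance Definition _ := GRing.Lmodule_isLalgebra.Build k D double_scaleAl.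

Fact double_scaleAr (c : k) (p q : D) : c *: (p * q) = p * (c *: q : D).
Proof.
by case: p q => [a b] [e f]; congr pair; rewrite /= !linearZ /= scalerDr -!scalerAr.
Qed.
HB.instance Definition _ := GRing.Lalgebra_isAlgebra.Build k D double_scaleAr.
HB.instance Definition _ := Algebra_isFalgebra.Build k D.

(** This extends the grading involution by negating the new generator too, so that the next doubling
    adds a generator anticommuting with all earlier ones. *)
Definition double_theta (p : D) : D := (theta p.1, - theta p.2).

Fact double_theta_is_linear : linear double_theta.
Proof.
move=> c [a b] [e f]; congr pair; rewrite /= !linearP //=.
Qed.
HB.instance Definition _ :=
  GRing.isLinear.Build k D D _ double_theta double_theta_is_linear.

Fact double_theta_is_monoid_morphism : monoid_morphism double_theta.
Proof.
split; first by congr pair; rewrite /= ?rmorph1 // rmorph0 oppr0.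
move=> [a b] [e f]; congr pair; rewrite /= rmorphD !rmorphM /=.
  by rewrite rmorphN mulrNN.
by rewrite mulrN mulNr opprD.
Qed.
HB.instance Definition _ :=
  GRing.isMonoidMorphism.Build D D double_theta double_theta_is_monoid_morphism.

Lemma double_thetaK : involutive double_theta.
Proof.
case=> a b; congr pair; rewrite /=; first exact: thetaK.
by rewrite rmorphN opprK; exact: thetaK.
Qed.

End Double.

(** The last clause says that the [f i] generate [A], as an induction principle by left
    multiplication; with the dimension it makes [A] a model of the Clifford algebra of a sum of [n]
    squares. *)
Definition clifford_system (k : fieldType) (A : falgType k) n (f : 'I_n -> A) :=
  [/\ forall i, f i * f i = 1,
      forall i j, i != j -> f i * f j = - (f j * f i),
      \dim {:A} = (2 ^ n)%N
    & forall P : A -> Prop, P 0 -> (forall c a b, P a -> P b -> P (c *: a + b)) ->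
        P 1 -> (forall i a, P a -> P (f i * a)) -> forall a, P a].

Lemma clifford_system_exists (k : fieldType) n :
  exists (A : falgType k) (f : 'I_n -> A), clifford_system f.
Proof.
(* The involution negating all generators is carried through the induction, since the doubling is
   formed with it. *)
suff [A [theta [thetaK [f [fT fS]]]]] : exists (A : falgType k)
    (theta : {lrmorphism A -> A}) (thetaK : involutive theta) (f : 'I_n -> A),
    (forall i, theta (f i) = - f i) /\ clifford_system f by exists A, f.
elim: n => [|n [A [theta [thetaK [f [fT [f1 fC fdim fG]]]]]]].
  exists k^o, idfun, (fun=> erefl), (fun=> 0); split; first by case.
  split; try by case.
    by rewrite regular_fullv dim_vline oner_eq0.
  move=> P P0 Plin P1 _ a.
  by have := Plin a 1 0 P1 P0; rewrite addr0 [_ *: _]mulr1.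
pose D := clifford_double thetaK.
pose inA (a : A) : D := (a, 0).
pose x : D := (0, 1).
exists D, (@double_theta k A theta thetaK : {lrmorphism D -> D}),
  (@double_thetaK k A theta thetaK).
exists (fun i => if unlift ord0 i is Some j then inA (f j) else x).
have inAM a b : inA a * inA b = inA (a * b).
  by congr pair; rewrite /= ?rmorph0 ?mulr0 ?mul0r ?addr0.
have inAN a : - inA a = inA (- a) by congr pair; rewrite /= oppr0.
have xA a : x * inA a = inA (theta a) * x.
  by congr pair; rewrite /= ?rmorph0 ?rmorph1 ?mulr0 ?mul0r ?addr0 ?add0r ?mulr1 ?mul1r.
split.
  move=> i; case: unliftP => [j _|_] /=.
    by rewrite inAN; congr pair; rewrite /= ?fT // rmorph0 oppr0.
  by congr pair; rewrite /= ?rmorph0 ?rmorph1 ?oppr0.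
split.
- move=> i; case: unliftP => [j _|_]; first by rewrite inAM f1.
  by congr pair; rewrite /= ?rmorph0 ?rmorph1 ?mulr0 ?mul0r ?addr0 ?add0r ?mulr1.
- move=> i j; case: unliftP => [i' ->|->]; case: unliftP => [j' ->|->].
  + by rewrite (inj_eq (@lift_inj _ _)) => ij; rewrite !inAM fC // inAN.
  + by move=> _; rewrite xA fT -inAN mulNr opprK.
  + by move=> _; rewrite xA fT -inAN mulNr.
  + by rewrite eqxx.
- by rewrite dimvf expnS -fdim dimvf /= mul2n -addnn.
move=> P P0 Plin P1 Pmul [a b].
have PA : forall a, P (inA a).
  apply: fG => [//|c u v Pu Pv|//|i u Pu].
    by have := Plin c _ _ Pu Pv; congr P; congr pair; rewrite /= scaler0 addr0.
  by have := Pmul (lift ord0 i) _ Pu; rewrite liftK inAM.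
(* [inA u * x] equals [x * inA (theta u)], so closure under left multiplication is enough. *)
have Px u : P (inA u * x).
  by have := Pmul ord0 _ (PA (theta u)); rewrite unlift_none xA thetaK.
have := Plin 1 _ _ (PA a) (Px b); congr P; congr pair; rewrite /= mul0r.
  by rewrite scale1r mulr0 !addr0.
by rewrite scaler0 mulr1 addr0 add0r.
Qed.

(** * Linear independence of anticommuting monomials *)

Section Anticommuting.
Variables (k : fieldType) (B : falgType k) (N : nat) (g : 'I_N -> B).
Hypothesis char2 : (2 : k) != 0.
Hypothesis g1 : forall i, g i * g i = 1.
Hypothesis gC : forall i j, i != j -> g i * g j = - (g j * g i).

Definition monom (W : {set 'I_N}) : B := \prod_(i <- enum W) g i.

(** Only factors other than [g i] contribute a sign, since [g i] commutes with itself. *)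
Lemma prod_anticomm (r : seq 'I_N) i :
  g i * \prod_(j <- r) g j =
    (-1) ^+ count (predC1 i) r *: ((\prod_(j <- r) g j) * g i).
Proof.
elim: r => [|j r IHr] /=; first by rewrite big_nil mulr1 mul1r scale1r.
rewrite big_cons; have [->|ji] := eqVneq j i.
  by rewrite add0n -[in RHS]mulrA [X in g i * X]IHr -scalerAr.
rewrite [LHS]mulrA gC 1?eq_sym // mulNr -[in LHS]mulrA [in LHS]IHr.
by rewrite exprD expr1 mulN1r scaleNr -scalerAr -[in RHS]mulrA.
Qed.

Definition monom_sign (W : {set 'I_N}) i : bool := odd #|W :\ i|.

Lemma monom_comm W i : g i * monom W = (-1) ^+ monom_sign W i *: (monom W * g i).
Proof.
rewrite /monom prod_anticomm /monom_sign; congr (_ *: _).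
rewrite signr_odd; congr (_ ^+ _).
rewrite cardE -size_filter; apply/perm_size/uniq_perm.
- by rewrite filter_uniq ?enum_uniq.
- exact: enum_uniq.
by move=> j; rewrite mem_filter !mem_enum !inE.
Qed.

Lemma monom_conj W i : g i * monom W * g i = (-1) ^+ monom_sign W i *: monom W.
Proof. by rewrite monom_comm -scalerAl -mulrA g1 mulr1. Qed.

Lemma monom_unit W : monom W \is a GRing.unit.
Proof.
rewrite /monom; elim: (enum W) => [|i r IHr]; first by rewrite big_nil unitr1.
rewrite big_cons unitrMl // /GRing.unit.
by apply/unitrP; exists (g i).
Qed.

(** Modulo 2 the sign is [#|W|] plus the membership of [i]. If [W] and [W'] have sizes of equal
    parity, this recovers membership; otherwise they are complementary, and two sizes of different
    parity would add up to the even number [N]. *)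
Lemma monom_sign_inj W W' : ~~ odd N -> monom_sign W =1 monom_sign W' -> W = W'.
Proof.
move=> evN eqs.
have s W0 i : monom_sign W0 i = odd #|W0| (+) (i \in W0).
  by rewrite /monom_sign (cardsD1 i W0) oddD; case: (i \in W0); case: (odd _).
have [e|ne] := eqVneq (odd #|W|) (odd #|W'|).
  by apply/setP=> i; have := eqs i; rewrite !s e => /addbI.
have WC : W = ~: W'.
  apply/setP=> i; have := eqs i; rewrite !s inE.
  by move: ne; case: (odd _); case: (odd _) => //= _;
    case: (i \in W); case: (i \in W').
have oN : odd N = odd #|W'| (+) odd #|~: W'| by rewrite -oddD cardsC card_ord.
by move: ne evN; rewrite WC oN; case: (odd _); case: (odd _).
Qed.

(* Averaging over conjugation by the generators, with the signs of W0, kills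
   every monomial but W0: for N even, distinct monomials have distinct signs. *)
Lemma monom_free : ~~ odd N ->
  forall c : {set 'I_N} -> k, \sum_W c W *: monom W = 0 -> forall W, c W = 0.
Proof.
move=> evN c sum0 W0.
(* Each step is b |-> b +- g_i b g_i, which multiplies a monomial by 2 or 0 according to whether its
   sign agrees with that of [W0]. *)
pose P r (b : B) := foldr (fun i b => b + (-1) ^+ monom_sign W0 i *: (g i * b * g i)) b r.
have PL r : linear (P r).
  elim: r => [|i r IHr] a u v //=.
  rewrite IHr mulrDr mulrDl scalerDr addrACA -scalerAr -scalerAl.
  by rewrite !scalerDr !scalerA [_ * a]mulrC.
have P0 r : P r 0 = 0 by have := PL r (-1) 0 0; rewrite scaleN1r !addNr scaleN1r addNr.
have Psum r (s : seq {set 'I_N}) : P r (\sum_(W <- s) c W *: monom W) =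
    \sum_(W <- s) c W *: P r (monom W).
  elim: s => [|W s IHs]; first by rewrite !big_nil P0.
  by rewrite !big_cons PL IHs.
have Pmon r W : P r (monom W) =
    (\prod_(i <- r) (1 + (-1) ^+ monom_sign W0 i * (-1) ^+ monom_sign W i)) *: monom W.
  elim: r => [|i r IHr] /=; first by rewrite big_nil scale1r.
  rewrite IHr big_cons -scalerAr -scalerAl monom_conj !scalerA.
  rewrite -scalerDl; congr (_ *: _); rewrite mulrDl mul1r; congr (_ + _).
  exact: mulrAC.
have Pmon0 W : W != W0 -> P (enum 'I_N) (monom W) = 0.
  move=> WW0; rewrite Pmon.
  have [i si] : exists i, monom_sign W i != monom_sign W0 i.
    apply/existsP; rewrite -negb_forall; apply: contraNN WW0 => /forallP h.
    by apply/eqP/monom_sign_inj => // i; apply/eqP.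
  rewrite (big_rem i) ?mem_enum //=.
  have -> : 1 + (-1) ^+ monom_sign W0 i * (-1) ^+ monom_sign W i = 0 :> k.
    by move: si; case: monom_sign; case: monom_sign;
      rewrite ?expr1 ?expr0 ?mul1r ?mulr1 ?addrN.
  by rewrite mul0r scale0r.
have := congr1 (P (enum 'I_N)) sum0; rewrite P0 Psum.
rewrite (bigD1 W0) //= big1 ?addr0 => [|W WW0]; last by rewrite Pmon0 ?scaler0.
rewrite Pmon scalerA => /eqP; rewrite scaler_eq0 => /orP[|/eqP m0]; last first.
  by have := monom_unit W0; rewrite m0 unitr0.
rewrite mulf_eq0 => /orP[/eqP //|].
rewrite prodf_seq_eq0 => /hasP[i _] /=.
by rewrite -signr_addb addbb expr0 -[1 + 1]/2 (negPf char2).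
Qed.

(** Such a subspace contains every monomial. The ambient algebra is arbitrary, so that the bound
    serves for images of homomorphisms and for spaces of operators. *)
Lemma anticommuting_dim (U : {vspace B}) : ~~ odd N ->
  1 \in U -> (forall i u, u \in U -> g i * u \in U) -> (2 ^ N <= \dim U)%N.
Proof.
move=> evN U1 Ug.
have mU W : monom W \in U.
  rewrite /monom; elim: (enum W) => [|i r IHr]; first by rewrite big_nil.
  by rewrite big_cons Ug.
pose X := [tuple monom (enum_val i) | i < #|{: {set 'I_N}}|].
have sX : size X = (2 ^ N)%N.
  by rewrite size_tuple -cardsT -powersetT card_powerset cardsT card_ord.
have fX : free X.
  apply/freeP => c sum0 i.
  have := monom_free evN (c := fun W => c (enum_rank W)) _ (enum_val i).
  rewrite enum_valK; apply; rewrite -[RHS]sum0.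
  rewrite (big_enum_val (A := predT)) /=; apply: eq_bigr => j _.
  by rewrite (nth_mktuple _ _ j) enum_valK.
rewrite -sX -(eqP fX) dimvS //; apply/span_subvP=> _ /tnthP[i ->].
by rewrite tnth_mktuple mU.
Qed.

End Anticommuting.

(** * Matrix algebras: generators, centre and automorphisms *)

Section MatrixAlgebra.
Variable k : fieldType.

(** The Pauli recursion: with the Pauli matrices s1, s2, s3, the new family consists of s1 (x) 1, s2
    (x) 1 and the s3 (x) f_a. *)
Lemma anticommuting_matrices m (i : k) : i * i = -1 ->
  exists d (f : nat -> 'M[k]_d.+1), [/\ d.+1 = (2 ^ m)%N,
    forall a, (a < m.*2)%N -> f a *m f a = 1%:M
    & forall a b, (a < m.*2)%N -> (b < m.*2)%N -> a != b -> f a *m f b = - (f b *m f a)].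
Proof.
move=> ii; elim: m => [|m [d [f [dE f1 fC]]]].
  by exists 0, (fun=> 0).
pose g a : 'M[k]_(d.+1 + d.+1) := match a with
  | 0 => block_mx 0 1%:M 1%:M 0
  | 1 => block_mx 0 (- i%:M) i%:M 0
  | a'.+2 => block_mx (f a') 0 0 (- f a') end.
have gCS a b : (a < b)%N -> (b < m.+1.*2)%N -> g a *m g b = - (g b *m g a).
  case: a b => [|[|a]] [|[|b]] //=; rewrite ?ltnS // => ab bm;
    rewrite !mulmx_block opp_block_mx !(mulmx0, mul0mx, addr0, add0r, mulmxN, mulNmx,
      mul1mx, mulmx1, mul_scalar_mx, mul_mx_scalar, scale1r, oppr0, opprK) //.
  by rewrite fC ?opprK // ?(ltn_trans ab bm) // ltn_eqF.
have g1 a : (a < m.+1.*2)%N -> g a *m g a = 1%:M.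
  case: a => [|[|a]] /=; rewrite ?ltnS => am;
    rewrite /g mulmx_block !(mulmx0, mul0mx, addr0, add0r, mulmxN, mulNmx, mulmx1, opprK).
  + by rewrite [RHS]scalar_mx_block.
  + by rewrite -scalar_mxM ii [RHS]scalar_mx_block rmorphN opprK.
  by rewrite f1 // [RHS]scalar_mx_block.
exists (d + d.+1)%N, g; split=> [|a|a b am bm ab]; first by rewrite expnS mul2n -addnn -dE addSn.
  exact: g1.
have [ltab|] := ltnP a b; first exact: gCS.
by rewrite leq_eqVlt eq_sym (negPf ab) => /gCS gE; rewrite [X in _ = - X]gE // opprK.
Qed.

Lemma center_matrix n (z : 'M[k]_n.+1) :
  (forall a, z *m a = a *m z) -> z = (z 0 0)%:M.
Proof.
move=> zC; apply/matrixP=> l i.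
have := congr1 (fun M : 'M_n.+1 => M l 0) (zC (delta_mx i 0)).
rewrite !mxE (bigD1 i) //= [X in _ + X]big1 ?addr0 => [|j ji]; last first.
  by rewrite mxE (negPf ji) mulr0.
rewrite mxE !eqxx mulr1 => ->.
rewrite (bigD1 0) //= [X in _ + X]big1 ?addr0 => [|j j0]; last first.
  by rewrite mxE (negPf j0) andbF mul0r.
by rewrite mxE eqxx andbT; case: eqP => _; rewrite ?mul1r ?mul0r ?mulr1n ?mulr0n.
Qed.

(* g maps the i-th basis vector to al(E_i0) w, for w in the image of the
   idempotent al(E_00). *)
Lemma skolem_noether n (al : 'M[k]_n.+1 -> 'M[k]_n.+1) :
    linear al -> al 1%:M = 1%:M -> (forall a b, al (a *m b) = al a *m al b) ->
  exists2 g, g \in unitmx & forall a, al a *m g = g *m a.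
Proof.
move=> alL al1 alM.
pose al' : {linear 'M[k]_n.+1 -> 'M[k]_n.+1} := HB.pack al (GRing.isLinear.Build _ _ _ _ al alL).
have al0 : al 0 = 0 by exact: (linear0 al').
have alZ c a : al (c *: a) = c *: al a by exact: (linearZ_LR al').
have al_sum (I : Type) (r : seq I) (P : pred I) F :
    al (\sum_(i <- r | P i) F i) = \sum_(i <- r | P i) al (F i).
  exact: (linear_sum al').
pose E i j : 'M[k]_n.+1 := delta_mx i j.
have EE i j l : E i j *m E l 0 = (j == l)%:R *: E i 0 by rewrite mul_delta_mx_cond scaler_nat.
(* [al (E 0 0)] is not zero, since E_ii = E_i0 E_00 E_0i would otherwise force [al 1%:M = 0]. Being
   idempotent, it fixes its columns, and [w] is a non-zero one. *)
have [w [w0 Ew]] : exists w : 'cV[k]_n.+1, w != 0 /\ al (E 0 0) *m w = w.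
  have E00 : al (E 0 0) != 0.
    apply/eqP=> e0; have : al 1%:M = 0.
      have -> : 1%:M = \sum_i E i i.
        apply/matrixP=> i j; rewrite summxE (bigD1 i) //= big1 ?addr0 => [|l li].
          by rewrite !mxE eqxx eq_sym.
        by rewrite mxE eq_sym (negPf li).
      rewrite al_sum; apply: big1 => i _ /=.
      have -> : E i i = E i 0 *m (E 0 0 *m E 0 i) by rewrite !mul_delta_mx.
      by rewrite !alM e0 mul0mx mulmx0.
    by rewrite al1 => /eqP; rewrite oner_eq0.
  have [j colj] : exists j, col j (al (E 0 0)) != 0.
    apply/existsP; rewrite -negb_forall; apply: contraNN E00 => /forallP h.
    by apply/eqP/matrixP=> l j; have /eqP/colP/(_ l) := h j; rewrite !mxE.
  by exists (col j (al (E 0 0))); rewrite colj colE mulmxA -alM mul_delta_mx.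
pose g : 'M[k]_n.+1 := \matrix_(l, i) (al (E i 0) *m w) l 0.
have colg i : col i g = al (E i 0) *m w.
  by apply/colP=> l; rewrite !mxE.
have gE a : al a *m g = g *m a.
  have colsP (M N : 'M[k]_n.+1) : (forall l, col l M = col l N) -> M = N.
    by move=> h; apply/matrixP=> i j; have /colP/(_ i) := h j; rewrite !mxE.
  have gEij i j : al (E i j) *m g = g *m E i j.
    apply: colsP => l; rewrite !colE -!mulmxA -colE colg mulmxA -alM EE alZ -scalemxAl.
    by rewrite mul_delta_mx_cond -scaler_nat -scalemxAr -colE colg.
  rewrite [a]matrix_sum_delta mulmx_sumr al_sum mulmx_suml.
  apply: eq_bigr => i _; rewrite mulmx_sumr al_sum mulmx_suml.
  by apply: eq_bigr => j _; rewrite alZ -scalemxAl -scalemxAr -gEij.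
exists g => //.
(* If [g] kills [u^T], applying [al (E 0 j)] leaves [u 0 j] times [w], so every coordinate of [u]
   vanishes. *)
rewrite -unitmx_tr -row_free_unit -kermx_eq0; apply/rowV0P=> u /sub_kermxP ug.
have gu : g *m u^T = 0 by rewrite -[g]trmxK -trmx_mul ug trmx0.
apply/rowP=> j; rewrite mxE.
have : al (E 0 j) *m (g *m u^T) = 0 by rewrite gu mulmx0.
rewrite mulmxA gE -mulmxA.
have -> : E 0 j *m u^T = u 0 j *: delta_mx 0 0.
  apply/colP=> l; rewrite !mxE (bigD1 j) //= big1 ?addr0 => [|i ij].
    by rewrite !mxE eqxx !andbT mulrC.
  by rewrite mxE (negPf ij) andbF mul0r.
rewrite -scalemxAr -colE colg Ew => /eqP; rewrite scaler_eq0 (negPf w0) orbF.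
by move/eqP.
Qed.

End MatrixAlgebra.

(** * Normal ordering of monomials modulo an ideal *)

Section SpanModuloIdeal.
Variables (k : fieldType) (R : lalgType k) (I : R -> Prop).
Hypothesis scalerAr : forall c (p q : R), p * (c *: q) = c *: (p * q).
Hypothesis I0 : I 0.
Hypothesis IB : forall p q, I p -> I q -> I (p - q).
Hypothesis IM : forall a p b, I p -> I (a * p * b).

Lemma ideal_add p q : I p -> I q -> I (p + q).
Proof. by move=> hp hq; rewrite -[q]opprK; apply: IB => //; rewrite -sub0r; exact: IB. Qed.

Lemma ideal_mull a p : I p -> I (a * p).
Proof. by move/(@IM a p 1); rewrite mulr1. Qed.

Lemma ideal_mulr p b : I p -> I (p * b).
Proof. by move/(@IM 1 p b); rewrite mul1r. Qed.

Lemma ideal_scale (c : k) p : I p -> I (c *: p).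
Proof. by move/(@ideal_mull c%:A); rewrite -scalerAl mul1r. Qed.

Variables (n : nat) (f : 'I_n -> R).
Hypothesis f1 : forall i, I (f i * f i - 1).
Hypothesis fC : forall i j, i != j -> I (f i * f j + f j * f i).

Fixpoint ordered_monoms (l : seq 'I_n) : seq R :=
  if l is i :: l' then ordered_monoms l' ++ map ( *%R (f i)) (ordered_monoms l')
  else [:: 1].

Lemma size_ordered_monoms l : size (ordered_monoms l) = (2 ^ size l)%N.
Proof. by elim: l => //= i l IHl; rewrite size_cat size_map IHl addnn -mul2n -expnS. Qed.

Lemma ordered_monoms1 l : 1 \in ordered_monoms l.
Proof. by elim: l => [|i l IHl] /=; rewrite ?mem_seq1 // mem_cat IHl. Qed.

(** [f i] moves to its place past the earlier generators, each swap costing a sign, and cancels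
    against an [f i] already present. *)
Lemma mul_ordered_monoms l i m : uniq l -> i \in l -> m \in ordered_monoms l ->
  exists c m', m' \in ordered_monoms l /\ I (f i * m - c *: m').
Proof.
elim: l i m => //= j l IHl i m /andP[jl ul].
rewrite inE mem_cat => /orP[/eqP ->|il].
  case/orP=> [ml|/mapP[m0 ml ->]].
    exists 1, (f j * m); rewrite scale1r subrr mem_cat; split; last exact: I0.
    by rewrite map_f ?orbT.
  exists 1, m0; rewrite scale1r mem_cat ml; split=> //.
  by rewrite mulrA -[X in _ - X]mul1r -mulrBl; exact: ideal_mulr.
have ji : i != j by apply: contraNneq jl => <-.
case/orP=> [ml|/mapP[m0 ml ->]].
  have [c [m' [m'l Im']]] := IHl i m ul il ml.
  by exists c, m'; rewrite mem_cat m'l.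
have [c [m' [m'l Im']]] := IHl i m0 ul il ml.
exists (- c), (f j * m'); rewrite mem_cat map_f ?orbT //; split=> //.
rewrite mulrA -[f i * f j](addrK (f j * f i)) mulrBl -addrA -opprD.
apply: IB; first by apply: ideal_mulr; exact: fC.
rewrite scaleNr -scalerAr -mulrA -mulrBr.
exact: ideal_mull.
Qed.

Let M := ordered_monoms (enum 'I_n).

Hypothesis f_ind : forall P : R -> Prop, P 0 ->
  (forall c p q, P p -> P q -> P (c *: p + q)) -> P 1 ->
  (forall i p, P p -> P (f i * p)) -> forall p, P p.

Lemma span_ordered_monoms p :
  exists c : 'I_(size M) -> k, I (p - \sum_j c j *: M`_j).
Proof.
pose P p := exists c : 'I_(size M) -> k, I (p - \sum_j c j *: M`_j).
have PI q : I q -> P q.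
  by exists (fun=> 0); rewrite big1 ?subr0 // => j _; rewrite scale0r.
have Plin c q q' : P q -> P q' -> P (c *: q + q').
  move=> [d hd] [d' hd']; exists (fun j => c * d j + d' j).
  rewrite (eq_bigr (fun j => c *: (d j *: M`_j) + d' j *: M`_j)); last first.
    by move=> j _; rewrite scalerDl scalerA.
  rewrite big_split -scaler_sumr opprD addrACA -scalerBr.
  by apply: ideal_add => //; exact: ideal_scale.
have Pm m : m \in M -> P m.
  case/(nthP 0)=> j jM <-; exists (fun j' => (j' == Ordinal jM)%:R).
  rewrite (bigD1 (Ordinal jM)) //= eqxx scale1r big1 ?addr0 ?subrr // => j' /negPf ->.
  exact: scale0r.
move: p; apply: (@f_ind P) => [||| i q [c hc]]; first exact: PI.
- exact: Plin.
- exact/Pm/ordered_monoms1.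
have -> : f i * q = 1 *: (\sum_j c j *: (f i * M`_j)) + f i * (q - \sum_j c j *: M`_j).
  rewrite mulrBr mulr_sumr scale1r addrC.
  by rewrite (eq_bigr _ (fun j _ => scalerAr (c j) (f i) M`_j)) subrK.
apply: (Plin); last by apply/PI/ideal_mull.
apply: (big_ind P) => [|x y hx hy|j _]; first exact: PI.
  by rewrite -[x]scale1r; exact: Plin.
have [d [m [mM hm]]] : exists c m, m \in M /\ I (f i * M`_j - c *: m).
  by apply: mul_ordered_monoms; rewrite ?enum_uniq ?mem_enum ?mem_nth.
have := Plin d _ _ (Pm _ mM) (PI _ hm); rewrite addrC subrK => h.
by rewrite -[_ *: _]addr0; apply: (Plin) => //; exact: PI.
Qed.

Variables (A : falgType k) (pi : {lrmorphism R -> A}).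
Hypothesis pi_surj : forall a, exists p, pi p = a.
Hypothesis piI : forall p, I p -> pi p = 0.

Let X := map pi M.

Let span_X : (<<X>> = fullv)%VS.
Proof.
apply/eqP; rewrite eqEsubv subvf; apply/subvP => a _.
have [p <-] := pi_surj a; have [c /piI/eqP] := span_ordered_monoms p.
rewrite linearB subr_eq0 => /eqP -> /=; rewrite linear_sum; apply: rpred_sum => j _.
by rewrite linearZ; apply/rpredZ/memv_span/map_f/mem_nth.
Qed.

Let size_X : size X = (2 ^ n)%N.
Proof. by rewrite size_map size_ordered_monoms size_enum_ord. Qed.

Lemma quotient_dim_le : (\dim {:A} <= 2 ^ n)%N.
Proof. by rewrite -span_X -size_X dim_span. Qed.

(** Spanning elements no more numerous than the dimension form a basis. A kernel element therefore
    has zero coefficients on the monomials, and its normal form shows it to lie in [I] itself. *)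
Lemma quotient_kernel : (2 ^ n <= \dim {:A})%N -> forall p, pi p = 0 -> I p.
Proof.
move=> dimA p; have [c Ic] := span_ordered_monoms p.
have freeX : free X by rewrite /free span_X size_X eqn_leq quotient_dim_le.
have e : pi (\sum_j c j *: M`_j) = pi p.
  by have /eqP := piI Ic; rewrite linearB subr_eq0 => /eqP ->.
move=> p0; suff s0 : \sum_j c j *: M`_j = 0 by move: Ic; rewrite s0 subr0.
rewrite p0 linear_sum in e.
have sM : size X = size M by rewrite size_map.
have X0 : \sum_(j < size X) c (cast_ord sM j) *: X`_j = 0.
  rewrite -[RHS]e (reindex (cast_ord (esym sM))) /=; last first.
    by exists (cast_ord sM) => j _; rewrite ?cast_ordK ?cast_ordKV.
  apply: eq_bigr => j _; rewrite cast_ordKV linearZ /=; congr (_ *: _).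
  by rewrite (nth_map 0).
apply: big1 => j _.
have := freeP (X := in_tuple X) freeX _ X0 (cast_ord (esym sM) j).
by rewrite cast_ordKV => ->; rewrite scale0r.
Qed.

End SpanModuloIdeal.

Lemma quotient_factor (k : fieldType) (R : lalgType k) (A B : falgType k)
    (pi : {lrmorphism R -> A}) (phi : {lrmorphism R -> B}) :
    (forall a, exists p, pi p = a) -> (forall p, pi p = 0 -> phi p = 0) ->
  exists F : {lrmorphism A -> B}, forall p, F (pi p) = phi p.
Proof.
move=> pi_surj ker; have /choice[s sP] := pi_surj.
pose F a := phi (s a).
have FE p : F (pi p) = phi p.
  have /eqP : phi (s (pi p) - p) = 0 by apply: ker; rewrite linearB /= sP subrr.
  by rewrite linearB subr_eq0 => /eqP.
have Flin : linear F.
  by move=> c a b; rewrite -(sP a) -(sP b) -(linearP pi) !FE linearP.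
have Fmul : monoid_morphism F.
  split=> [|a b]; first by rewrite -(rmorph1 pi) FE rmorph1.
  by rewrite -(sP a) -(sP b) -(rmorphM pi) !FE rmorphM.
pose F1 : {linear A -> B} := HB.pack F (GRing.isLinear.Build k A B _ F Flin).
pose F2 : {lrmorphism A -> B} :=
  HB.pack F (GRing.isLinear.Build k A B _ F Flin) (GRing.isMonoidMorphism.Build A B F Fmul).
by exists F2.
Qed.

(** * Quotients of the tensor algebra by Clifford relations *)

Section IdealGen.
Variables (R : nzRingType) (S : set R).
Local Notation I := (ideal_gen S).

Lemma ideal_gen0 : I 0. Proof. by move=> J []. Qed.
Lemma ideal_genB p q : I p -> I q -> I (p - q).
Proof. by move=> hp hq J hJ; case: (hJ) => _ h _ _; apply: h; [exact: hp|exact: hq]. Qed.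
Lemma ideal_genM a p b : I p -> I (a * p * b).
Proof. by move=> hp J hJ; case: (hJ) => _ _ h _; apply: h; exact: hp. Qed.
Lemma ideal_gen_mem p : S p -> I p.
Proof. by move=> hp J [_ _ _]; exact. Qed.

Lemma ideal_gen_sub (J : R -> Prop) : J 0 -> (forall p q, J p -> J q -> J (p - q)) ->
  (forall a p b, J p -> J (a * p * b)) -> (forall p, S p -> J p) ->
  forall p, I p -> J p.
Proof. by move=> J0 JB JM JS p Ip; apply: (Ip J). Qed.

Lemma ideal_gen_ker (R' : nzRingType) (f : {rmorphism R -> R'}) :
  (forall p, S p -> f p = 0) -> forall p, I p -> f p = 0.
Proof.
move=> fS; apply: (ideal_gen_sub (J := fun p => f p = 0)) => //.
- exact: rmorph0.
- by move=> p q fp fq; rewrite rmorphB fp fq subr0.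
by move=> a p b fp; rewrite !rmorphM fp mulr0 mul0r.
Qed.

End IdealGen.

Lemma lrmorph_sqrB (k : fieldType) (R B : lalgType k) (phi : {lrmorphism R -> B}) x c :
  phi (x * x - c%:A) = phi x * phi x - c%:A.
Proof. by rewrite linearB linearZ /= rmorphM rmorph1. Qed.

(** Together with this, the next... *)
Lemma polar_identity (k : fieldType) (R : lalgType k) (a b : R) (p q r : k) :
  (a + b) * (a + b) - (r + (p + q))%:A - (a * a - p%:A) - (b * b - q%:A)
    = a * b + b * a - r%:A.
Proof.
rewrite mulrDl !mulrDr !scalerDl.
move: (a * a) (a * b) (b * a) (b * b) => x y z w; move: p%:A q%:A r%:A => {}p {}q {}r.
rewrite !opprB [x + y]addrC (addrACA y) -[LHS]addrA.
have -> : (p - x) + (q - w) = (p + q) - (x + w) by rewrite addrACA opprD.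
by rewrite opprD [X in X + _ = _]addrA [LHS]addrA subrK addrAC addrK.
Qed.

Lemma anticomm_sum_sqr (k : fieldType) (B : algType k) n (f : 'I_n -> B) (w : 'I_n -> k) :
  (forall i, f i * f i = 1) -> (forall i j, i != j -> f i * f j = - (f j * f i)) ->
  (\sum_i w i *: f i) * (\sum_i w i *: f i) = (\sum_i w i * w i)%:A.
Proof.
move=> f1 fC; elim: n f w f1 fC => [|n IHn] f w f1 fC.
  by rewrite !big_ord0 mul0r scale0r.
rewrite !big_ord_recl mulrDl !mulrDr IHn => [|i|i j ij]; first last.
- by apply: fC; rewrite (inj_eq (@lift_inj _ _)).
- exact: f1.
rewrite -scalerAl -scalerAr f1 scalerA scalerDl -!addrA; congr (_ + _).
rewrite addrA -[RHS]add0r; congr (_ + _).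
rewrite mulr_sumr mulr_suml -big_split big1 // => i _ /=.
by rewrite -!scalerAl -!scalerAr fC ?neq_lift // !scalerN !scalerA [w ord0 * _]mulrC addNr.
Qed.

Section Clifford.
Variable k : closedFieldType.
Hypothesis char2 : (2 : k) != 0.
Variables (n : nat) (Q : 'M[k]_n).
Local Notation T := (tensalg k n).
Local Notation I := (ideal_gen (cliff_rel Q)).

Definition qform (v w : 'cV[k]_n) : k := (v^T *m Q *m w) 0 0.

Lemma lift_linear (B : algType k) (h : {linear 'cV[k]_n -> B}) :
  exists phi : {lrmorphism T -> B}, forall v, phi (tens1 v) = h v.
Proof.
exists (lift_tens (fun i => h (delta_mx i 0)) : {lrmorphism _ -> _}) => v.
rewrite /= lift_tens1 [v in RHS]matrix_sum_delta linear_sum; apply: eq_bigr => i _.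
by rewrite big_ord1 linearZ.
Qed.

Lemma cliff_kills (B : lalgType k) (phi : {lrmorphism T -> B}) :
  (forall v, phi (tens1 v) * phi (tens1 v) = (qform v v)%:A) ->
  forall p, I p -> phi p = 0.
Proof.
move=> phiQ; apply: ideal_gen_ker => _ [v _ <-].
suff: phi (tens1 v * tens1 v - (qform v v)%:A) = 0 by [].
by rewrite lrmorph_sqrB phiQ subrr.
Qed.

Lemma cliff_sqr (A : falgType k) (pi : {lrmorphism T -> A}) :
  is_quotient (cliff_rel Q) pi ->
  forall v, pi (tens1 v) * pi (tens1 v) = (qform v v)%:A.
Proof.
move=> [_ ker] v.
have : pi (tens1 v * tens1 v - (qform v v)%:A) = 0.
  by apply: (ker _).2; apply: ideal_gen_mem; exists v.
by rewrite lrmorph_sqrB => /eqP; rewrite subr_eq0 => /eqP.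
Qed.

Hypotheses (Qs : Q^T = Q) (Qu : Q \in unitmx).

Lemma qform_sym v w : qform v w = qform w v.
Proof.
have <- : (v^T *m Q *m w)^T 0 0 = qform v w by rewrite mxE.
by rewrite !trmx_mul trmxK Qs mulmxA.
Qed.

Lemma qformDl u v w : qform (u + v) w = qform u w + qform v w.
Proof. by rewrite /qform [(u + v)^T]linearD /= !mulmxDl mxE. Qed.

Lemma qformDr u v w : qform w (u + v) = qform w u + qform w v.
Proof. by rewrite /qform mulmxDr mxE. Qed.

Lemma cliff_polar (B : lalgType k) (h : {linear 'cV[k]_n -> B}) :
  (forall v, h v * h v = (qform v v)%:A) ->
  forall v w, h v * h w + h w * h v = (2 * qform v w)%:A.
Proof.
move=> hQ v w; have := hQ (v + w).
rewrite linearD /= mulrDl !mulrDr !hQ qformDl !qformDr !scalerDl.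
rewrite -!addrA => /addrI; rewrite !addrA => /addIr ->.
by rewrite (qform_sym w) -scalerDl -mulr2n mulr_natl.
Qed.

Let basis := orthonormal_basis char2 Qs Qu.

Lemma orthonormal_frame : exists P : 'M[k]_n, P \in unitmx /\
  forall i j, qform (col i P) (col j P) = (i == j)%:R.
Proof.
have [P Pu PQ] := basis; exists P; split=> // i j.
rewrite /qform !colE trmx_mul -!mulmxA !mulmxA -[_ *m P^T *m _ *m _]mulmxA.
rewrite -[_ *m P^T *m (_ *m _)]mulmxA (mulmxA P^T) PQ mulmx1 trmx_delta -rowE !mxE.
by rewrite eqxx andbT.
Qed.

Lemma frame_span (P : 'M[k]_n) (v : 'cV[k]_n) : P \in unitmx ->
  v = \sum_i (invmx P *m v) i 0 *: col i P.
Proof.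
move=> Pu; rewrite -{1}[v](mulKVmx Pu); move: (invmx P *m v) => w.
apply/colP=> j; rewrite summxE mxE; apply: eq_bigr => i _.
by rewrite !mxE mulrC.
Qed.

Lemma frame_ind (P : 'M[k]_n) (R : lalgType k) (h : {linear 'cV[k]_n -> R})
    (p : R) (C : R -> Prop) :
  P \in unitmx -> C 0 -> (forall c p q, C p -> C q -> C (c *: p + q)) ->
  (forall i, C (h (col i P) * p)) -> forall v, C (h v * p).
Proof.
move=> Pu C0 Clin Ch v; rewrite (frame_span v Pu) linear_sum mulr_suml.
elim/big_ind: _ => [//|x y Cx Cy|i _].
  by rewrite -[x]scale1r; apply: Clin.
by rewrite linearZ -scalerAl -[_ *: _]addr0; apply: (Clin).
Qed.

(** Words are written in the standard basis, while the relations are diagonal in an orthonormal one;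
    this transfers induction from the former to the latter. *)
Lemma tens_frame_ind (P : 'M[k]_n) (C : T -> Prop) : P \in unitmx ->
  C 0 -> (forall c p q, C p -> C q -> C (c *: p + q)) -> C 1 ->
  (forall i p, C p -> C (tens1 (col i P) * p)) -> forall p, C p.
Proof.
move=> Pu C0 Clin C1 Cmul; apply: (@tens_ind _ _ C C0 Clin C1) => i p Cp.
rewrite -tens1_delta; apply: (@frame_ind P T (@tens1 k n)) => // j; exact: Cmul.
Qed.

Section Quotient.
Variables (A : falgType k) (pi : {lrmorphism T -> A}).
Hypothesis pi_surj : forall a, exists p, pi p = a.

(* 2 ^ n ordered monomials span the quotient, so a surjection killing the
   relations is the quotient as soon as its target is large enough. *)
Lemma cliff_dim_le :
  (forall v, pi (tens1 v) * pi (tens1 v) = (qform v v)%:A) ->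
  (\dim {:A} <= 2 ^ n)%N /\
  ((2 ^ n <= \dim {:A})%N -> is_quotient (cliff_rel Q) pi).
Proof.
move=> piQ; have [P [Pu PQ]] := orthonormal_frame.
have piI := cliff_kills piQ.
have I1 v : I (tens1 v * tens1 v - (qform v v)%:A) by apply: ideal_gen_mem; exists v.
have f1 i : I (tens1 (col i P) * tens1 (col i P) - 1).
  by have := I1 (col i P); rewrite PQ eqxx scale1r.
have fC i j : i != j -> I (tens1 (col i P) * tens1 (col j P) + tens1 (col j P) * tens1 (col i P)).
  move=> ij; set a := tens1 (col i P); set b := tens1 (col j P).
  have := I1 (col i P + col j P).
  rewrite qformDl !qformDr !PQ !eqxx (eq_sym j) (negPf ij) addr0 add0r linearD /= -/a -/b.
  move=> h; have := ideal_genB (ideal_genB h (f1 i)) (f1 j); rewrite -/a -/b.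
  have := polar_identity a b 1 1 0; rewrite add0r scale0r subr0 scale1r => e.
  by congr I.
have := @quotient_dim_le k T I (@tens_scalerAr k n)
  (@ideal_gen0 _ _) (@ideal_genB _ _) (@ideal_genM _ _)
  n _ f1 fC (fun C => @tens_frame_ind P C Pu) A pi pi_surj piI.
have := @quotient_kernel k T I (@tens_scalerAr k n)
  (@ideal_gen0 _ _) (@ideal_genB _ _) (@ideal_genM _ _)
  n _ f1 fC (fun C => @tens_frame_ind P C Pu) A pi pi_surj piI.
move=> ker dimA. split; first exact: dimA.
move=> dimA'; split=> // p; split; first exact: ker.
exact: piI.
Qed.

End Quotient.

(** In orthonormal coordinates the cross terms of the square of a vector cancel in pairs, leaving
    the sum of the squares of the coordinates. *)
Lemma frame_clifford_map (P : 'M[k]_n) (B : algType k) (f : 'I_n -> B) :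
  P \in unitmx -> (forall i j, qform (col i P) (col j P) = (i == j)%:R) ->
  (forall i, f i * f i = 1) -> (forall i j, i != j -> f i * f j = - (f j * f i)) ->
  exists phi : {lrmorphism T -> B},
    (forall v, phi (tens1 v) * phi (tens1 v) = (qform v v)%:A) /\
    (forall i, phi (tens1 (col i P)) = f i).
Proof.
move=> Pu PQ f1 fC.
pose h (v : 'cV[k]_n) := \sum_i (invmx P *m v) i 0 *: f i.
have hl : linear h.
  move=> c u v; rewrite /h scaler_sumr -big_split; apply: eq_bigr => i _ /=.
  by rewrite mulmxDr -scalemxAr !mxE scalerDl scalerA.
pose h' : {linear 'cV[k]_n -> B} := HB.pack h (GRing.isLinear.Build _ _ _ _ h hl).
have [phi phiE] := lift_linear h'.
exists phi; split=> [v|i]; last first.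
  rewrite phiE /= /h colE mulKmx //.
  rewrite (bigD1 i) //= mxE !eqxx scale1r big1 ?addr0 // => j ji.
  by rewrite mxE (negPf ji) scale0r.
rewrite !phiE /= /h; set w := invmx P *m v.
have vw : v = \sum_i w i 0 *: col i P by exact: frame_span.
have -> : qform v v = \sum_i w i 0 * w i 0.
  have sumr (u : 'cV_n) : qform u v = \sum_j w j 0 * qform u (col j P).
    rewrite {1}vw /qform mulmx_sumr summxE; apply: eq_bigr => j _.
    by rewrite -scalemxAr mxE.
  rewrite sumr; apply: eq_bigr => j _; congr (_ * _).
  rewrite (qform_sym v) sumr (bigD1 j) //= PQ eqxx mulr1.
  by rewrite big1 ?addr0 // => l lj; rewrite PQ eq_sym (negPf lj) mulr0.
exact: anticomm_sum_sqr.
Qed.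

Lemma cliff_exists : exists (A : falgType k) (pi : {lrmorphism T -> A}),
  is_quotient (cliff_rel Q) pi.
Proof.
have [A [f [f1 fC fdim fG]]] := clifford_system_exists k n.
have [P [Pu PQ]] := orthonormal_frame.
have [pi [piQ pif]] := frame_clifford_map Pu PQ f1 fC.
exists A, pi; have [|_] := cliff_dim_le _ piQ; last by apply; rewrite fdim.
apply: fG => [|c a b [p <-] [q <-]||i a [p <-]].
- by exists 0; rewrite linear0.
- by exists (c *: p + q); rewrite linearP.
- by exists 1; rewrite rmorph1.
by exists (tens1 (col i P) * p); rewrite rmorphM /= pif.
Qed.

Section Universal.
Variables (A : falgType k) (pi : {lrmorphism T -> A}).
Hypothesis quot : is_quotient (cliff_rel Q) pi.

Lemma cliff_universal (B : falgType k) (phi : {lrmorphism T -> B}) :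
  (forall v, phi (tens1 v) * phi (tens1 v) = (qform v v)%:A) ->
  exists F : {lrmorphism A -> B}, forall p, F (pi p) = phi p.
Proof.
move=> phiQ; apply: quotient_factor; first by case: quot.
by move=> p; case: quot => _ ker /ker; exact: cliff_kills.
Qed.

Lemma cliff_ind (C : A -> Prop) :
  C 0 -> (forall c a b, C a -> C b -> C (c *: a + b)) -> C 1 ->
  (forall v a, C a -> C (pi (tens1 v) * a)) -> forall a, C a.
Proof.
move=> C0 Clin C1 Cmul a; have [surj _] := quot; have [p <-] := surj a.
elim/tens_ind: p => [|c p q Cp Cq||i p Cp].
- by rewrite linear0.
- by rewrite linearP; exact: Clin.
- by rewrite rmorph1.
by rewrite rmorphM -tens1_delta; exact: Cmul.
Qed.

Lemma cliff_frame : exists f : 'I_n -> A,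
  [/\ forall i, f i * f i = 1, forall i j, i != j -> f i * f j = - (f j * f i)
    & forall i, exists v, f i = pi (tens1 v)].
Proof.
have [P [Pu PQ]] := orthonormal_frame.
exists (fun i => pi (tens1 (col i P))); split=> [i|i j ij|i]; last by exists (col i P).
  by rewrite (cliff_sqr quot) PQ eqxx scale1r.
apply/eqP; rewrite -addr_eq0; apply/eqP.
have h := cliff_polar (h := pi \o @tens1 k n) (cliff_sqr quot).
by rewrite [LHS]h PQ (negPf ij) mulr0 scale0r.
Qed.

(** The lower bound comes from the universal property, which maps [A] onto the model of dimension
    [2 ^ n]. *)
Lemma cliff_dim : \dim {:A} = (2 ^ n)%N.
Proof.
have [surj _] := quot; have piQ := cliff_sqr quot.
have [dimA _] := cliff_dim_le surj piQ.
apply/eqP; rewrite eqn_leq dimA /=.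
have [B [f [f1 fC fdim fG]]] := clifford_system_exists k n.
have [P [Pu PQ]] := orthonormal_frame.
have [phi [phiQ phif]] := frame_clifford_map Pu PQ f1 fC.
have [F FE] := cliff_universal phiQ.
rewrite -fdim; suff -> : (fullv = limg (linfun F))%VS.
  by rewrite -(limg_ker_dim (linfun F) fullv) leq_addl.
apply/eqP; rewrite eqEsubv subvf andbT; apply/subvP => b _.
move: b; apply: fG => [|c a b||i a].
- exact: mem0v.
- by move=> *; rewrite memvD ?memvZ.
- by apply/memv_imgP; exists 1; rewrite ?memvf // lfunE /= rmorph1.
case/memv_imgP=> u _ ->; apply/memv_imgP; exists (pi (tens1 (col i P)) * u).
  exact: memvf.
by rewrite !lfunE /= rmorphM /= FE phif.
Qed.

End Universal.

End Clifford.

Section BilinearSpan.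
Variables (k : fieldType) (A B C : vectType k) (f : A -> B -> C).
Hypothesis linl : forall b, linear (f^~ b).
Hypothesis linr : forall a, linear (f a).

Lemma bilinear_mem_span a b :
  f a b \in <<[seq f a b | a <- vbasis {:A}, b <- vbasis {:B}]>>%VS.
Proof.
have f0l b' : f 0 b' = 0 by have := linl b' (-1) 0 0; rewrite scaleN1r !addNr scaleN1r addNr.
have f0r a' : f a' 0 = 0 by have := linr a' (-1) 0 0; rewrite scaleN1r !addNr scaleN1r addNr.
have fsl b' m (s : seq A) (c : 'I_m -> k) :
    f (\sum_i c i *: s`_i) b' = \sum_i c i *: f s`_i b'.
  elim/big_rec2: _ => [|i y x _ <-]; first exact: f0l.
  exact: linl.
have fsr a' m (s : seq B) (c : 'I_m -> k) :
    f a' (\sum_i c i *: s`_i) = \sum_i c i *: f a' s`_i.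
  elim/big_rec2: _ => [|i y x _ <-]; first exact: f0r.
  exact: linr.
rewrite (coord_vbasis (memvf a)) (coord_vbasis (memvf b)) fsl.
apply: rpred_sum => i _; apply: rpredZ; rewrite fsr.
apply: rpred_sum => j _; apply: rpredZ; apply: memv_span.
by apply: allpairs_f; rewrite mem_nth ?size_tuple.
Qed.

(** With equal dimensions, spanning suffices. The span is presented as the least subspace [U]
    containing all values, so that its stability under an operator need only be checked on the
    values [f a b]. *)
Lemma bilinear_basis : \dim {:C} = (\dim {:A} * \dim {:B})%N ->
  (forall U : {vspace C}, (forall a b, f a b \in U) ->
     (forall V : {vspace C}, (forall a b, f a b \in V) -> (U <= V)%VS) ->
     (\dim {:C} <= \dim U)%N) ->
  basis_of fullv [seq f a b | a <- vbasis {:A}, b <- vbasis {:B}].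
Proof.
move=> dimC dimU; rewrite basisEdim size_allpairs !size_tuple -dimC leqnn andbT.
rewrite -dimv_leqif_sup ?subvf // eqn_leq dimvS ?subvf // dimU // => [a b|V fV].
  exact: bilinear_mem_span.
by apply/span_subvP=> _ /allpairsP[p [_ _ ->]].
Qed.

End BilinearSpan.

(* With t acting by -1 on V, the braiding is minus the flip, so the Weyl
   relation reads v w + w v = B(v, w), that is v ^ 2 = B(v, v) / 2. *)
Section Weyl.
Variables (k : closedFieldType) (gT : finGroupType) (char2 : 2%N \notin [pchar k]).
Variable X : orthrep k gT.
Local Notation n := (odim X).
Local Notation T := (tensalg k n).
Local Notation V := (tpsi char2 X).

Lemma tens2_outer (v w : 'cV[k]_n) : tens2 (v *m w^T) = tens1 v * tens1 w.
Proof.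
rewrite /tens2 /tens1 mulr_suml; apply: eq_bigr => i _.
rewrite mulr_sumr; apply: eq_bigr => j _.
by rewrite mxE big_ord1 mxE tens_scalerAr -tens_scalerAl scalerA mulrC.
Qed.

Lemma tens2_linear : linear (@tens2 k n).
Proof.
move=> c M N; rewrite /tens2 scaler_sumr -big_split; apply: eq_bigr => i _ /=.
rewrite scaler_sumr -big_split; apply: eq_bigr => j _ /=.
by rewrite !mxE scalerDl scalerA.
Qed.

Lemma weyl_cliff_ideal p :
  ideal_gen (weyl_rel V) p <-> ideal_gen (cliff_rel (2^-1 *: oform X)) p.
Proof.
have halfD : 2^-1 + 2^-1 = 1 :> k.
  by rewrite -mulr2n -[2^-1 *+ 2]mulr_natr mulVf // (two_neq0 char2).
pose Q := 2^-1 *: oform X; rewrite -/Q.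
have Qs : Q^T = Q by rewrite /Q linearZ /= oform_sym.
have form_eval_outer (v w : 'cV[k]_n) :
    form_eval (oform X) (v *m w^T) = (v^T *m oform X *m w) 0 0.
  have <- : (v^T *m oform X *m w)^T 0 0 = (v^T *m oform X *m w) 0 0 by rewrite mxE.
  by rewrite /form_eval mulmxA mxtrace_mulC /mxtrace big_ord1 !trmx_mul trmxK.
have half (v : 'cV[k]_n) : v *m v^T = 2^-1 *: (v *m v^T) + (2^-1 *: (v *m v^T))^T.
  by rewrite linearZ /= trmx_mul trmxK -scalerDl halfD scale1r.
split; apply: ideal_gen_sub; rewrite /=;
  do ?[exact: ideal_gen0 | exact: ideal_genB | exact: ideal_genM].
  move=> _ [M _ <-]. rewrite (tpsi_braiding char2) opprK.
  (* [D] is linear, so elementary matrices suffice; these are outer products v w^T, for which [D] is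
     the polarised square relation. *)
  pose D N := tens2 (N + N^T) - (form_eval (oform X) N)%:A.
  have Dlin : linear D.
    move=> c N N'; rewrite /D /form_eval [(c *: N + N')^T]linearP /= mulmxDr.
    rewrite -scalemxAr mxtraceD mxtraceZ addrACA -scalerDr tens2_linear.
    by rewrite scalerDl opprD addrACA scalerBr scalerA.
  suff JD N : ideal_gen (cliff_rel Q) (D N) by exact: JD.
  pose D' : {linear 'M[k]_n -> T} := HB.pack D (GRing.isLinear.Build _ _ _ _ D Dlin).
  rewrite -[D]/(D' : _ -> _) [N]matrix_sum_delta linear_sum.
  have J0 := @ideal_gen0 _ (cliff_rel Q).
  have JB := @ideal_genB _ (cliff_rel Q).
  have JM := @ideal_genM _ (cliff_rel Q).
  elim/big_ind: _ => [//|x y hx hy|i _]; first exact: (ideal_add J0 JB).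
  rewrite linear_sum; elim/big_ind: _ => [//|x y hx hy|j _]; first exact: (ideal_add J0 JB).
  rewrite linearZ; apply: (ideal_scale JM).
  have -> : delta_mx i j = (delta_mx i 0 : 'cV_n) *m (delta_mx j 0 : 'cV_n)^T :> 'M[k]_n.
    by rewrite trmx_delta mul_delta_mx.
  move: (delta_mx i 0) (delta_mx j 0) => v w; rewrite /= /D trmx_mul trmxK.
  have := tens2_linear 1 (v *m w^T) (w *m v^T); rewrite !scale1r !tens2_outer => ->.
  set r := form_eval _ _.
  have eQ : qform Q (v + w) (v + w) = r + (qform Q v v + qform Q w w).
    rewrite qformDl !qformDr (qform_sym Qs w v) [X in X + _ = _]addrC addrACA.
    congr (_ + _); rewrite /r form_eval_outer.
    by rewrite /qform /Q -scalemxAr -scalemxAl mxE -mulrDl halfD mul1r.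
  have hv u : ideal_gen (cliff_rel Q) (tens1 u * tens1 u - (qform Q u u)%:A).
    by apply: ideal_gen_mem; exists u.
  have := JB _ _ (JB _ _ (hv (v + w)) (hv v)) (hv w).
  have := polar_identity (tens1 v) (tens1 w) (qform Q v v) (qform Q w w) r.
  by rewrite -eQ => e; congr ideal_gen; rewrite linearD.
(* The Weyl relation symmetrises its matrix, and half of v v^T symmetrises to v v^T. *)
move=> _ [v _ <-]; apply: ideal_gen_mem; exists (2^-1 *: (v *m v^T)); first exact: I.
rewrite (tpsi_braiding char2) opprK -half tens2_outer; congr (_ - _%:A).
rewrite scalemxAl form_eval_outer /qform /Q [(_ *: v)^T]linearZ /=.
by rewrite -!scalemxAl -scalemxAr -scalemxAl.
Qed.

Lemma weyl_quotientP (A : falgType k) (pi : {lrmorphism T -> A}) :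
  is_quotient (weyl_rel V) pi <-> is_quotient (cliff_rel (2^-1 *: oform X)) pi.
Proof.
by split=> -[surj ker]; split=> // p; split;
  [move/ker/weyl_cliff_ideal|move/weyl_cliff_ideal/ker|
   move/ker/weyl_cliff_ideal|move/weyl_cliff_ideal/ker].
Qed.

End Weyl.

(** * Azumaya property and tensor products *)

Section Azumaya.
Variables (k : closedFieldType) (Gm : finGroupType) (t : Gm).
Hypothesis char2 : (2 : k) != 0.
Variables (A : calg k Gm) (n : nat) (Q : 'M[k]_n).
Hypotheses (Qs : Q^T = Q) (Qu : Q \in unitmx).
Variable pi : {lrmorphism tensalg k n -> A}.
Hypothesis quot : is_quotient (cliff_rel Q) pi.
Hypothesis tpi : forall v, cact A t (pi (tens1 v)) = - pi (tens1 v).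

Local Notation theta := (cact A t).
Local Notation ev := (@evenp k Gm t A).
Local Notation od := (@oddp k Gm t A).

Lemma parity_involutive : involutive theta.
Proof.
apply: (cliff_ind quot) => [|c a b ha hb||v a ha].
- by rewrite !linear0.
- by rewrite !linearP /= ha hb.
- by rewrite !rmorph1.
by rewrite !rmorphM /= tpi rmorphN /= tpi opprK ha.
Qed.

Lemma evenp_linear : linear ev.
Proof.
move=> c a b; rewrite /evenp linearP /= addrACA -scalerDr [LHS]scalerDr !scalerA.
by rewrite [c * _]mulrC.
Qed.

Lemma oddp_linear : linear od.
Proof.
move=> c a b; rewrite /oddp linearP /= opprD addrACA -scalerBr [LHS]scalerDr !scalerA.
by rewrite [c * _]mulrC.
Qed.

Lemma evenp_parity a : ev (theta a) = ev a.
Proof. by rewrite /evenp parity_involutive addrC. Qed.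

Lemma oddp_parity a : od (theta a) = - od a.
Proof. by rewrite /oddp parity_involutive -scalerN opprB. Qed.

Lemma evenp_mull u a : theta u = - u -> ev (u * a) = u * od a.
Proof. by move=> hu; rewrite /evenp /oddp rmorphM /= hu -scalerAr mulrBr mulNr. Qed.

Lemma oddp_mull u a : theta u = - u -> od (u * a) = u * ev a.
Proof. by move=> hu; rewrite /evenp /oddp rmorphM /= hu -scalerAr mulrDr mulNr opprK. Qed.

Lemma evenp1 : ev (1 : A) = 1.
Proof.
by rewrite /evenp rmorph1 -mulr2n -scaler_nat scalerA mulVf ?scale1r.
Qed.

Lemma oddp1 : od (1 : A) = 0.
Proof. by rewrite /oddp rmorph1 subrr scaler0. Qed.

Lemma sandwichE (a b x : A) : sandwich t a b x = a * (x * ev b + theta x * od b).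
Proof.
pose f (y : A) := a * (y * ev b + theta y * od b).
have fl : linear f.
  move=> c y z; rewrite /f linearP /= !mulrDl -!scalerAl addrACA -scalerDr.
  by rewrite mulrDr -scalerAr.
pose F : {linear A -> A} := HB.pack f (GRing.isLinear.Build _ _ _ _ f fl).
exact: (lfunE F).
Qed.

Lemma sandwich_linl b : linear (fun a => sandwich t a b : 'End(A)).
Proof.
move=> c a a'; apply/lfunP=> x.
by rewrite add_lfunE scale_lfunE !sandwichE mulrDl scalerAl.
Qed.

Lemma sandwich_linr a : linear (fun b => sandwich t a b : 'End(A)).
Proof.
move=> c b b'; apply/lfunP=> x.
rewrite add_lfunE scale_lfunE !sandwichE evenp_linear oddp_linear !mulrDr -!scalerAr.
by rewrite addrACA !scalerDr.
Qed.

Import FalgLfun.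

(* x |-> f_j x and x |-> theta(x) f_j are 2n anticommuting operators on A that
   preserve the span of the sandwich maps, which therefore has dimension at
   least 4 ^ n = dim End(A). *)
Lemma cliff_azumaya : azumaya t A.
Proof.
have [i ii] := closed_sqrt (-1 : k).
have [f [f1 fC fV]] := cliff_frame char2 Qs Qu quot.
have tf j : theta (f j) = - f j by have [v ->] := fV j; exact: tpi.
have [L LE] : exists L : 'I_n -> 'End(A), forall j x, L j x = f j * x.
  by exists (fun j => amull (f j)) => j x; rewrite lfunE.
(* The map x |-> theta(x) f_j squares to -1, because [theta] negates [f j]; the factor [i] corrects
   the sign. *)
have [R RE] : exists R : 'I_n -> 'End(A), forall j x, R j x = i *: (theta x * f j).
  exists (fun j => i *: sandwich t 1 (f j)) => j x.
  have evf : ev (f j) = 0 by rewrite -[f j]mulr1 evenp_mull // oddp1 mulr0.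
  have odf : od (f j) = f j by rewrite -[in LHS](mulr1 (f j)) oddp_mull // evenp1 mulr1.
  by rewrite scale_lfunE sandwichE mul1r evf odf mulr0 add0r.
pose g (j : 'I_(n + n)) := match split j with inl l => L l | inr l => R l end.
have g1 j : g j * g j = 1.
  rewrite /g; apply/lfunP=> x; rewrite lfun_mulE id_lfunE.
  case: (split j) => l; first by rewrite !LE mulrA f1 mul1r.
  rewrite !RE linearZ /= rmorphM /= parity_involutive tf -scalerAl scalerA ii mulrN mulNr.
  by rewrite scaleN1r opprK -mulrA f1 mulr1.
have gC j l : j != l -> g j * g l = - (g l * g j).
  rewrite /g => jl; apply/lfunP=> x; rewrite opp_lfunE !lfun_mulE.
  have : split j != split l by rewrite (inj_eq (can_inj (@splitK _ _))).
  case: (split j) => j'; case: (split l) => l' jl'; rewrite ?LE ?RE.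
  - have {}jl' : l' != j' by rewrite eq_sym; exact: jl'.
    by rewrite mulrA (fC _ _ jl') mulNr -mulrA.
  - by rewrite rmorphM /= tf -scalerAr !mulNr scalerN mulrA.
  - by rewrite rmorphM /= tf -scalerAr !mulNr scalerN opprK mulrA.
  - have {}jl' : j' != l' by exact: jl'.
    rewrite !linearZ /= !rmorphM /= !parity_involutive !tf -!scalerAl !mulrN !mulNr !scalerN.
    by rewrite -!mulrA (fC _ _ jl') mulrN !scalerN.
have dimE : \dim {:'End(A)} = (\dim {:A} * \dim {:A})%N by rewrite !dimvf.
apply: bilinear_basis.
- exact: sandwich_linl.
- exact: sandwich_linr.
- exact: dimE.
move=> U sU Umin; rewrite dimE (cliff_dim char2 Qs Qu quot) -expnD.
apply: (anticommuting_dim char2 g1 gC).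
- by rewrite oddD addbb.
- have -> : 1 = sandwich t 1 1 :> 'End(A); last exact: sU.
  by apply/lfunP=> x; rewrite id_lfunE sandwichE evenp1 oddp1 mulr0 addr0 mul1r mulr1.
move=> j u uU.
have : (U <= amull (g j) @^-1: U)%VS.
  (* The product of ['End(A)] composes from left to right, so the generator acts before the sandwich
     map and is absorbed into [a] or [b]. *)
  apply: Umin => a b; rewrite -memv_preim lfunE /= /g.
  case: (split j) => l.
    have -> : L l * sandwich t a b = sandwich t (a * f l) (theta b).
      apply/lfunP=> x; rewrite lfun_mulE LE !sandwichE evenp_parity oddp_parity.
      by rewrite rmorphM /= tf !mulNr mulrN -[RHS]mulrA [f l * (_ - _)]mulrBr !mulrA.
    exact: sU.
  have -> : R l * sandwich t a b = i *: sandwich t a (f l * theta b).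
    apply/lfunP=> x; rewrite lfun_mulE RE linearZ scale_lfunE /= !sandwichE.
    rewrite evenp_mull // oddp_mull // evenp_parity oddp_parity rmorphM /= parity_involutive tf.
    by rewrite [in LHS]addrC !mulrN !mulNr !mulrA.
  by rewrite memvZ // sU.
by move/subvP/(_ u uU); rewrite -memv_preim lfunE.
Qed.

End Azumaya.

Section TensorProduct.
Variables (k : closedFieldType) (Gm : finGroupType) (t : Gm).
Hypothesis char2 : (2 : k) != 0.
Variables (A B C : calg k Gm) (m n : nat) (QA : 'M[k]_m) (QB : 'M[k]_n).
Hypotheses (QAs : QA^T = QA) (QAu : QA \in unitmx).
Hypotheses (QBs : QB^T = QB) (QBu : QB \in unitmx).
Variables (piA : {lrmorphism tensalg k m -> A}) (piB : {lrmorphism tensalg k n -> B}).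
Variable piC : {lrmorphism tensalg k (m + n) -> C}.
Hypothesis quotA : is_quotient (cliff_rel QA) piA.
Hypothesis quotB : is_quotient (cliff_rel QB) piB.
Hypothesis quotC : is_quotient (cliff_rel (block_mx QA 0 0 QB)) piC.
Variables (rA : Gm -> 'M[k]_m) (rB : Gm -> 'M[k]_n).
Hypothesis actA : forall x v, cact A x (piA (tens1 v)) = piA (tens1 (rA x *m v)).
Hypothesis actB : forall x v, cact B x (piB (tens1 v)) = piB (tens1 (rB x *m v)).
Hypothesis actC : forall x v, cact C x (piC (tens1 v)) =
  piC (tens1 (block_mx (rA x) 0 0 (rB x) *m v)).
Hypotheses (tA : rA t = - 1%:M) (tB : rB t = - 1%:M).

Let tpiA v : cact A t (piA (tens1 v)) = - piA (tens1 v).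
Proof. by rewrite actA tA mulNmx mul1mx !linearN. Qed.

Let tpiB v : cact B t (piB (tens1 v)) = - piB (tens1 v).
Proof. by rewrite actB tB mulNmx mul1mx !linearN. Qed.

Let incl_l (v : 'cV[k]_m) : C := piC (tens1 (col_mx v 0)).
Let incl_r (w : 'cV[k]_n) : C := piC (tens1 (col_mx 0 w)).

Let incl_l_linear : linear incl_l.
Proof.
move=> c u v; rewrite /incl_l -!linearP; congr (piC (tens1 _)).
by rewrite scale_col_mx add_col_mx scaler0 addr0.
Qed.

Let incl_r_linear : linear incl_r.
Proof.
move=> c u v; rewrite /incl_r -!linearP; congr (piC (tens1 _)).
by rewrite scale_col_mx add_col_mx scaler0 addr0.
Qed.

Let QC := block_mx QA 0 0 QB.

Let qformC u u' v v' :
  qform QC (col_mx u v) (col_mx u' v') = qform QA u u' + qform QB v v'.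
Proof.
rewrite /qform tr_col_mx mul_row_block mul_row_col !mulmx0 addr0 add0r.
by rewrite mxE.
Qed.

Let qform0r n' (Q : 'M[k]_n') v : qform Q v 0 = 0.
Proof. by rewrite /qform mulmx0 mxE. Qed.

Let qform0l n' (Q : 'M[k]_n') v : qform Q 0 v = 0.
Proof. by rewrite /qform trmx0 !mul0mx mxE. Qed.

Let QCu : QC \in unitmx.
Proof. by rewrite unitmxE det_ublock unitrM -!unitmxE QAu. Qed.

Let QCs : QC^T = QC.
Proof. by rewrite tr_block_mx !trmx0 QAs QBs. Qed.

(** Vectors of the two summands are orthogonal, hence anticommute in [C]; this gives the sign rule
    [comm] between the images of [A] and [B]. Products of the two images span because their span is
    stable under left multiplication by every vector, and dimensions match. *)
Lemma cliff_tensor : is_tensor t A B C.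
Proof.
have C2 := cliff_sqr quotC.
have [FA FAE] : exists F : {lrmorphism A -> C}, forall v, F (piA (tens1 v)) = incl_l v.
  pose h : {linear 'cV[k]_m -> C} :=
    HB.pack incl_l (GRing.isLinear.Build _ _ _ _ _ incl_l_linear).
  have [phi phiE] := lift_linear h.
  have [v|F FE] := cliff_universal quotA (phi := phi).
    by rewrite !phiE /= /incl_l C2 qformC qform0r addr0.
  by exists F => v; rewrite FE phiE.
have [FB FBE] : exists F : {lrmorphism B -> C}, forall v, F (piB (tens1 v)) = incl_r v.
  pose h : {linear 'cV[k]_n -> C} :=
    HB.pack incl_r (GRing.isLinear.Build _ _ _ _ _ incl_r_linear).
  have [phi phiE] := lift_linear h.
  have [v|F FE] := cliff_universal quotB (phi := phi).
    by rewrite !phiE /= /incl_r C2 qformC qform0r add0r.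
  by exists F => v; rewrite FE phiE.
have lr v w : incl_r w * incl_l v = - (incl_l v * incl_r w).
  apply/eqP; rewrite -addr_eq0; apply/eqP.
  have h := cliff_polar QCs (h := piC \o @tens1 k _) C2.
  by rewrite [LHS]h qformC qform0l qform0r addr0 mulr0 scale0r.
have comm1 w a : incl_r w * FA a = FA (cact A t a) * incl_r w.
  move: a; apply: (cliff_ind quotA) => [|c a a' ha ha'||v a ha].
  - by rewrite !linear0 mulr0 mul0r.
  - by rewrite !linearP /= mulrDr mulrDl ha' -scalerAr ha -scalerAl.
  - by rewrite !rmorph1 mulr1 mul1r.
  move: (tpiA v) (FAE v) (lr v w); move: (piA (tens1 v)) (incl_l v) => u iu tu Fu lru.
  rewrite !rmorphM /= tu rmorphN /= Fu [LHS]mulrA lru mulNr -[in LHS]mulrA ha.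
  by rewrite !mulNr mulrA.
have comm b a : FB b * FA a = FA a * FB (evenp t b) + FA (cact A t a) * FB (oddp t b).
  move: b a; apply: (cliff_ind quotB) => [|c b b' hb hb'||w b hb] a.
  - have e0 : evenp t (0 : B) = 0 by rewrite /evenp linear0 addr0 scaler0.
    have o0 : oddp t (0 : B) = 0 by rewrite /oddp linear0 subr0 scaler0.
    by rewrite e0 o0 linear0 mul0r !mulr0 addr0.
  - rewrite evenp_linear oddp_linear !linearP /= mulrDl -scalerAl hb hb'.
    by rewrite !mulrDr -!scalerAr scalerDr addrACA.
  - by rewrite evenp1 // oddp1 !linear0 mulr0 addr0 !rmorph1 mulr1 mul1r.
  move: (tpiB w) (FBE w); move: (piB (tens1 w)) => u tu Fu.
  rewrite evenp_mull ?oddp_mull // !rmorphM /= Fu -[LHS]mulrA hb mulrDr.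
  by rewrite !mulrA !comm1 (parity_involutive quotA tpiA) addrC.
pose tauf (a : A) : 'Hom(B, C) := (amull (FA a) \o linfun FB)%VF.
have taufE a b : tauf a b = FA a * FB b by rewrite comp_lfunE !lfunE.
have tauf_lin : linear tauf.
  move=> c a a'; apply/lfunP=> b; rewrite add_lfunE scale_lfunE !taufE.
  by rewrite linearP /= mulrDl -scalerAl.
pose tau : {linear A -> 'Hom(B, C)} := HB.pack tauf (GRing.isLinear.Build _ _ _ _ tauf tauf_lin).
have tauE a b : linfun tau a b = FA a * FB b by rewrite lfunE /= taufE.
exists (linfun tau); split=> [||a b a' b'|x a b].
- apply: bilinear_basis => [b c a a'|a c b b'||U sU Umin].
  + by rewrite linearP add_lfunE scale_lfunE.
  + by rewrite linearP.
  + rewrite (cliff_dim char2 QCs QCu quotC) (cliff_dim char2 QAs QAu quotA).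
    by rewrite (cliff_dim char2 QBs QBu quotB) expnD.
  apply: dimvS; apply/subvP=> c _; move: c.
  apply: (cliff_ind quotC) => [|c a b ha hb||v c hc].
  + exact: mem0v.
  + by rewrite memvD ?memvZ.
  + by have := sU 1 1; rewrite tauE !rmorph1 mulr1.
  have : (U <= amull (piC (tens1 v)) @^-1: U)%VS.
    apply: Umin => a b; rewrite -memv_preim lfunE /= -[v]vsubmxK.
    have -> : piC (tens1 (col_mx (usubmx v) (dsubmx v))) =
        FA (piA (tens1 (usubmx v))) + incl_r (dsubmx v).
      by rewrite FAE /incl_l /incl_r -!linearD add_col_mx addr0 add0r.
    rewrite mulrDl memvD //.
      by rewrite tauE mulrA -(rmorphM FA) -tauE.
    by rewrite tauE mulrA comm1 -mulrA -FBE -(rmorphM FB) -tauE.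
  by move/subvP/(_ c hc); rewrite -memv_preim lfunE.
- by rewrite tauE !rmorph1 mulr1.
- rewrite !tauE -mulrA (mulrA (FB b)) comm mulrDl mulrDr !rmorphM /=.
  by rewrite !mulrA.
rewrite !tauE rmorphM /=; congr (_ * _).
  move: a; apply: (cliff_ind quotA) => [|c a a' ha ha'||v a ha].
  - by rewrite !linear0.
  - by rewrite !linearP /= ha ha'.
  - by rewrite !rmorph1.
  have : cact C x (FA (piA (tens1 v))) = FA (cact A x (piA (tens1 v))).
    have e : block_mx (rA x) 0 0 (rB x) *m col_mx v 0 = col_mx (rA x *m v) 0.
      by rewrite mul_block_col !mul0mx !mulmx0 !addr0.
    apply: etrans (congr1 _ (FAE v)) _; apply: etrans (actC x _) _.
    by rewrite e (actA x v) (FAE (rA x *m v)).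
  by move: (piA (tens1 v)) => u hu; rewrite !rmorphM /= ha hu.
move: b; apply: (cliff_ind quotB) => [|c b b' hb hb'||v b hb].
- by rewrite !linear0.
- by rewrite !linearP /= hb hb'.
- by rewrite !rmorph1.
have : cact C x (FB (piB (tens1 v))) = FB (cact B x (piB (tens1 v))).
  have e : block_mx (rA x) 0 0 (rB x) *m col_mx 0 v = col_mx 0 (rB x *m v).
    by rewrite mul_block_col !mul0mx !mulmx0 !add0r.
  apply: etrans (congr1 _ (FBE v)) _; apply: etrans (actC x _) _.
  by rewrite e (actB x v) (FBE (rB x *m v)).
by move: (piB (tens1 v)) => u hu; rewrite !rmorphM /= hb hu.
Qed.

End TensorProduct.

Section Action.
Variables (k : closedFieldType) (n : nat) (Q : 'M[k]_n).
Variables (A : falgType k) (pi : {lrmorphism tensalg k n -> A}).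
Hypothesis quot : is_quotient (cliff_rel Q) pi.

Lemma cliff_lift_isometry (a : 'M[k]_n) : a^T *m Q *m a = Q ->
  exists F : {lrmorphism A -> A}, forall v, F (pi (tens1 v)) = pi (tens1 (a *m v)).
Proof.
move=> aQ; pose h v := pi (tens1 (a *m v)).
have hl : linear h by move=> c u v; rewrite /h mulmxDr -scalemxAr !linearP.
pose h' : {linear 'cV[k]_n -> A} := HB.pack h (GRing.isLinear.Build _ _ _ _ h hl).
have [phi phiE] := lift_linear h'.
have [v|F FE] := cliff_universal quot (phi := phi).
  rewrite !phiE /= /h (cliff_sqr quot); congr (_ *: 1).
  rewrite /qform trmx_mul -!mulmxA (mulmxA Q) (mulmxA a^T) (mulmxA a^T) aQ.
  by rewrite !mulmxA.
by exists F => v; rewrite FE phiE.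
Qed.

Lemma cliff_lrmorph_ext (F G : {lrmorphism A -> A}) :
  (forall v, F (pi (tens1 v)) = G (pi (tens1 v))) -> F =1 G.
Proof.
move=> FG; apply: (cliff_ind quot) => [|c a b ha hb||v a ha].
- by rewrite !linear0.
- by rewrite !linearP /= ha hb.
- by rewrite !rmorph1.
by move: (FG v); move: (pi (tens1 v)) => u hu; rewrite !rmorphM /= hu ha.
Qed.

Variables (Gm : finGroupType) (r : Gm -> 'M[k]_n).
Hypotheses (r1 : r 1%g = 1%:M) (rM : forall x y, r (x * y)%g = r x *m r y).
Hypothesis rQ : forall x, (r x)^T *m Q *m r x = Q.

Lemma cliff_action : exists (B : calg k Gm) (rho : {lrmorphism tensalg k n -> B}),
  is_quotient (cliff_rel Q) rho /\
  forall x v, cact B x (rho (tens1 v)) = rho (tens1 (r x *m v)).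
Proof.
have /choice[F FE] x := cliff_lift_isometry (rQ x).
pose act x : 'AEnd(A) := linfun_ahom (F x).
have actE x a : act x a = F x a by rewrite /= lfunE.
have act1 a : act 1%g a = a.
  rewrite actE; apply: (cliff_lrmorph_ext (F := F 1%g) (G := idfun)) => v.
  by rewrite FE r1 mul1mx.
have actM x y a : act (x * y)%g a = act x (act y a).
  rewrite !actE; apply: (cliff_lrmorph_ext (F := F (x * y)%g) (G := F x \o F y)) => v.
  by rewrite /= !FE rM mulmxA.
exists (CAlg act1 actM), pi; split=> // x v.
by rewrite [LHS]actE FE.
Qed.

End Action.

(** * The projective action on spinors *)

Section EvenClifford.
Variables (k : closedFieldType) (m : nat) (Q : 'M[k]_(m + m)).
Hypothesis char2 : (2 : k) != 0.
Hypotheses (Qs : Q^T = Q) (Qu : Q \in unitmx).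
Variables (A : falgType k) (pi : {lrmorphism tensalg k (m + m) -> A}).
Hypothesis quot : is_quotient (cliff_rel Q) pi.

(** Matrices of size [2 ^ m] contain [2 m] anticommuting elements of square 1. The image of the
    resulting homomorphism contains their independent monomials, so its dimension is [4 ^ m], that
    of both algebras. *)
Lemma cliff_even_matrix : exists d (F : {lrmorphism A -> 'M[k]_d.+1}), bijective F.
Proof.
have [i ii] := closed_sqrt (-1 : k).
have [d [f [dE f1 fC]]] := anticommuting_matrices m ii.
have [P [Pu PQ]] := orthonormal_frame char2 Qs Qu.
pose g (j : 'I_(m + m)) : 'M[k]_d.+1 := f j.
have ltm (j : 'I_(m + m)) : (j < m.*2)%N by rewrite -addnn.
have g1 j : g j * g j = 1 by exact: f1.
have gC j l : j != l -> g j * g l = - (g l * g j) by move=> jl; exact: fC.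
have [phi [phiQ phig]] := frame_clifford_map Qs Pu PQ g1 gC.
have [F FE] := cliff_universal quot phiQ.
have dimF : \dim (limg (linfun F)) = \dim {:A}.
  apply/eqP; rewrite eqn_leq; apply/andP; split.
    by rewrite -(limg_ker_dim (linfun F) fullv) leq_addl.
  rewrite (cliff_dim char2 Qs Qu quot).
  apply: (anticommuting_dim char2 g1 gC).
  - by rewrite oddD addbb.
  - by apply/memv_imgP; exists 1; rewrite ?memvf // lfunE /= rmorph1.
  move=> j _ /memv_imgP[u _ ->]; apply/memv_imgP.
  exists (pi (tens1 (col j P)) * u); first exact: memvf.
  by rewrite !lfunE /= rmorphM /= FE phig.
have F0 : lker (linfun F) == 0%VS.
  rewrite -dimv_eq0 -(eqn_add2r (\dim (limg (linfun F)))).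
  by rewrite -{1}[lker _]capfv limg_ker_dim add0n dimF.
have limgF : limg (linfun F) = fullv.
  apply/eqP; rewrite eqEdim subvf dimF (cliff_dim char2 Qs Qu quot) dimvf /=.
  by rewrite /dim /= dE -expnD.
exists d, F, ((linfun F)^-1)%VF => a.
  by rewrite -[F a](lfunE F) lker0_lfunK.
by rewrite -[F _](lfunE F) limg_lfunVK // limgF memvf.
Qed.

Lemma cliff_unit_ext (z : A) :
  (forall v, z * pi (tens1 v) = pi (tens1 v) * z) -> exists c, z = c%:A.
Proof.
move=> zC; have [d [F [G FK GK]]] := cliff_even_matrix.
have zC' a : z * a = a * z.
  move: a; apply: (cliff_ind quot) => [|c a b ha hb||v a ha].
  - by rewrite mulr0 mul0r.
  - by rewrite mulrDr mulrDl -scalerAr -scalerAl ha hb.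
  - by rewrite mulr1 mul1r.
  by rewrite mulrA zC -!mulrA ha.
have : F z = (F z 0 0)%:M.
  by apply: center_matrix => a; have := congr1 F (zC' (G a)); rewrite !rmorphM /= GK.
move=> FzE; exists (F z 0 0); apply: (can_inj FK).
by rewrite {1}FzE linearZ /= rmorph1 -scalemx1.
Qed.

(** [y^-1 * y'] commutes with all vectors, hence is a scalar. The multipliers and signs in the
    construction of a factor system come from this. *)
Lemma cliff_proportional (j : 'cV[k]_(m + m) -> A) (y y' : A) :
  y \is a GRing.unit ->
  (forall v, y * pi (tens1 v) = j v * y) -> (forall v, y' * pi (tens1 v) = j v * y') ->
  exists c, y' = c *: y.
Proof.
move=> yu yj y'j; have [v|c cE] := @cliff_unit_ext (y^-1 * y').
  apply: (mulrI yu); rewrite -mulrA y'j !mulrA yj -!mulrA.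
  by rewrite !mulVKr // mulrA yj -mulrA mulVKr.
by exists c; rewrite -(mulVKr yu y') cE -scalerAr mulr1.
Qed.

Lemma cliff_inner (F : {lrmorphism A -> A}) :
  exists2 u : A, u \is a GRing.unit & forall a, u * a = F a * u.
Proof.
have [d [M [M' MK M'K]]] := cliff_even_matrix.
pose al (a : 'M[k]_d.+1) := M (F (M' a)).
have M'l : linear M' by move=> c a b; apply: (can_inj MK); rewrite linearP /= !M'K.
have M'1 : M' 1 = 1 by apply: (can_inj MK); rewrite M'K rmorph1.
have M'M a b : M' (a * b) = M' a * M' b by apply: (can_inj MK); rewrite rmorphM /= !M'K.
have [g gu gE] : exists2 g, g \in unitmx & forall a, al a *m g = g *m a.
  apply: skolem_noether => [c a b||a b].
  - by rewrite /al M'l !linearP.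
  - by rewrite /al M'1 !rmorph1.
  by rewrite /al M'M !rmorphM.
exists (M' g).
  apply/unitrP; exists (M' (invmx g)); rewrite -!M'M.
  by rewrite [_ * _](mulVmx gu) [g * _](mulmxV gu) M'1.
move=> a; apply: (can_inj MK); rewrite !rmorphM /= M'K.
by have := gE (M a); rewrite /al MK => e; exact: esym e.
Qed.

(** The element implementing v |-> -v has a square that commutes with all vectors, hence scalar,
    which rescaling turns into -1. Up to a scalar it is the product of an orthonormal basis. *)
Lemma cliff_volume : exists w : A,
  [/\ w \is a GRing.unit, w * w = -1 & forall v, w * pi (tens1 v) = - pi (tens1 v) * w].
Proof.
have [|F FE] := @cliff_lift_isometry _ _ _ _ _ quot (- 1%:M).
  by rewrite [(- _)^T]linearN /= trmx1 mulNmx mul1mx mulNmx mulmxN mulmx1 opprK.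
have FN v : F (pi (tens1 v)) = - pi (tens1 v) by rewrite FE mulNmx mul1mx !linearN.
have [u uu uE] := cliff_inner F.
have uv v : u * pi (tens1 v) = - (pi (tens1 v) * u) by rewrite uE FN mulNr.
have [v|c cE] := @cliff_unit_ext (u * u).
  by rewrite -[LHS]mulrA [u * pi _]uv mulrN [u * (_ * _)]mulrA uv mulNr opprK mulrA.
have c0 : c != 0.
  apply/eqP=> c0; have : u * u \is a GRing.unit by rewrite unitrMl.
  by rewrite cE c0 scale0r unitr0.
have [s ss] := closed_sqrt (- c^-1).
exists (s *: u); split=> [||v].
- rewrite scaler_unit // unitfE; apply/eqP=> s0; move/eqP: ss.
  by rewrite s0 mulr0 eq_sym oppr_eq0 invr_eq0 (negPf c0).
- by rewrite -scalerAl -scalerAr scalerA ss cE scalerA mulNr mulVf // scaleN1r.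
by rewrite -scalerAl uv mulNr -scalerAr scalerN.
Qed.

End EvenClifford.

Section Homogeneous.
Variables (k : closedFieldType) (n : nat).
Hypothesis char2 : (2 : k) != 0.
Variables (A : falgType k) (pi : {lrmorphism tensalg k n -> A}).
Hypothesis pi_surj : forall a, exists p, pi p = a.
Variable w : A.
Hypothesis wu : w \is a GRing.unit.
Hypothesis wC : forall v, w * pi (tens1 v) = - pi (tens1 v) * w.
Local Notation word s := (<< FMonom s >> : tensalg k n).

Lemma sign_word (s : seq 'I_n) : w * pi (word s) = (-1) ^+ odd (size s) *: (pi (word s) * w).
Proof.
elim: s => [|i s IHs]; first by rewrite word_nil rmorph1 mul1r mulr1 scale1r.
have -> : pi (word (i :: s)) = pi (tens1 (delta_mx i 0)) * pi (word s).
  by rewrite word_cons tens1_delta -(rmorphM pi).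
move: (wC (delta_mx i 0)) IHs; move: (pi (tens1 _)) (pi (word s)) => u x wu' IHs.
rewrite [LHS]mulrA wu' -[LHS]mulrA IHs -scalerAr [in LHS]mulrA !mulNr scalerN /=.
by case: (odd _); rewrite /= ?scaleN1r ?scale1r ?opprK ?mulNr.
Qed.

Lemma homog_sign d (u : A) : homog pi d u -> w * u = (-1) ^+ d *: (u * w).
Proof.
move=> [p [-> pd]]; rewrite [p in LHS]tens_sum_words [p in RHS]tens_sum_words.
rewrite !(linear_sum pi) mulr_sumr mulr_suml scaler_sumr big_seq [RHS]big_seq.
apply: eq_bigr => v vp; rewrite !(linearZ_LR pi) -scalerAr -scalerAl /= scalerA.
have := pd v vp; rewrite /fdeg => <-; case: v vp => s _ /=.
by rewrite sign_word scalerA mulrC.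
Qed.

(** A preimage splits into an even and an odd part. The hypothesis forces twice the image of the
    part of wrong parity to vanish, so the part of parity [d] is itself a preimage. *)
Lemma sign_homog (d : bool) (u : A) : w * u = (-1) ^+ d *: (u * w) -> homog pi d u.
Proof.
move=> uC; have [p pE] := pi_surj u.
pose part e := \sum_(v <- msupp p | odd (fdeg v) == e) p@_v *: word v.
have partS e : w * pi (part e) = (-1) ^+ e *: (pi (part e) * w).
  rewrite (linear_sum pi) mulr_sumr mulr_suml scaler_sumr.
  apply: eq_bigr => v /eqP vd; rewrite !(linearZ_LR pi) -scalerAr -scalerAl /= scalerA.
  by rewrite sign_word scalerA mulrC -vd /fdeg; case: (v).
have split_p : p = part d + part (~~ d).
  rewrite [LHS]tens_sum_words (bigID (fun v => odd (fdeg v) == d)) /=; congr (_ + _).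
  by apply: eq_bigl => v; case: (odd _); case: (d).
exists (part d); split.
  have uE : u = pi (part d) + pi (part (~~ d)) by rewrite -pE {1}split_p linearD.
  move: uC; rewrite uE mulrDr !partS mulrDl scalerDr => /addrI/eqP.
  have -> : (-1) ^+ (~~ d) = - (-1) ^+ d :> k by case: (d); rewrite ?opprK.
  rewrite scaleNr -subr_eq0 -opprD oppr_eq0 -mulr2n -scaler_nat !scaler_eq0.
  rewrite (negPf char2) signr_eq0 /= => /eqP h.
  have : pi (part (~~ d)) * w = 0 * w by rewrite h mul0r.
  by move/(mulIr wu) => ->; rewrite addr0.
move=> v; rewrite -mcoeff_neq0; apply: contraNeq => vd.
rewrite raddf_sum big1 // => v' /eqP v'd.
rewrite /= mcoeffZ mcoeffU fmK; case: eqP => [e|_]; last by rewrite mulr0n mulr0.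
by move: vd; rewrite -e v'd eqxx.
Qed.

End Homogeneous.

Section OrthogonalSums.
Variables (k : fieldType) (gT : finGroupType).

Lemma block_mx_repr m n (r : mx_representation k [set: gT] m)
    (s : mx_representation k [set: gT] n) :
  mx_repr [set: gT] (fun g => block_mx (r g) 0 0 (s g)).
Proof.
split=> [|x y _ _]; first by rewrite !repr_mx1 -scalar_mx_block.
by rewrite mulmx_block !mulmx0 !mul0mx !addr0 !add0r !repr_mxM ?inE.
Qed.

Lemma orth_sum_sym (X Y : orthrep k gT) :
  (block_mx (oform X) 0 0 (oform Y))^T = block_mx (oform X) 0 0 (oform Y).
Proof. by rewrite tr_block_mx !trmx0 !oform_sym. Qed.

Lemma orth_sum_nondeg (X Y : orthrep k gT) :
  block_mx (oform X) 0 0 (oform Y) \in unitmx.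
Proof. by rewrite unitmxE det_ublock unitrM -!unitmxE !oform_nondeg. Qed.

Lemma orth_sum_inv (X Y : orthrep k gT) x :
  (block_mx (orep X x) 0 0 (orep Y x))^T *m block_mx (oform X) 0 0 (oform Y)
    *m block_mx (orep X x) 0 0 (orep Y x) = block_mx (oform X) 0 0 (oform Y).
Proof.
rewrite tr_block_mx !trmx0 !mulmx_block !mulmx0 !mul0mx !addr0 !add0r ?mulmx0 ?mul0mx.
by rewrite !oform_inv.
Qed.

Definition orth_sum (X Y : orthrep k gT) : orthrep k gT :=
  @OrthRep k gT _ (MxRepresentation (block_mx_repr (orep X) (orep Y))) _
    (orth_sum_sym X Y) (orth_sum_nondeg X Y) (orth_sum_inv X Y).

Lemma triv_mx_repr n : mx_repr [set: gT] (fun=> 1%:M : 'M[k]_n).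
Proof. by split=> // x y _ _; rewrite mulmx1. Qed.

Definition orth_triv n : orthrep k gT :=
  @OrthRep k gT n (MxRepresentation (triv_mx_repr n)) 1%:M
    (trmx1 _ _) (unitmx1 _ _) (fun x => etrans (mulmx1 _) (etrans (mulmx1 _) (trmx1 _ _))).

Variable X : orthrep k gT.
Local Notation r := (minus_mx (orep X)).

Lemma minus_mx1 : r 1%g = 1%:M.
Proof. by rewrite /minus_mx repr_mx1 /sgn expr0 scale1r. Qed.

Lemma minus_mxM x y : r (x * y)%g = r x *m r y.
Proof. by rewrite -(repr_mxM (minus_rep (orep X))) ?inE. Qed.

Lemma minus_mxt : r (parity gT) = - 1%:M.
Proof. by rewrite /minus_mx repr_mx1 /sgn /= expr1 scaleN1r. Qed.

Lemma minus_mx_unit x : r x \in unitmx.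
Proof. by have := repr_mx_unit (minus_rep (orep X)) (finset.in_setT x). Qed.

End OrthogonalSums.

(** * Factor systems in the Clifford group *)

Section Beta.
Variables (k : closedFieldType) (gT : finGroupType).
Hypothesis char2 : (2 : k) != 0.
Variable X : orthrep k gT.
Local Notation Gm := (gT * 'Z_2)%type.
Local Notation t := (parity gT).
Local Notation n := (odim X).
(** [oform Y] is convertible to [tilde_form X], and the action of [Y] twisted by the sign of [t] to
    [tilde_rep X], so facts about orthogonal representations apply to X~ as they stand. *)
Let Y := orth_sum X (orth_triv k gT n).
Local Notation T := (tensalg k (n + n)).
Local Notation rho := (tilde_rep X).

Let rho_inv x : (rho x)^T *m tilde_form X *m rho x = tilde_form X.
Proof. exact: (tpsi_inv Y x). Qed.

Let rho_t : rho t = - 1%:M. Proof. exact: (minus_mxt Y). Qed.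
Let rhoM x y : rho (x * y)%g = rho x *m rho y. Proof. exact: (minus_mxM Y). Qed.
Let rho_unit x : rho x \in unitmx. Proof. exact: (minus_mx_unit Y). Qed.

Let Qs : (tilde_form X)^T = tilde_form X. Proof. exact: (oform_sym Y). Qed.
Let Qu : tilde_form X \in unitmx. Proof. exact: (oform_nondeg Y). Qed.

Lemma sign_inj (A : falgType k) (a b : bool) (u : A) : u \is a GRing.unit ->
  (-1 : k) ^+ a *: u = (-1) ^+ b *: u -> a = b.
Proof.
move=> uu /eqP; rewrite -subr_eq0 -scalerBl scaler_eq0 => /orP[|/eqP u0]; last first.
  by rewrite u0 unitr0 in uu.
case: a; case: b => //=; rewrite ?expr0 ?expr1 -?opprD ?oppr_eq0 ?opprK;
  by rewrite -[1 + 1]/(2 : k) (negPf char2).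
Qed.

(* The inner implementers r x of the action satisfy w (r x) = +- (r x) w, where w
   anticommutes with all vectors; the sign is the degree of r x, and r x w
   implements the twisted adjoint action when r x is odd. *)
Lemma is_beta_exists : exists b, is_beta X b.
Proof.
have [A [pi quot]] := cliff_exists char2 Qs Qu.
have [w [wu w2 wC0]] := cliff_volume char2 Qs Qu quot.
have [surj _] := quot.
have scalarP (u u' : A) c : u \is a GRing.unit -> u' = c *: u -> u' \is a GRing.unit -> c != 0.
  by move=> uu -> h; apply: contraTneq h => ->; rewrite scale0r unitr0.
have [j [jE jL]] : exists j : 'cV[k]_(n + n) -> A,
    (forall v, j v = pi (tens1 v)) /\ (forall c v, j (c *: v) = c *: j v).
  by exists (fun v => pi (tens1 v)); split=> // c v; rewrite !linearZ_LR.
have wC v : w * j v = - (j v * w) by rewrite jE wC0 mulNr.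
have prop (h : 'cV[k]_(n + n) -> A) (y y' : A) : y \is a GRing.unit ->
    (forall v, y * j v = h v * y) -> (forall v, y' * j v = h v * y') -> exists c, y' = c *: y.
  move=> yu hy hy'; apply: (cliff_proportional char2 Qs Qu quot (j := h) yu) => v.
    by rewrite -jE.
  by rewrite -jE.
have /choice[r rP] (x : Gm) : exists r : A, r \is a GRing.unit /\
    forall v, r * j v = j (rho x *m v) * r.
  have [F FE] := cliff_lift_isometry quot (rho_inv x).
  have [r ru rE] := cliff_inner char2 Qs Qu quot F.
  have Fj v : F (j v) = j (rho x *m v) by rewrite (jE v) (jE (rho x *m v)); exact: FE.
  by exists r; split=> // v; rewrite rE Fj.
have ru x : r x \is a GRing.unit by have [] := rP x.
have rE x v : r x * j v = j (rho x *m v) * r x by have [_] := rP x.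
(* [w * r x] and [r x * w] implement the same map v |-> - rho(x) v, so they differ by a scalar [c];
   as w ^ 2 = -1, moving [w] past [r x] twice gives c ^ 2 = 1. *)
have /choice[d dP] (x : Gm) : exists d : bool, w * r x = (-1) ^+ d *: (r x * w).
  have [|v|v|c cE] := prop (fun v => - j (rho x *m v)) (r x * w) (w * r x).
  - by rewrite unitrMl.
  - by rewrite -[LHS]mulrA wC mulrN [r x * (_ * _)]mulrA rE mulNr mulrA.
  - by rewrite -[LHS]mulrA rE [w * (_ * _)]mulrA wC !mulNr mulrA.
  have c2 : c * c = 1.
    have : w * (w * r x) = (c * c) *: (r x * (w * w)).
      by rewrite [w * r x]cE -scalerAr [w * (_ * _)]mulrA cE -scalerAl scalerA -mulrA.
    rewrite mulrA w2 mulN1r mulrN1 scalerN => /oppr_inj h.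
    apply/eqP; rewrite -subr_eq0; apply: contraTT (ru x) => c0.
    have : (c * c - 1) *: r x = 0 by rewrite scalerBl -h scale1r subrr.
    by move/eqP; rewrite scaler_eq0 (negPf c0) => /eqP ->; rewrite unitr0.
  move/eqP: c2; rewrite -expr2 sqrf_eq1 => /orP[/eqP c1|/eqP c1].
    by exists false; rewrite cE c1.
  by exists true; rewrite cE c1.
have rM x y : exists2 c, c != 0 & r x * r y = c *: r (x * y)%g.
  have [|v|v|c cE] := prop (fun v => j (rho (x * y)%g *m v)) (r (x * y)%g) (r x * r y).
  - exact: ru.
  - exact: rE.
  - by rewrite -[LHS]mulrA rE [r x * (_ * _)]mulrA rE -[LHS]mulrA mulmxA rhoM.
  by exists c => //; apply: scalarP cE _; rewrite ?unitrMl.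
have dM x y : d (x * y)%g = d x (+) d y.
  have [c c0 cE] := rM x y.
  apply: (@sign_inj A _ _ (r (x * y)%g * w)); first by rewrite unitrMl.
  apply: (scalerI c0).
  rewrite -dP scalerAr -cE [w * (_ * _)]mulrA dP -scalerAl -mulrA dP -scalerAr scalerA mulrA cE.
  by rewrite -scalerAl !scalerA signr_addb mulrC.
pose u x := if d x then r x * w else r x.
have uu x : u x \is a GRing.unit by rewrite /u; case: (d x); rewrite ?unitrMl.
have uE x v : u x * j v = (-1) ^+ d x *: (j (rho x *m v) * u x).
  rewrite /u; case: (d x); last by rewrite rE scale1r.
  by rewrite -[LHS]mulrA wC mulrN [r x * (_ * _)]mulrA rE expr1 scaleN1r mulrA.
have uw x : w * u x = (-1) ^+ d x *: (u x * w).
  have := dP x; rewrite /u; case: (d x) => // e.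
  by rewrite mulrA e -scalerAl.
have uconj x v : u x * j v / u x = (-1) ^+ d x *: j (rho x *m v).
  by rewrite uE -scalerAl mulrK.
have /choice[b0 b0E] (p : Gm * Gm) : exists c, u p.1 * u p.2 = c *: u (p.1 * p.2)%g.
  case: p => x y /=; move: (uu) (uE) => {}uu {}uE; clear uw uconj; move: u uu uE => u uu uE.
  apply: (prop (fun v => (-1) ^+ d (x * y)%g *: j (rho (x * y)%g *m v))) => // v.
    by rewrite uE scalerAl.
  rewrite -[LHS]mulrA uE -scalerAr [u x * (_ * _)]mulrA uE -scalerAl scalerA -mulrA mulmxA -rhoM.
  by rewrite dM signr_addb scalerAl mulrC.
have b00 x y : b0 (x, y) != 0.
  by apply: scalarP (b0E (x, y)) _ => //=; rewrite unitrMl.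
move: (uu) (b0E) (uconj) (uw); clear uE uconj uw b0E uu; move: u => u uu b0E uconj uw.
have b0C x y z : b0 (x, y) * b0 ((x * y)%g, z) = b0 (x, (y * z)%g) * b0 (y, z).
  have : u x * u y * u z = u x * (u y * u z) by rewrite mulrA.
  rewrite (b0E (x, y)) (b0E (y, z)) /= -scalerAl -scalerAr.
  rewrite (b0E ((x * y)%g, z)) (b0E (x, (y * z)%g)) /= !scalerA mulgA => /eqP.
  rewrite -subr_eq0 -scalerBl scaler_eq0 => /orP[|/eqP u0].
    by rewrite subr_eq0 => /eqP ->; rewrite mulrC.
  by have := uu (x * y * z)%g; rewrite u0 unitr0.
exists (mkcocycle b00 b0C), A, pi, d, u; split; [exact: quot|move=> x|move=> x y]; last first.
  by rewrite (b0E (x, y)) ffunE.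
split; [|exact: uu| |].
- exact: (sign_homog char2 surj wu wC0 (uw x)).
- have uconj' v : u x * pi (tens1 v) / u x = (-1) ^+ d x *: j (rho x *m v).
    exact: etrans (congr1 (fun a => u x * a / u x) (esym (jE v))) (uconj x v).
  apply/seteqP; split=> _ [v _ <-].
    exists ((-1) ^+ d x *: (rho x *m v)); first exact: I.
    by apply: etrans (esym (jE _)) (etrans (jL _ _) (esym (uconj' v))).
  exists ((-1) ^+ d x *: (invmx (rho x) *m v)); first exact: I.
  apply: etrans (uconj' _) _; apply: etrans (esym (jL _ _)) _; apply: etrans (jE _) _.
  by congr (pi (tens1 _)); rewrite -scalemxAr mulKVmx // scalerA -expr2 sqrr_sign scale1r.
move=> v; apply: etrans (jE _).
apply: etrans (congr1 (fun a => _ *: (u x * a / u x)) (esym (jE v))) _.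
by rewrite uconj scalerA -expr2 sqrr_sign scale1r.
Qed.

End Beta.

Section Beta.
Variables (k : closedFieldType) (gT : finGroupType).
Hypothesis charN2 : 2%N \notin [pchar k].
Variable X : orthrep k gT.
Local Notation Gm := (gT * 'Z_2)%type.
Local Notation t := (parity gT).
Local Notation n := (odim X).
Let Y := orth_sum X (orth_triv k gT n).
Local Notation T := (tensalg k (n + n)).
Local Notation rho := (tilde_rep X).
Let char2 : (2 : k) != 0 := two_neq0 charN2.

Let rho_t : rho t = - 1%:M. Proof. exact: (minus_mxt Y). Qed.
Let Qs : (tilde_form X)^T = tilde_form X. Proof. exact: (oform_sym Y). Qed.
Let Qu : tilde_form X \in unitmx. Proof. exact: (oform_nondeg Y). Qed.

Lemma scale_form_sym m (c : k) (Q : 'M[k]_m) : Q^T = Q -> (c *: Q)^T = c *: Q.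
Proof. by move=> e; rewrite linearZ /= e. Qed.

Lemma scale_form_unit m (c : k) (Q : 'M[k]_m) : c != 0 -> Q \in unitmx -> c *: Q \in unitmx.
Proof. by move=> c0 Q1; rewrite unitmxZ ?unitfE. Qed.

(** Multiplying vectors by [c] keeps the algebra and scales the form by c ^ 2; c ^ 2 = 1/2 leads
    from the Clifford algebra defining beta_X to the Weyl algebra. *)
Lemma cliff_rescale m (c : k) (Q : 'M[k]_m) (A : falgType k)
    (pi : {lrmorphism tensalg k m -> A}) : c != 0 -> Q^T = Q -> Q \in unitmx ->
    is_quotient (cliff_rel Q) pi ->
  exists pi' : {lrmorphism tensalg k m -> A},
    is_quotient (cliff_rel ((c * c) *: Q)) pi' /\ forall v, pi' (tens1 v) = c *: pi (tens1 v).
Proof.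
move=> c0 Q1 Q2 quot.
pose h (v : 'cV[k]_m) : A := c *: pi (tens1 v).
have hl : linear h.
  by move=> a u v; rewrite /h (linearP (@tens1 k m)) (linearP pi) scalerDr !scalerA [c * a]mulrC.
pose h' : {linear 'cV[k]_m -> A} := HB.pack h (GRing.isLinear.Build _ _ _ _ h hl).
have [phi phiE] := lift_linear h'.
exists phi; split; last exact: phiE.
have surj a : exists p, phi p = a.
  move: a; apply: (cliff_ind quot) => [|a u v [p pE] [q qE]||v a [p pE]].
  - by exists 0; rewrite linear0.
  - by exists (a *: p + q); rewrite linearP /= pE qE.
  - by exists 1; rewrite rmorph1.
  exists (tens1 (c^-1 *: v) * p).
  apply: etrans (rmorphM phi _ _) _; rewrite -[LHS]/(phi (tens1 (c^-1 *: v)) * phi p).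
  rewrite pE phiE; congr (_ * _); rewrite /= /h.
  by rewrite (linearZ_LR (@tens1 k m)) (linearZ_LR pi) scalerA mulfV // scale1r.
have cc0 : c * c != 0 by rewrite mulf_neq0.
have [v|_] := cliff_dim_le char2 (scale_form_sym (c * c) Q1)
  (scale_form_unit cc0 Q2) surj; last first.
  by apply; rewrite (cliff_dim char2 Q1 Q2 quot).
rewrite !phiE /= /h -scalerAl -scalerAr scalerA (cliff_sqr quot) scalerA.
by congr (_ *: 1); rewrite /qform -scalemxAr -scalemxAl [RHS]mxE.
Qed.

(* r x := u x * w ^ (d x) implements the untwisted action; the sign
   (-1)^(d x * d y) from moving w past u y is cancelled by w ^ 2 = -1, so the
   multiplier of r is b itself. *)
Lemma is_beta_projEnd b : is_beta X b -> exists A : azu k t,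
  is_weyl (tpsi charN2 Y) A /\ is_projEnd A b.
Proof.
move=> [A [pi [d [u [quot uP uM]]]]].
have [w [wu w2 wC0]] := cliff_volume char2 Qs Qu quot.
have [j [jE jL]] : exists j : 'cV[k]_(n + n) -> A,
    (forall v, j v = pi (tens1 v)) /\ (forall c v, j (c *: v) = c *: j v).
  by exists (fun v => pi (tens1 v)); split=> // c v; rewrite !linearZ_LR.
have wC v : w * j v = - (j v * w) by rewrite jE wC0 mulNr.
have uu x : u x \is a GRing.unit by have [] := uP x.
have uw x : w * u x = (-1) ^+ d x *: (u x * w).
  by have [hu _ _ _] := uP x; exact: (homog_sign wC0 hu).
have uE x v : u x * j v / u x = (-1) ^+ d x *: j (rho x *m v).
  have [_ _ _ h] := uP x.
  have s0 : (-1) ^+ d x != 0 :> k by rewrite signr_eq0.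
  apply: (scalerI s0); rewrite [RHS]scalerA -expr2 sqrr_sign scale1r.
  apply: etrans (etrans _ (h v)) (esym (jE _)).
  by congr (_ *: (_ * _ / _)); exact: jE.
have b0 x y : b (x, y) != 0 by exact: coneq0.
have dM x y : d (x * y)%g = d x (+) d y.
  apply: (@sign_inj k char2 A _ _ (u (x * y)%g * w)); first by rewrite unitrMl.
  apply: (scalerI (b0 x y)).
  rewrite -uw scalerAr -uM [w * (_ * _)]mulrA uw -scalerAl -mulrA uw -scalerAr scalerA.
  by rewrite mulrA uM -scalerAl !scalerA signr_addb mulrC.
pose r x := if d x then u x * w else u x.
have ru x : r x \is a GRing.unit by rewrite /r; case: (d x); rewrite ?unitrMl.
have rE x v : r x * j v / r x = j (rho x *m v).
  rewrite /r; have := uE x v; case: (d x); rewrite ?scale1r //= scaleN1r => e.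
  by rewrite -[u x * w * _]mulrA wC mulrN mulNr invrM // mulrA mulrA mulrK // e opprK.
have rM x y : r x * r y = b (x, y) *: r (x * y)%g.
  rewrite /r dM; have := uw y; have := uM x y; case: (d x); case: (d y) => /= e ew.
  - rewrite -mulrA [w * (_ * _)]mulrA ew -scalerAl expr1 scaleN1r -mulrA w2 mulrN1 opprK.
    exact: e.
  - by rewrite -mulrA ew scale1r mulrA e -scalerAl.
  - by rewrite mulrA e -scalerAl.
  - exact: e.
(* [b] need not be normalised, but [r 1%g] is still a scalar, so conjugation by it is trivial. *)
have r1 : exists c, r 1%g = c%:A.
  exists (b (1%g, 1%g)).
  by apply: (mulrI (ru 1%g)); rewrite rM mulg1 -scalerAr mulr1.
have act_lin x : linear (fun a => r x * a / r x).
  by move=> c a a'; rewrite mulrDr mulrDl -scalerAr -scalerAl.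
have act_mul x : monoid_morphism (fun a => r x * a / r x).
  split=> [|a a']; first by rewrite mulr1 divrr.
  by rewrite !mulrA mulrVK.
pose conj x : {lrmorphism A -> A} := HB.pack (fun a : A => r x * a / r x)
  (GRing.isLinear.Build k A A _ _ (act_lin x))
  (GRing.isMonoidMorphism.Build A A _ (act_mul x)).
pose act x : 'AEnd(A) := linfun_ahom (conj x).
have actE x a : act x a = r x * a / r x by exact: (lfunE (conj x) a).
have act1 a : act 1%g a = a.
  have [c cE] := r1; apply: (mulIr (ru 1%g)).
  by rewrite actE mulrVK // cE -scalerAl mul1r -scalerAr mulr1.
have actM x y a : act (x * y)%g a = act x (act y a).
  rewrite !actE; apply: (mulIr (ru (x * y)%g)); rewrite mulrVK //.
  apply: (scalerI (b0 x y)); rewrite scalerAl scalerAr -rM !mulrA mulrVK // mulrVK //.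
pose B := CAlg act1 actM.
have [s ss] := closed_sqrt (2^-1 : k).
have s0 : s != 0.
  by apply/eqP=> s0; move/eqP: ss; rewrite s0 mul0r eq_sym invr_eq0 (negPf char2).
have [pi' [quot' piE]] := cliff_rescale s0 Qs Qu quot.
rewrite ss in quot'.
have actB x v : cact B x (pi' (tens1 v)) = pi' (tens1 (rho x *m v)).
  have piE' y : pi' (tens1 y) = s *: j y by exact: etrans (piE y) (congr1 _ (esym (jE y))).
  have e : r x * (s *: j v) / r x = s *: j (rho x *m v) by rewrite -scalerAr -scalerAl rE.
  apply: etrans (actE x _) (etrans _ (etrans e (esym (piE' _)))).
  exact: (congr1 (fun a : A => r x * a / r x) (piE' v)).
have h0 : 2^-1 != 0 :> k by rewrite invr_eq0.
have azB : azumaya t B.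
  apply: (@cliff_azumaya _ _ t char2 B _ _ (scale_form_sym _ Qs)
    (scale_form_unit h0 Qu) pi' quot') => v.
  by rewrite actB rho_t mulNmx mul1mx !linearN.
exists (Azu azB); split.
  exists pi'; split; last exact: actB.
  exact/weyl_quotientP.
have [N [F Fbij]] := cliff_even_matrix char2 Qs Qu quot.
have FZ c a : F (c *: a) = c *: F a by exact: (linearZ_LR F).
have [i ii] := closed_sqrt (-1 : k).
have Fu x : F (r x) \in unitmx by have := rmorph_unit F (ru x).
(* The factor [i] makes the parity operator an involution, since w ^ 2 = -1. *)
exists N.+1, (i *: F w), (fun x => F (r x)); split.
- rewrite -scalemxAl -scalemxAr scalerA ii -[F w *m F w](rmorphM F) w2.
  by rewrite rmorphN rmorph1 scaleN1r opprK.
(* Conjugation by [r t] and by [w] both negate vectors, so [r t] is a multiple of [w]. *)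
- have [v|v|c cE] := cliff_proportional char2 Qs Qu quot (j := fun v => - j v) wu (y' := r t).
  + by rewrite -jE wC mulNr.
  + rewrite -jE -[LHS](mulrVK (ru t)) rE rho_t mulNmx mul1mx.
    by rewrite -scaleN1r jL scaleN1r.
  by exists (- i * c); rewrite cE FZ scalerA mulrAC mulNr ii opprK mul1r.
- exact: Fu.
- by move=> x y; rewrite -FZ -rM; exact: esym (rmorphM F _ _).
exists (linfun F); split.
- have [G FG GF] := Fbij; exists G => a; rewrite ?lfunE /=; [exact: FG|exact: GF].
- by rewrite lfunE /= rmorph1.
- by move=> a a'; rewrite !lfunE /= rmorphM.
move=> x a; rewrite !(lfunE F); apply: etrans (congr1 F (actE x a)) _.
by rewrite !rmorphM /= (rmorphV F (ru x)).
Qed.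

End Beta.

(** * The Witt group *)

Section Exponent.
Variables (k : fieldType) (gT : finGroupType).
Local Notation Gm := (gT * 'Z_2)%type.
Implicit Types (b c : cocycle k gT) (x y z : Gm).

(** When [eps] vanishes, the sign in the twisted product is trivial and powers are taken
    pointwise. *)
Lemma H2class_expg b n : (forall x, eps b x = false) ->
  exists c, [/\ (H2class b ^+ n)%g = H2class c, forall x, eps c x = false
    & forall x y, c (x, y) = b (x, y) ^+ n].
Proof.
move=> eb; elim: n => [|n [c [cE ec cb]]].
  exists (coone k gT); split=> // [x|x y]; first exact: eps_coone.
  by rewrite cooneE.
exists (comul b c); split=> [|x|x y].
- by rewrite expgS cE [LHS]H2mulE.
- by rewrite eps_comul eb ec.
by rewrite comulE eb expr0 mul1r cb exprS.
Qed.

(* c := b * b has trivial eps, so its #|Gm|-th power is the pointwise power,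
   which is the coboundary of x |-> \prod_z c (x, z). *)
Lemma H2star_exponent : exists N, forall u : H2star k gT, (u ^+ N.+1)%g = 1%g.
Proof.
pose M := #|{: Gm}|.
have N0 : (0 < 2 * M)%N by rewrite muln_gt0; apply/card_gt0P; exists 1%g.
exists (2 * M).-1; rewrite prednK //; elim/H2ind=> b.
have e0 x : eps (comul b b) x = false by rewrite eps_comul addbb.
have [c [cE _ cb]] := H2class_expg M e0.
rewrite expgnA expg2 [(_ * _)%g]H2mulE cE.
apply/H2classP/asboolP.
pose f x := \prod_z comul b b (x, z).
have f0 x : f x != 0 by apply/prodf_neq0 => z _; exact: coneq0.
exists (fun x => (f x)^-1); split=> [x|x y]; first by rewrite invr_eq0.
rewrite cooneE cb.
(* This is the cocycle identity multiplied over all [z], with [z] reindexed by translation by [y] in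
   one factor. *)
have e : comul b b (x, y) ^+ M * f (x * y)%g = f x * f y.
  rewrite /f -prodr_const -big_split /=.
  rewrite (eq_bigr _ (fun z _ => cocycleE (comul b b) x y z)) big_split /=.
  by congr (_ * _); rewrite [RHS](reindex_inj (mulgI y)).
apply: (mulIf (f0 (x * y)%g)); rewrite mul1r mulrAC e.
by field; rewrite ?oner_neq0 ?f0.
Qed.

End Exponent.

(** * Objects whose symmetric algebra has finite length *)

Section FiniteLength.
Variables (k : closedFieldType) (gT : finGroupType).
Hypothesis charN2 : 2%N \notin [pchar k].
Local Notation Gm := (gT * 'Z_2)%type.
Local Notation t := (parity gT).
Let char2 : (2 : k) != 0 := two_neq0 charN2.
Variable V : symp k t.
Local Notation n := (sdim V).
Local Notation T := (tensalg k n).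
Local Notation r := (srep V).

Lemma srep_t2 : r t *m r t = 1%:M.
Proof. by rewrite -repr_mxM ?inE // parity2 repr_mx1. Qed.

Lemma srep_tC x : r x *m r t = r t *m r x.
Proof. by rewrite -!repr_mxM ?inE // parityC. Qed.

Definition even_functional (l : 'rV[k]_n) := l *m r t = l.

Definition eval_functional (l : 'rV[k]_n) : {lrmorphism T -> {poly k}} :=
  lift_tens (fun i => l 0 i *: 'X).

Lemma eval_tens1 l v : eval_functional l (tens1 v) = (l *m v) 0 0 *: 'X.
Proof.
rewrite [LHS]lift_tens1 mxE scaler_suml; apply: eq_bigr => i _.
by rewrite scalerA mulrC.
Qed.

Lemma eval_tens2 l (M : 'M[k]_n) :
  eval_functional l (tens2 M) = (l *m M *m l^T) 0 0 *: 'X^2.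
Proof.
have phiM i j : eval_functional l (<< fmu i >> * << fmu j >>) = (l 0 i * l 0 j) *: 'X^2.
  apply: etrans (rmorphM (eval_functional l) _ _) _.
  apply: etrans (congr2 _ (lift_fmu _ _) (lift_fmu _ _)) _.
  by rewrite -scalerAl -scalerAr scalerA expr2.
rewrite /tens2 (linear_sum (eval_functional l)) mxE scaler_suml.
transitivity (\sum_i \sum_j (M i j * (l 0 i * l 0 j)) *: 'X^2 : {poly k}).
  apply: eq_bigr => i _; rewrite (linear_sum (eval_functional l)); apply: eq_bigr => j _.
  apply: etrans (linearZ_LR (eval_functional l) _ _) _; rewrite -scalerA.
  by congr (_ *: _); exact: phiM.
rewrite exchange_big; apply: eq_bigr => j _ /=; rewrite -scaler_suml; congr (_ *: _).
rewrite !mxE mulr_suml; apply: eq_bigr => i _; rewrite mulrA; congr (_ * _).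
by rewrite mulrC.
Qed.

(** A functional fixed by [t] sees only the even part, where the braiding is the plain flip;
    commutators die in a commutative target. *)
Lemma eval_kills l : even_functional l ->
  forall p, ideal_gen (sym_rel V) p -> eval_functional l p = 0.
Proof.
move=> el p; apply: ideal_gen_ker => _ [M _ <-].
have el' : (r t)^T *m l^T = l^T by rewrite -trmx_mul el.
suff: eval_functional l (tens2 (M - braiding (r t) M)) = 0 by [].
rewrite eval_tens2; set c := _ 0 0; suff -> : c = 0 by rewrite scale0r.
rewrite /c mulmxBr mulmxBl mxE [X in _ + X]mxE /braiding.
set N := _ *: _.
have -> : (l *m N^T *m l^T) 0 0 = (l *m N *m l^T) 0 0.
  have <- : (l *m N *m l^T)^T 0 0 = (l *m N *m l^T) 0 0 by rewrite mxE.
  by rewrite !trmx_mul trmxK mulmxA.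
have lP : l *m (r t *m M) = l *m M by rewrite mulmxA el.
have Pl (K : 'M_n) : l *m (K *m (r t)^T) *m l^T = l *m K *m l^T.
  by rewrite mulmxA -mulmxA el'.
have e : l *m N *m l^T = l *m M *m l^T.
  rewrite /N -scalemxAr -scalemxAl !mulmxDr mulmxN !mulmxDl mulNmx !Pl lP.
  by rewrite addrK -mulr2n -scaler_nat scalerA mulVf ?scale1r.
by rewrite e subrr.
Qed.

Lemma eval_tensmap l (a : 'M[k]_n) p :
  eval_functional l (tensmap a p) = eval_functional (l *m a) p.
Proof.
rewrite /tensmap (linear_sum (eval_functional l)); apply: eq_bigr => v _.
rewrite (linearZ_LR (eval_functional l)); congr (_ *: _).
apply: etrans (rmorph_prod (eval_functional l) _ _ _) _; apply: eq_bigr => i _.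
apply: etrans (eval_tens1 _ _) _.
by congr (_ *: _); rewrite colE mulmxA -colE mxE.
Qed.

(* A functional l on the even part of V induces an algebra map SV -> k['X];
   filtering SV by the degrees of these images gives infinite chains as soon as
   some l is non-zero. *)
Lemma finite_length_odd : sym_finite_length V -> r t = - 1%:M.
Proof.
move=> [N finV]; apply: contrapT => Pn1.
have [l0 el0 l00] : exists2 l, even_functional l & l != 0.
  have P1 : 1%:M + r t != 0.
    by apply/eqP=> /eqP; rewrite addrC addr_eq0 => /eqP.
  have [i rowi] : exists i, row i (1%:M + r t) != 0.
    apply/existsP; rewrite -negb_forall; apply: contraNN P1 => /forallP h.
    by apply/eqP/row_matrixP=> i; rewrite row0; apply/eqP.
  exists (row i (1%:M + r t)) => //.
  by rewrite /even_functional -row_mul mulmxDl mul1mx srep_t2 addrC.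
have [j lj] : exists j, l0 0 j != 0.
  apply/existsP; rewrite -negb_forall; apply: contraNN l00 => /forallP h.
  by apply/eqP/rowP=> j; rewrite mxE; apply/eqP.
(* Ranging over all even functionals, and not only [l0], makes [W i] stable under the group:
   translating by [x] keeps a functional even because [t] is central. *)
pose W i : set T := fun p => forall l, even_functional l -> (size (eval_functional l p) <= i)%N.
have Wsub i : sym_subobject (W i).
  split=> [p Ip l el|c p q Wp Wq l el|x p Wp l el].
  - by rewrite eval_kills // size_poly0.
  - rewrite (linearP (eval_functional l)); apply: leq_trans (size_polyD _ _) _.
    by rewrite geq_max Wq // (leq_trans (size_scale_leq _ _)) // Wp.
  by rewrite eval_tensmap; apply: Wp; rewrite /even_functional -mulmxA srep_tC mulmxA el.
pose e := tens1 (delta_mx j 0 : 'cV[k]_n).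
have evalX l i : eval_functional l (e ^+ i) = (l 0 j) ^+ i *: 'X^i.
  apply: etrans (rmorphXn (eval_functional l) _ _) _.
  rewrite -[RHS]exprZn; congr (_ ^+ _); apply: etrans (eval_tens1 _ _) _.
  by rewrite -colE mxE.
have Wlt i : (W i `<` W i.+1)%classic.
  split=> [p Wp l el|/(_ (e ^+ i))]; first exact: leq_trans (Wp l el) (leqnSn _).
  have We : W i.+1 (e ^+ i).
    by move=> l el; rewrite evalX (leq_trans (size_scale_leq _ _)) // size_polyXn.
  move=> /(_ We l0 el0); rewrite evalX size_scale ?expf_neq0 // size_polyXn.
  by rewrite ltnn.
by have := finV N.+1 W (fun i _ => Wsub i) (fun i _ => Wlt i); rewrite ltnn.
Qed.

End FiniteLength.

Section WittGroup.
Local Open Scope quotient_scope.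
Variables (k : fieldType) (Gm : finGroupType) (t : Gm).
Local Notation free := {malg int[fsymp k t]}.
Local Notation piSW := (\pi_(@Quotient.quot free (@SW_nullmod k Gm t))).

Lemma SW_pi_eq (p q : free) : SW_rel (p - q) -> piSW p = piSW q.
Proof.
move=> h; apply/eqP; rewrite -Quotient.idealrBE; apply/asboolP => I [_ _]; exact.
Qed.

Lemma SW_class_sum (U V W : fsymp k t) (h : 'M[k]_(sdim U, sdim V + sdim W)) :
  symp_sum_iso h -> SW_class U = SW_class V + SW_class W.
Proof.
move=> hiso; have /SW_pi_eq := SW_sum hiso.
by rewrite raddfD.
Qed.

Lemma SW_ind (P : SW k t -> Prop) : P 0 -> (forall a b, P a -> P b -> P (a + b)) ->
  (forall a, P a -> P (- a)) -> (forall V, P (SW_class V)) -> forall a, P a.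
Proof.
move=> P0 PD PN PV; elim/quotW => p.
rewrite [p]monalgE raddf_sum; elim/big_ind: _ => // V _.
have PMn a n : P a -> P (a *+ n).
  by move=> Pa; elim: n => [|n IHn]; rewrite ?mulr0n // mulrS; apply: PD.
have mulZ (z : int) : << z *g V >> = << V >> *~ z :> free.
  apply/malgP=> W; rewrite [RHS]raddfMz /= !mcoeffU.
  case: eqP => _ /=; last by rewrite mulr0n mul0rz.
  by rewrite mulr1n; exact: esym (intz z).
rewrite mulZ raddfMz; case: p@_V => n; first by apply: (PMn (SW_class V)); exact: PV.
by rewrite NegzE mulrNz; apply/PN/(PMn (SW_class V)); exact: PV.
Qed.

End WittGroup.

Section OrthogonalClasses.
Variables (k : closedFieldType) (gT : finGroupType).
Hypothesis charN2 : 2%N \notin [pchar k].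
Local Notation Gm := (gT * 'Z_2)%type.
Local Notation t := (parity gT).
Let char2 : (2 : k) != 0 := two_neq0 charN2.
Local Notation orth_class X := (SW_class (tpsi_f charN2 X)).

(** The Witt relations mention direct sums only. Both the isomorphism and the identity of [V] are
    read as decompositions with the zero object [O] as second summand, whence [U] = [V] + [O] =
    [V]. *)
Lemma SW_class_iso (U V : fsymp k t) (h : 'M[k]_(sdim U, sdim V)) (h' : 'M[k]_(sdim V, sdim U)) :
    h *m h' = 1%:M -> h' *m h = 1%:M ->
    (forall x, srep U x *m h = h *m srep V x) -> h^T *m sform U *m h = sform V ->
  SW_class U = SW_class V.
Proof.
pose O := tpsi_f charN2 (orth_triv k gT 0).
have isoO (U' V' : fsymp k t) (a : 'M[k]_(sdim U', sdim V')) (a' : 'M[k]_(sdim V', sdim U')) :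
    a *m a' = 1%:M -> a' *m a = 1%:M -> (forall x, srep U' x *m a = a *m srep V' x) ->
    a^T *m sform U' *m a = sform V' -> SW_class U' = SW_class V' + SW_class O.
  move=> aa' a'a ar af.
  apply: (SW_class_sum (U := U') (V := V') (W := O) (h := row_mx a 0)); split.
  - exists (col_mx a' 0); split; first by rewrite mul_row_col mul0mx addr0.
    rewrite mul_col_row a'a !mulmx0 mul0mx scalar_mx_block; congr block_mx.
    by rewrite [LHS]flatmx0 [RHS]flatmx0.
  - by move=> x; rewrite mul_mx_row ar mulmx0 mul_row_block !mulmx0 !mul0mx !addr0.
  rewrite tr_row_mx mul_col_mx mul_col_row af trmx0 !mulmx0 !mul0mx.
  by congr block_mx; rewrite [LHS]flatmx0 [RHS]flatmx0.
move=> hh' h'h hr hf; rewrite (isoO U V h h') //.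
apply/esym/(isoO V V 1%:M 1%:M); rewrite ?trmx1 ?mul1mx ?mulmx1 // => x.
by rewrite mulmx1 mul1mx.
Qed.

Lemma orth_class_sum (X Y : orthrep k gT) :
  orth_class (orth_sum X Y) = orth_class X + orth_class Y.
Proof.
apply: (SW_class_sum (U := tpsi_f charN2 (orth_sum X Y)) (V := tpsi_f charN2 X)
  (W := tpsi_f charN2 Y) (h := 1%:M)); split.
- by exists 1%:M; rewrite mulmx1.
- by move=> x; rewrite mulmx1 mul1mx /= /minus_mx scale_block_mx !scaler0.
by rewrite trmx1 mul1mx mulmx1.
Qed.

Lemma orth_class_trivS n :
  orth_class (orth_triv k gT n.+1) =
    orth_class (orth_triv k gT 1) + orth_class (orth_triv k gT n).
Proof.
rewrite -orth_class_sum.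
apply: (SW_class_iso (U := tpsi_f charN2 (orth_triv k gT n.+1))
  (V := tpsi_f charN2 (orth_sum (orth_triv k gT 1) (orth_triv k gT n))) (h := 1%:M) (h' := 1%:M)).
- exact: mulmx1.
- exact: mulmx1.
- move=> x; apply: etrans (mulmx1 _) (etrans _ (esym (mul1mx _))).
  by rewrite /= /minus_mx /=; congr (_ *: _); exact: (scalar_mx_block 1 n 1).
rewrite trmx1 mulmx1; apply: etrans (mul1mx _) _.
exact: (scalar_mx_block 1 n 1).
Qed.

Lemma orth_class_triv0 : orth_class (orth_triv k gT 0) = 0.
Proof.
have := orth_class_sum (orth_triv k gT 0) (orth_triv k gT 0).
set a := orth_class (orth_triv k gT 0) => e.
have : a = a + a.
  rewrite -{1}e; apply/esym.
  apply: (SW_class_iso (U := tpsi_f charN2 (orth_sum (orth_triv k gT 0) (orth_triv k gT 0)))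
    (V := tpsi_f charN2 (orth_triv k gT 0)) (h := 0) (h' := 0));
    by move=> *; rewrite [LHS]flatmx0 [RHS]flatmx0.
by rewrite -{1}[a]addr0 => /addrI.
Qed.

Lemma SW_class_orth (V : fsymp k t) : exists X, SW_class V = orth_class X.
Proof.
have rt : srep V t = - 1%:M := finite_length_odd charN2 (fsympP V).
pose r g := srep V (g, 1%g).
have r_repr : mx_repr [set: gT] r.
  split=> [|x y _ _]; first by rewrite /r (repr_mx1 (srep V)).
  by rewrite /r -repr_mxM ?inE //; congr (srep V (_, _)); rewrite mulg1.
have srepE x : srep V x = sgn k x *: r x.1.
  have [xE|xE] : x = (x.1, 1%g) \/ x = ((x.1, 1%g) * t)%g.
  - case: x => g [[|[|//]] a2]; [left|right]; congr pair; rewrite ?mulg1 //; exact: val_inj.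
  - by rewrite {1}xE /r {2}xE /sgn expr0 scale1r.
  rewrite [in LHS]xE repr_mxM ?inE // rt mulmxN mulmx1 [in sgn k x]xE /sgn /=.
  by rewrite expr1 scaleN1r.
(* Once [t] acts by -1 the braiding is minus the flip, so skewness for the braiding is ordinary
   symmetry. *)
have sym : (sform V)^T = sform V.
  apply/matrixP=> i j; have := @sform_skew _ _ _ V (delta_mx j i).
  rewrite rt /braiding; have Pt : (- 1%:M)^T = - 1%:M :> 'M[k]_(sdim V).
    by rewrite linearN /= trmx1.
  rewrite Pt !mulNmx !mul1mx !mulmxN !mulmx1 opprK addrN add0r -opprD -mulr2n.
  rewrite -scaler_nat scalerN scalerA mulVf // scale1r linearN /= trmx_delta.
  rewrite /form_eval mulmxN linearN /= => /oppr_inj.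
  have tr_delta (M : 'M[k]_(sdim V)) a b : \tr (M *m delta_mx a b) = M b a.
    rewrite /mxtrace (bigD1 b) //= big1 ?addr0 => [|c cb].
      rewrite mxE (bigD1 a) //= mxE !eqxx mulr1 big1 ?addr0 // => c ca.
      by rewrite mxE (negPf ca) mulr0.
    by rewrite mxE big1 // => e _; rewrite mxE (negPf cb) andbF mulr0.
  by rewrite !tr_delta !mxE.
have inv g : (r g)^T *m sform V *m r g = sform V by exact: sform_inv.
pose X := @OrthRep k gT _ (MxRepresentation r_repr) _ sym (sform_nondeg V) inv.
exists X.
apply: (SW_class_iso (U := V) (V := tpsi_f charN2 X) (h := 1%:M) (h' := 1%:M)).
- exact: mulmx1.
- exact: mulmx1.
- by move=> x; rewrite mulmx1 mul1mx srepE.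
by rewrite trmx1 mul1mx mulmx1.
Qed.

(** [sends_to_Weyl] evaluates [iota] only through a Weyl algebra at hand, so one has to be exhibited
    with its Azumaya property and group action. *)
Lemma weyl_orth_exists (X : orthrep k gT) :
  exists (A : azu k t) (pi : {lrmorphism tensalg k (odim X) -> A}),
    is_quotient (cliff_rel (2^-1 *: oform X)) pi /\
    forall x v, cact A x (pi (tens1 v)) = pi (tens1 (minus_mx (orep X) x *m v)).
Proof.
have half0 : 2^-1 != 0 :> k by rewrite invr_eq0.
have Qs := scale_form_sym 2^-1 (oform_sym X).
have Qu := scale_form_unit half0 (oform_nondeg X).
have [A0 [pi0 quot0]] := cliff_exists char2 Qs Qu.
have [x|B [pi [quot act]]] := cliff_action quot0 (minus_mx1 X) (minus_mxM X).
  rewrite -[_ *m (2^-1 *: _)]scalemxAr -[(2^-1 *: _) *m _]scalemxAl.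
  by congr (_ *: _); exact: (tpsi_inv X x).
have azB : azumaya t B.
  apply: (cliff_azumaya char2 Qs Qu quot) => v.
  by rewrite act minus_mxt mulNmx mul1mx !linearN.
by exists (Azu azB), pi.
Qed.

Lemma weyl_orthP (X : orthrep k gT) (A : calg k Gm) (pi : {lrmorphism tensalg k (odim X) -> A}) :
  is_quotient (cliff_rel (2^-1 *: oform X)) pi ->
  (forall x v, cact A x (pi (tens1 v)) = pi (tens1 (minus_mx (orep X) x *m v))) ->
  is_weyl (tpsi charN2 X) A.
Proof. by move=> quot act; exists pi; split=> //; apply/weyl_quotientP. Qed.

End OrthogonalClasses.

(** * Values and image of [iota] *)

Section Iota.
Variables (k : closedFieldType) (gT : finGroupType).
Hypothesis charN2 : 2%N \notin [pchar k].
Local Notation Gm := (gT * 'Z_2)%type.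
Local Notation t := (parity gT).
Let char2 : (2 : k) != 0 := two_neq0 charN2.
Local Notation orth_class X := (SW_class (tpsi_f charN2 X)).
Local Notation triv n := (orth_triv k gT n).
Variables (Br : groupType) (cls : azu k t -> Br).
Hypothesis Br_brauer : is_brauer_group cls.
Variable Phi : Br -> H2star k gT * mu2 k.
Hypothesis Phi_id : is_identification cls Phi.
Variable iota : SW k t -> Br.
Hypothesis iota_inj : injective iota.
Hypothesis iota_Weyl : sends_to_Weyl cls iota.

Let PhiM a b : Phi (a * b)%g = (Phi a * Phi b)%g.
Proof. by case: Phi_id. Qed.

Let Phi1 : Phi 1%g = 1%g.
Proof. by apply: (mulgI (Phi 1%g)); rewrite -PhiM !mulg1. Qed.

Lemma iota_weyl_orth (X : orthrep k gT) (A : azu k t)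
    (pi : {lrmorphism tensalg k (odim X) -> A}) :
  is_quotient (cliff_rel (2^-1 *: oform X)) pi ->
  (forall x v, cact A x (pi (tens1 v)) = pi (tens1 (minus_mx (orep X) x *m v))) ->
  iota (orth_class X) = cls A.
Proof.
move=> quot act; apply: (iota_Weyl (V := tpsi_f charN2 X)).
exact: (weyl_orthP charN2 quot act).
Qed.

(** The Brauer class turns the tensor product of Weyl algebras into a product; no additivity of
    [iota] enters. *)
Lemma iota_orth_sum (X Y : orthrep k gT) :
  iota (orth_class (orth_sum X Y)) = (iota (orth_class X) * iota (orth_class Y))%g.
Proof.
have [A [piA [quotA actA]]] := weyl_orth_exists charN2 X.
have [B [piB [quotB actB]]] := weyl_orth_exists charN2 Y.
have [C [piC [quotC actC]]] := weyl_orth_exists charN2 (orth_sum X Y).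
rewrite (iota_weyl_orth quotA actA) (iota_weyl_orth quotB actB) (iota_weyl_orth quotC actC).
have [_ _ tensorP] := Br_brauer; apply: tensorP.
have half0 : 2^-1 != 0 :> k by rewrite invr_eq0.
have quotC' : is_quotient
    (cliff_rel (block_mx (2^-1 *: oform X) 0 0 (2^-1 *: oform Y))) piC.
  by have := quotC; rewrite /= scale_block_mx !scaler0.
have actC' x v : cact C x (piC (tens1 v)) =
    piC (tens1 (block_mx (minus_mx (orep X) x) 0 0 (minus_mx (orep Y) x) *m v)).
  have e : minus_mx (orep (orth_sum X Y)) x =
      block_mx (minus_mx (orep X) x) 0 0 (minus_mx (orep Y) x).
    by rewrite /= /minus_mx scale_block_mx !scaler0.
  by move: (actC x v); rewrite e.
apply: (cliff_tensor char2
  (scale_form_sym _ (oform_sym X)) (scale_form_unit half0 (oform_nondeg X))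
  (scale_form_sym _ (oform_sym Y)) (scale_form_unit half0 (oform_nondeg Y)) quotA quotB quotC'
  actA actB actC').
- exact: minus_mxt.
exact: minus_mxt.
Qed.

Lemma iota_orthD (X Y : orthrep k gT) :
  iota (orth_class X + orth_class Y) = (iota (orth_class X) * iota (orth_class Y))%g.
Proof. by rewrite -orth_class_sum iota_orth_sum. Qed.

Lemma iota0 : iota 0 = 1%g.
Proof.
have := iota_orthD (triv 0) (triv 0); rewrite orth_class_triv0 addr0 => e.
by apply: (mulgI (iota 0)); rewrite -e mulg1.
Qed.

Lemma orth_classMn (X : orthrep k gT) n : exists Y, orth_class X *+ n = orth_class Y /\
  iota (orth_class Y) = (iota (orth_class X) ^+ n)%g.
Proof.
elim: n => [|n [Y [YE iY]]].
  by exists (triv 0); rewrite orth_class_triv0 iota0.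
by exists (orth_sum X Y); rewrite mulrS YE orth_class_sum iota_orthD iY expgS.
Qed.

(* The group H2star x mu2 has finite exponent and iota is injective, hence every
   class [X (x) psi] is torsion. *)
Lemma orth_class_opp (X : orthrep k gT) : exists Y, - orth_class X = orth_class Y.
Proof.
have [N HN] := H2star_exponent k gT.
(* The exponent [2 * N.+1] kills both factors of the target, so M [X] is the opposite of [X]. *)
pose M := (2 * N.+1).-1.
have ME : M.+1 = (2 * N.+1)%N by rewrite prednK.
have [Z [ZE iZ]] := orth_classMn X M.+1.
have [Y [YE _]] := orth_classMn X M.
have Phi_inj : injective Phi by case: Phi_id => /bij_inj.
have PhiX b n : Phi (b ^+ n)%g = ((Phi b).1 ^+ n, (Phi b).2 ^+ n)%g.
  elim: n => [|n IHn]; first exact: Phi1.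
  by rewrite !expgS PhiM IHn.
have Z0 : orth_class Z = 0.
  apply/iota_inj/Phi_inj; rewrite iZ iota0 PhiX Phi1 ME mulnC expgnA HN expg1n.
  rewrite mulnC expgnA expg2; congr pair.
  have -> : ((Phi (iota (orth_class X))).2 * (Phi (iota (orth_class X))).2 = 1)%g.
    by apply: val_inj; rewrite /= -expr2 mu2P.
  by rewrite expg1n.
by exists Y; rewrite -YE; apply/eqP; rewrite eq_sym -addr_eq0 -mulrSr ZE Z0.
Qed.

Lemma SW_orth (a : SW k t) : exists X, a = orth_class X.
Proof.
move: a; apply: SW_ind => [|a b [X ->] [Y ->]|a [X ->]|V].
- by exists (triv 0); rewrite orth_class_triv0.
- by exists (orth_sum X Y); rewrite orth_class_sum.
- exact: orth_class_opp.
exact: SW_class_orth.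
Qed.

Lemma iotaD a b : iota (a + b) = (iota a * iota b)%g.
Proof.
by have [[X ->] [Y ->]] := (SW_orth a, SW_orth b); exact: iota_orthD.
Qed.

Lemma iota_triv1 : Phi (iota (orth_class (triv 1))) = (1%g, mu2_sign k 1).
Proof.
have [A [pi [quot act]]] := weyl_orth_exists charN2 (triv 1).
rewrite (iota_weyl_orth quot act).
have [_ _ _ _ cliff1] := Phi_id; apply: cliff1.
have half0 : 2^-1 != 0 :> k by rewrite invr_eq0.
have Qs := scale_form_sym 2^-1 (oform_sym (triv 1)).
have Qu := scale_form_unit half0 (oform_nondeg (triv 1)).
(* Because the form is halved, the unit vector has square 1/2, and its multiple by a square root of
   2 has square 1. *)
have [s ss] := closed_sqrt (2 : k).
have s0 : s != 0 by apply: contraNneq char2 => s0; rewrite -ss s0 mulr0.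
pose xi := pi (tens1 (s *: (1%:M : 'cV_1))).
have xi2 : xi * xi = 1.
  rewrite /xi (cliff_sqr quot) /qform [(s *: _)^T]linearZ /= trmx1.
  rewrite -scalemxAr mulmx1 -scalemxAl mul1mx !scalerA !mxE eqxx mulr1n mulr1.
  by rewrite ss mulfV ?scale1r.
exists xi; split=> //.
- rewrite basisEdim /= (cliff_dim char2 Qs Qu quot) andbT.
  apply/subvP=> a _; move: a.
  apply: (cliff_ind quot) => [|c a b ha hb||v a ha].
  + exact: mem0v.
  + by rewrite memvD ?memvZ.
  + by rewrite memv_span ?mem_head.
  have -> : pi (tens1 v) = (s^-1 * v 0 0) *: xi.
    rewrite /xi -(linearZ_LR pi) -(linearZ_LR (@tens1 k 1)); congr (pi (tens1 _)).
    by apply/matrixP=> i j; rewrite !ord1 !mxE /= mulr1 mulrAC mulVf // mul1r.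
  rewrite -scalerAl memvZ //.
  have : (<<[:: 1%R; xi]>> <= amull xi @^-1: <<[:: 1%R; xi]>>)%VS.
    apply/span_subvP=> y; rewrite !inE -memv_preim lfunE /= => /orP[] /eqP ->.
      by rewrite mulr1 memv_span // !inE eqxx orbT.
    by rewrite xi2 memv_span // !inE eqxx.
  by move/subvP/(_ a ha); rewrite -memv_preim lfunE.
move=> x; rewrite /xi act -(linearZ_LR pi) -(linearZ_LR (@tens1 k 1)).
by rewrite /= /minus_mx -scalemxAl mul1mx.
Qed.

Lemma iota_triv n : Phi (iota (orth_class (triv n))) = (1%g, mu2_sign k n).
Proof.
elim: n => [|n IHn].
  by rewrite orth_class_triv0 iota0 Phi1; congr pair; apply: val_inj.
rewrite orth_class_trivS iotaD PhiM IHn iota_triv1.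
by congr pair; [rewrite /= mulg1|apply: val_inj; rewrite /= -exprD].
Qed.

Lemma iota_tilde (X : orthrep k gT) :
  Phi (iota (orth_class (orth_sum X (triv (odim X))))) = (betaX X, 1%g).
Proof.
have bE b : is_beta X b ->
    Phi (iota (orth_class (orth_sum X (triv (odim X))))) = (H2class b, 1%g).
  move=> /(is_beta_projEnd charN2)[A [wA pA]].
  by rewrite (iota_Weyl (V := tpsi_f charN2 _) wA); case: Phi_id => _ _ _ + _; apply.
have [b bX] := is_beta_exists char2 X.
(* Existence of a factor system excludes the default of [xget], so the chosen class comes from some
   [b'] to which [bE] applies. *)
have [|b' b'X b'E] := @xgetPex _ 1%g [set c | exists2 b, is_beta X b & c = H2class b]%classic.
  by exists (H2class b), b.
by rewrite /betaX b'E -(bE b').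
Qed.

Lemma iota_orth (X : orthrep k gT) :
  Phi (iota (orth_class X)) = (betaX X, mu2_sign k (odim X)).
Proof.
have e : (Phi (iota (orth_class X)) * (1%g, mu2_sign k (odim X)))%g = (betaX X, 1%g).
  by rewrite -iota_triv -PhiM -iotaD -orth_class_sum iota_tilde.
have s2 : (mu2_sign k (odim X) * mu2_sign k (odim X))%g = 1%g.
  by apply: val_inj; rewrite /= -expr2 (mu2P (mu2_sign k (odim X))).
have := congr1 (fun p => p * (1%g, mu2_sign k (odim X)))%g e.
rewrite -mulgA.
have -> : ((1, mu2_sign k (odim X)) * (1, mu2_sign k (odim X)) = 1 :> H2star k gT * mu2 k)%g.
  by congr pair; [exact: mulg1|exact: s2].
by rewrite mulg1 => ->; congr pair; [exact: mulg1|exact: mul1g].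
Qed.

(** The image is a subgroup. It contains every (beta_X, 1), through X (+) k^(dim X), and every (1,
    +-1), through trivial representations; these generate the product. *)
Lemma iota_image :
  ([set Phi (iota s) | s in [set: SW k t]] = @SWplus k gT `*` [set: mu2 k])%classic.
Proof.
apply/seteqP; split=> [_ [s _ <-]|[c z] [/= cP _]].
  have [X ->] := SW_orth s; rewrite iota_orth; split=> //= K [_ _ _]; exact.
pose img := [set Phi (iota s) | s in [set: SW k t]]%classic.
have imgM p q : img p -> img q -> img (p * q)%g.
  by move=> [a _ <-] [b _ <-]; exists (a + b) => //; rewrite iotaD PhiM.
have img1 : img 1%g by exists 0 => //; rewrite iota0.
have imgs n : img (1%g, mu2_sign k n) by exists (orth_class (triv n)) => //; exact: iota_triv.
have imgV p : img p -> img p^-1%g.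
  move=> [a _ <-]; exists (- a) => //; apply: (mulgI (Phi (iota a))).
  by rewrite -PhiM -iotaD subrr iota0 Phi1 mulgV.
have imgc : img (c, 1%g).
  apply: (cP (fun c => img (c, 1%g))); split=> [|a b ha hb|a ha|X].
  - exact: img1.
  - by have := imgM _ _ ha hb; congr (img (_, _)); rewrite /= mulg1.
  - by have := imgV _ ha; congr (img (_, _)); rewrite /= invg1.
  by rewrite -iota_tilde; exists (orth_class (orth_sum X (triv (odim X)))).
have [n ->] : exists n, z = mu2_sign k n.
  have := mu2P z; move/eqP; rewrite sqrf_eq1 => /orP[] /eqP e.
    by exists 0%N; apply: val_inj; rewrite /= e.
  by exists 1%N; apply: val_inj; rewrite /= e.
by have := imgM _ _ imgc (imgs n); congr (img (_, _)); rewrite /= ?mulg1 ?mul1g.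
Qed.

End Iota.

Theorem proposition3p10 (k : closedFieldType) (gT : finGroupType)
    (char2 : 2%N \notin [pchar k])
    (charG : forall p : nat, p \in [pchar k] -> coprime #|gT| p)
    (Br : groupType) (cls : azu k (parity gT) -> Br)
    (Br_brauer : is_brauer_group cls)
    (Phi : Br -> H2star k gT * mu2 k)
    (Phi_identification : is_identification cls Phi)
    (iota : SW k (parity gT) -> Br)
    (iota_inj : injective iota)
    (iota_Weyl : sends_to_Weyl cls iota) :
  [/\ forall X : orthrep k gT,
        Phi (iota (SW_class (tpsi_f char2 X)))
          = (betaX X, mu2_sign k (odim X)),
      forall a b, iota (a + b) = (iota a * iota b)%g
    & ([set Phi (iota s) | s in [set: SW k (parity gT)]]
        = @SWplus k gT `*` [set: mu2 k])%classic].
Proof.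
split.
- by move=> X; exact: (iota_orth char2 Br_brauer Phi_identification iota_inj iota_Weyl X).
- exact: (iotaD char2 Br_brauer Phi_identification iota_inj iota_Weyl).
exact: (iota_image char2 Br_brauer Phi_identification iota_inj iota_Weyl).
Qed.
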